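(* Let $G \subset \mathbb{C}$ be a simply connected domain and let $(\varphi_n)_{n\in\mathbb{N}}$ be a strongly frequently runaway sequence of univalent holomorphic self-maps $\varphi_n : G \to G$. Then the set $FHC((C_{\varphi_n})_n)$ is spaceable in $H(G)$; that is, there exists a closed infinite dimensional vector subspace $M\subset H(G)$ such that $M\subset FHC((C_{\varphi_n})_n)\cup\{0\}$.
   Context: $\mathbb{N}=\{1,2,3,\dots\}$. A domain is a nonempty connected open subset of $\mathbb{C}$; a domain $G$ (possibly $G=\mathbb{C}$) is simply connected if $\mathbb{C}_\infty\setminus G$ is connected, where $\mathbb{C}_\infty=\mathbb{C}\cup\{\infty\}$ is the one-point compactification of $\mathbb{C}$. $H(G)$ is the space of holomorphic functions $G\to\mathbb{C}$ with the topology of uniform convergence on compact subsets of $G$. For a holomorphic map $\varphi:G\to G$, the composition operator is $C_\varphi: H(G)\to H(G)$, $C_\varphi f = f\circ\varphi$. Univalent means one-to-one. For $A\subset\mathbb{N}$, the lower density is $\underline{\rm dens}(A)=\liminf_{n\to\infty}\frac{{\rm card}(A\cap\{1,\dots,n\})}{n}$. For a sequence $(T_n)_n$ of continuous linear maps $X\to Y$ between topological vector spaces, a vector $x_0\in X$ is frequently hypercyclic for $(T_n)_n$ if $\underline{\rm dens}(\{n\in\mathbb{N}: T_n x_0\in V\})>0$ for every nonempty open set $V\subset Y$; $FHC((T_n)_n)$ is the set of such vectors. A sequence $(K_\nu)_{\nu\in\mathbb{N}}$ of compact subsets of $G$ is exhaustive if $G=\bigcup_{\nu} K_\nu$ and $K_\nu$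 is contained in the interior of $K_{\nu+1}$ for all $\nu$. $\mathcal{M}(G)$ is the family of compact sets $K\subset G$ such that $\mathbb{C}\setminus K$ is connected. A sequence $(\varphi_n)_n$ of holomorphic self-maps of $G$ is strongly frequently runaway if there exist an exhaustive sequence $(K_\nu)_{\nu}\subset\mathcal{M}(G)$ and a family $\{A(\nu):\nu\in\mathbb{N}\}$ of subsets of $\mathbb{N}$ such that: (P1) $\underline{\rm dens}(A(\nu))>0$ for all $\nu\in\mathbb{N}$; (P2) the sets $A(\nu)$ ($\nu\in\mathbb{N}$) are pairwise disjoint, and the sets $\varphi_n(K_\nu)$ ($\nu\in\mathbb{N}$, $n\in A(\nu)$) are pairwise disjoint (i.e. sets corresponding to different indices $\nu$, respectively to different index pairs $(n,\nu)$, are disjoint); (P3) for every compact $K\subset G$ there are only finitely many pairs $(n,\nu)$ with $\nu\in\mathbb{N}$, $n\in A(\nu)$ and $K\cap\varphi_n(K_\nu)\neq\varnothing$. *)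

(* Defs.v *)
From HB Require Import structures.
From mathcomp Require Import all_boot all_order all_algebra.
From mathcomp Require Import finmap complex.
From mathcomp Require Import all_classical all_reals all_analysis.
Set Implicit Arguments.
Unset Strict Implicit.
Unset Printing Implicit Defensive.
Import Order.TTheory GRing.Theory Num.Theory.
Import numFieldNormedType.Exports.
Local Open Scope classical_set_scope.
Local Open Scope ring_scope.

(* The complex plane is [R[i]^o] for a [realType] R: the suffix [^o] gives
   access to the topology of the modulus and to the structure of normed module
   over R[i], so that derivability over [R[i]^o] is complex derivability. *)

(* A sequence indexed by {1, 2, 3, ...} is represented by a function on [nat]
   whose value at k is the term of index k + 1, and a set of positive integers
   by the set of the predecessors of its elements. Thus {1, ..., n + 1} becomes
   [`I_n.+1], that is {0, ..., n}. *)

Definition lower_density (R : realType) (A : set nat) : \bar R :=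
  limn_einf (fun n => (#|` fset_set (A `&` `I_n.+1)|%:R / n.+1%:R)%:E).

Definition FHC (R : realType) (X : Type) (Y : topologicalType)
    (T : nat -> X -> Y) : set X :=
  [set x | forall V : set Y, open V -> V !=set0 ->
     (0 < lower_density R [set n | V (T n x)])%E].

Definition finite_dimensional (K : fieldType) (X : lmodType K) (M : set X) :=
  exists (n : nat) (b : 'I_n -> X), (forall i, M (b i)) /\
    forall x, M x -> exists c : 'I_n -> K, x = \sum_(i < n) c i *: b i.

Definition spaceable (K : numFieldType) (X : preTopologicalLmodType K)
    (A : set X) :=
  exists M : set X,
    [/\ submod_closed (mem M), closed M, ~ finite_dimensional M
      & M `<=` A `|` [set 0]].

Definition simply_connected (T : topologicalType) (G : set T) :=
  connected (~` (Some @` G) : set (one_point_compactification T)).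

Definition exhaustive (T : topologicalType) (K : nat -> set T) :=
  [/\ forall nu, compact (K nu), \bigcup_nu K nu = [set: T]
    & forall nu, K nu `<=` (K nu.+1)°].

Section holomorphic.
Context (R : realType) (G : set R[i]^o).

(* The functions on G are extended by 0; this does not affect derivability at
   the points of an open set G. *)
Definition holomorphic (f : G -> R[i]^o) :=
  forall z : R[i]^o, G z -> derivable ('valL_(0 : R[i]^o) f) z 1.

Definition hol_pred : {pred G -> R[i]^o} := [pred f | `[< holomorphic f >]].

Lemma hol_submod_closed : submod_closed hol_pred.
Proof.
split=> [|a f g /asboolP hf /asboolP hg]; apply/asboolP => z Gz.
- rewrite (_ : 'valL_0 _ = cst 0); first exact: derivable_cst.
  by apply/funext => w /=; case: ('oinv_set_val w).
- rewrite (_ : 'valL_0 _ = a \*: 'valL_(0 : R[i]^o) f + 'valL_(0 : R[i]^o) g).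
    by apply: derivableD; [apply: derivableZ; exact: hf|exact: hg].
  apply/funext => w; rewrite /= /GRing.add/=.
  by case: ('oinv_set_val w) => //=; rewrite scaler0 addr0.
Qed.

HB.instance Definition _ :=
  GRing.isSubmodClosed.Build R[i] (G -> R[i]^o) hol_pred hol_submod_closed.

Record hol := Hol { hol_fun :> G -> R[i]^o; _ : hol_fun \in hol_pred }.

HB.instance Definition _ := [isSub for hol_fun].
HB.instance Definition _ := [Choice of hol by <:].
HB.instance Definition _ := [SubChoice_isSubLmodule of hol by <:].

Lemma holP (f : hol) : holomorphic f.
Proof. by apply/asboolP; exact: (valP f). Qed.

(* [hol] is the space H(G): its topology is induced by that of uniform
   convergence on the compact subsets of G. *)
HB.instance Definition _ := Uniform.copy hol
  (initial_topology (hol_fun : hol -> {family compact, G -> R[i]^o})).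

Lemma near_derivable (f g : R[i]^o -> R[i]^o) (z : R[i]^o) :
  (\forall w \near z, f w = g w) -> derivable f z 1 -> derivable g z 1.
Proof.
move=> fg df; have fgz : f z = g z by exact: nbhs_singleton fg.
apply/cvg_ex; exists ('D_1 f z); apply: cvg_trans df; apply: near_eq_cvg.
apply: cvg_within; move: fg; rewrite near_simpl => /nbhs_ballP[e e0 fg].
apply/nbhs_ballP; exists e => // h; rewrite /ball /= sub0r normrN => he.
rewrite fgz; congr (_ *: (_ - _)); apply: fg.
by rewrite /ball /= opprD addrCA subrr addr0 normrN [_ *: _]mulr1.
Qed.

Lemma comp_holomorphic (phi : G -> G) (f : G -> R[i]^o) :
  open G -> holomorphic (set_val \o phi) -> holomorphic f ->
  holomorphic (f \o phi).
Proof.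
move=> oG hphi hf z Gz.
pose P := 'valL_(0 : R[i]^o) (set_val \o phi).
pose F := 'valL_(0 : R[i]^o) f.
have valE (g : G -> R[i]^o) w (Gw : w \in G) :
    'valL_(0 : R[i]^o) g w = g (SigSub Gw).
  by rewrite -[in RHS](valLK 0 g).
have GP w : G w -> G (P w).
  by move=> /mem_set Gw; rewrite /P (valE _ _ Gw); exact/set_mem/valP.
apply: (@near_derivable (F \o P)).
  have : nbhs z G by exact: open_nbhs_nbhs.
  apply: filterS => w Gw; have Pw := mem_set (GP _ Gw).
  change (F (P w) = 'valL_(0 : R[i]^o) (f \o phi) w).
  rewrite /F (valE _ _ Pw) (valE _ _ (mem_set Gw)); congr f.
  by apply: val_inj; rewrite [LHS]/= /P (valE _ _ (mem_set Gw)).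
apply/derivable1_diffP/differentiable_comp.
  exact/derivable1_diffP/hphi.
exact/derivable1_diffP/hf/GP.
Qed.

End holomorphic.

(* The composition operator f |-> f \o phi on H(G). *)
Definition comp_op (R : realType) (G : set R[i]^o) (oG : open G)
    (phi : G -> G) (hphi : holomorphic (set_val \o phi)) (f : hol G) : hol G :=
  Hol (asboolT (comp_holomorphic oG hphi (@holP _ _ f))).

(* The compact subsets of G whose complement in the plane is connected. *)
Definition compl_connected_compact (R : realType) (G : set R[i]^o) :
    set (set G) :=
  [set K | compact K /\ connected (~` (set_val @` K))].

(* The subsets of G are handled as sets over the topological space G itself;
   since G is open, compactness and interior agree with those in the plane. *)
Definition strongly_frequently_runaway (R : realType) (G : set R[i]^o)
    (phi : nat -> G -> G) :=
  exists (K : nat -> set G) (A : nat -> set nat),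
    [/\ exhaustive K, forall nu, compl_connected_compact (K nu)
      & [/\ forall nu, (0 < lower_density R (A nu))%E,
            trivIset [set: nat] A,
            trivIset [set p : nat * nat | A p.2 p.1]
              (fun p => phi p.1 @` K p.2)
          & forall L : set G, compact L ->
              finite_set [set p : nat * nat |
                A p.2 p.1 /\ L `&` phi p.1 @` K p.2 !=set0]]].

(* Main.v *)
(** Fix a disc B in G. For l = 0, 1, 2, ... we construct f_l in H(G) such that
    f_l is close to ((z - z0) / s)^l on B and such that, for all n in A(nu) but
    finitely many, f_l o phi_n is within 2^-(l + nu) on K_nu of the polynomial
    P_nu when nu has label l, and of 0 otherwise; here the indices nu are
    labelled so that every pair (l, P), P a polynomial with rational complex
    coefficients, occurs infinitely often. This is possible by Carleman
    approximation: the sets phi_n(K_nu) are pairwise disjoint, locally finite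
    and polynomially convex, so that f_l can be found as a limit of polynomials
    given by Runge's theorem.

    M is the closed linear span of the f_l. The f_l being a perturbation of
    ((z - z0) / s)^l on B, a function f of M has coefficients c_l which are
    controlled by its supremum on B, and some c_l is nonzero when f is nonzero,
    by the identity theorem. For nu with label (l, P), f o phi_n is then as
    close to c_l P on K_nu as 2^-nu, whence f is frequently hypercyclic.

    Complex analysis is derived from Goursat's lemma on rectangles. Polynomial
    convexity replaces connectedness of complements: the main tool is that b is
    not in the hull of K as soon as 1 / (w - b) is approximable near K by
    functions having primitives. *)

(* Connectedness of the complement of [phi_n(K_nu)] is not readily transported through [phi_n],
   whereas polynomial convexity is a statement about approximation, and approximants can be pulled
   back along the inverse map. The hypothesis on the [K_nu] is therefore used only through their
   hulls. The tolerance 2^-(l + nu) plays two roles. Summed over l, it lets a combination with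
   bounded coefficients see on [phi_n(K_nu)] only the member whose index is the label of nu. The sum
   is of order 2^-nu, so a label must recur with nu as large as desired, large enough also for
   [K_nu] to contain a given compact set. The disc prevents degeneracy in the closure: the
   coefficients of combinations converging to f might otherwise blow up or have no limit. There the
   perturbations are summable, and so small that Cauchy integrals still recover the coefficients.
   For each nu, the finitely many n for which [phi_n(K_nu)] meets the disc are given up; positivity
   of the lower density survives this. *)
Require Import Defs.
From HB Require Import structures.
From mathcomp Require Import all_boot all_order all_algebra.
From mathcomp Require Import finmap complex.
From mathcomp Require Import ring lra.
From mathcomp Require Import all_classical all_reals all_analysis.
Set Implicit Arguments.
Unset Strict Implicit.
Unset Printing Implicit Defensive.
Import Order.TTheory GRing.Theory Num.Theory.
Import numFieldNormedType.Exports.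
Local Open Scope classical_set_scope.
Local Open Scope ring_scope.

(** * The modulus and the topology of the plane *)

(* The norm of [R[i]] takes its values in [R[i]]; [nrm] is the modulus with
   values in [R]. *)
Notation nrm := (@Normc.normc _).
Notation rc := (real_complex _).
Notation Cre := (@complex.Re _).
Notation Cim := (@complex.Im _).
Notation ii := (Complex 0 1).

Section modulus.
Context {R : realType}.
Implicit Types z w : R[i].

Lemma nrmE z : `|z| = rc (nrm z).
Proof. by rewrite normc_def; case: z. Qed.

Lemma nrm_ge0 z : 0 <= nrm z. Proof. by case: z => a b; exact: sqrtr_ge0. Qed.
Lemma nrm0 : nrm (0 : R[i]) = 0. Proof. exact: Normc.normc0. Qed.
Lemma nrm1 : nrm (1 : R[i]) = 1. Proof. exact: Normc.normc1. Qed.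
Lemma nrmM z w : nrm (z * w) = nrm z * nrm w. Proof. exact: Normc.normcM. Qed.
Lemma nrmV z : nrm z^-1 = (nrm z)^-1. Proof. exact: Normc.normcV. Qed.
Lemma nrmN z : nrm (- z) = nrm z. Proof. exact: normcN. Qed.
Lemma nrmD z w : nrm (z + w) <= nrm z + nrm w. Proof. exact: le_normcD. Qed.
Lemma nrmBC z w : nrm (z - w) = nrm (w - z).
Proof. by rewrite -nrmN opprB. Qed.
Lemma nrmB z w : nrm (z - w) <= nrm z + nrm w.
Proof. by rewrite -(nrmN w); exact: nrmD. Qed.
Lemma nrm_tri u z w : nrm (z - w) <= nrm (z - u) + nrm (u - w).
Proof. by rewrite -[z - w](subrKA u); exact: nrmD. Qed.
Lemma nrm_sub z w : nrm z - nrm w <= nrm (z - w).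
Proof. by rewrite lerBlDr -{1}(subrK w z); exact: nrmD. Qed.
Lemma nrmX z n : nrm (z ^+ n) = nrm z ^+ n.
Proof. by elim: n => [|n IH]; rewrite ?expr0 ?nrm1// !exprS nrmM IH. Qed.
Lemma nrm_eq0 z : (nrm z == 0) = (z == 0).
Proof.
apply/eqP/eqP => [|->]; [exact: Normc.eq0_normc|exact: nrm0].
Qed.
Lemma nrm_gt0 z : (0 < nrm z) = (z != 0).
Proof. by rewrite lt_def nrm_ge0 andbT nrm_eq0. Qed.
Lemma nrm_real (x : R) : nrm (rc x : R[i]) = `|x|.
Proof. by rewrite /= expr0n addr0 sqrtr_sqr. Qed.
Lemma nrm_nat n : nrm (n%:R : R[i]) = n%:R.
Proof. by rewrite -(rmorph_nat (real_complex R)) nrm_real ger0_norm. Qed.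
Lemma nrm_i : nrm (ii : R[i]) = 1.
Proof. by rewrite /= expr0n/= add0r expr1n sqrtr1. Qed.
Lemma nrm_sum I (s : seq I) (P : pred I) (F : I -> R[i]) :
  nrm (\sum_(i <- s | P i) F i) <= \sum_(i <- s | P i) nrm (F i).
Proof.
elim/big_ind2 : _ => [|x1 x2 y1 y2 h1 h2|//]; first by rewrite nrm0.
exact: le_trans (nrmD _ _) (lerD h1 h2).
Qed.
Lemma nrm_Re z : `|Cre z| <= nrm z.
Proof.
case: z => a b; rewrite -(sqrtr_sqr a) /= ler_wsqrtr// lerDl sqr_ge0//.
Qed.
Lemma nrm_Im z : `|Cim z| <= nrm z.
Proof.
case: z => a b; rewrite -(sqrtr_sqr b) /= ler_wsqrtr// lerDr sqr_ge0//.
Qed.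
Lemma nrm_ReIm z : nrm z <= `|Cre z| + `|Cim z|.
Proof.
case: z => a b /=; have h : 0 <= `|a| + `|b| by rewrite addr_ge0.
rewrite -[leRHS](ger0_norm h) -(sqrtr_sqr (_ + _)) ler_wsqrtr//.
rewrite sqrrD !real_normK ?num_real// lerD2r lerDl mulrn_wge0// mulr_ge0//.
Qed.
Lemma CreD z w : Cre (z + w) = Cre z + Cre w. Proof. by case: z; case: w. Qed.
Lemma CimD z w : Cim (z + w) = Cim z + Cim w. Proof. by case: z; case: w. Qed.
Lemma CreN z : Cre (- z) = - Cre z. Proof. by case: z. Qed.
Lemma CimN z : Cim (- z) = - Cim z. Proof. by case: z. Qed.
Lemma CreB z w : Cre (z - w) = Cre z - Cre w. Proof. by rewrite CreD CreN. Qed.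
Lemma CimB z w : Cim (z - w) = Cim z - Cim w. Proof. by rewrite CimD CimN. Qed.
Lemma CreM z w : Cre (z * w) = Cre z * Cre w - Cim z * Cim w.
Proof. by case: z; case: w. Qed.
Lemma CimM z w : Cim (z * w) = Cre z * Cim w + Cim z * Cre w.
Proof. by case: z => a b; case: w => c d. Qed.

Lemma eq_ReIm z w : Cre z = Cre w -> Cim z = Cim w -> z = w.
Proof. by case: z w => a b [c d] /= -> ->. Qed.

Lemma nrm_le0 z : (forall e, 0 < e -> nrm z <= e) -> z = 0.
Proof.
move=> h; apply/eqP; rewrite -nrm_eq0; apply/negPn/negP => z0.
have h0 : 0 < nrm z by rewrite lt_def z0 nrm_ge0.
by have := h (nrm z / 2) (divr_gt0 h0 (ltr0Sn _ 1)); lra.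
Qed.

Lemma nrm_invB z w (d : R) : 0 < d -> d <= nrm (z - w) -> nrm (z - w)^-1 <= d^-1.
Proof. by move=> d0 h; rewrite nrmV lef_pV2 ?posrE//; exact: lt_le_trans h. Qed.

End modulus.

(** * Bisection arguments on intervals and rectangles *)

Section bisection.
Context {R : realType}.

Lemma ex_pow2_lt (l d : R) : 0 < d -> exists n, l / 2 ^+ n < d.
Proof.
move=> d0; exists (Num.truncn `|l / d|).+1.
rewrite ltr_pdivrMr ?exprn_gt0// mulrC -ltr_pdivrMr//.
apply: le_lt_trans (ler_norm _) _; apply: lt_trans (truncnS_gt _) _.
by rewrite -natrX ltr_nat ltn_expl.
Qed.

Lemma nested_itv (a b : nat -> R) : (forall n, a n <= a n.+1) ->
  (forall n, b n.+1 <= b n) -> (forall n, a n <= b n) ->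
  exists x, forall n, a n <= x <= b n.
Proof.
move=> ha hb hab.
have ham : {homo a : m n / (m <= n)%N >-> m <= n} by apply: homo_leq => // y x z; exact: le_trans.
have hbm : {homo b : m n / (m <= n)%N >-> n <= m}.
  by apply: homo_leq => // y x z h1 h2; exact: le_trans h2 h1.
have key m n : a m <= b n.
  apply: le_trans (ham _ _ (leq_maxl m n)) _; apply: le_trans (hab _) _.
  exact: hbm (leq_maxr m n).
have hs : has_sup (range a).
  by split; [exists (a 0); exists 0 | exists (b 0) => _ [m _ <-]].
exists (sup (range a)) => n; apply/andP; split.
  by apply: ub_le_sup; [exact: hs.2|exists n].
by apply: ge_sup; [exact: hs.1|move=> _ [m _ <-]].
Qed.

(* Cousin's lemma for rectangles. *)
Lemma rect_bisection (P : R -> R -> R -> R -> Prop) (x0 x1 y0 y1 : R) :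
  x0 <= x1 -> y0 <= y1 ->
  (forall a b c d, x0 <= a -> a <= b -> b <= x1 -> y0 <= c -> c <= d -> d <= y1 ->
    let m := (a + b) / 2 in let n := (c + d) / 2 in
    P a m c n -> P m b c n -> P a m n d -> P m b n d -> P a b c d) ->
  (forall x y, x0 <= x <= x1 -> y0 <= y <= y1 -> exists2 e, 0 < e &
    forall a b c d, x0 <= a -> b <= x1 -> y0 <= c -> d <= y1 ->
      a <= x <= b -> c <= y <= d -> b - a < e -> d - c < e -> P a b c d) ->
  P x0 x1 y0 y1.
Proof.
move=> hx hy split_P loc; apply: contrapT => nP.
(* The [ok] rectangles are those where [P] fails; by [split_P] one of the four quarters is again
   [ok]. *)
pose ok (s : R * R * (R * R)) := [/\ x0 <= s.1.1, s.1.1 <= s.1.2, s.1.2 <= x1,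
  [/\ y0 <= s.2.1, s.2.1 <= s.2.2 & s.2.2 <= y1] &
  ~ P s.1.1 s.1.2 s.2.1 s.2.2].
pose half (s t : R * R) := [/\ s.1 <= t.1, t.1 <= t.2, t.2 <= s.2 &
  t.2 - t.1 = (s.2 - s.1) / 2].
have step (s : {s | ok s}) : exists t : {s | ok s},
    half (sval s).1 (sval t).1 /\ half (sval s).2 (sval t).2.
  case: s => -[[a b] [c d]] [/= h1 h2 h3 [h4 h5 h6] h7].
  pose m := (a + b) / 2; pose n := (c + d) / 2.
  have [am mb] : a <= m /\ m <= b by rewrite /m; move: h2; clear; lra.
  have [cn nd] : c <= n /\ n <= d by rewrite /n; move: h5; clear; lra.
  have [em em'] : m - a = (b - a) / 2 /\ b - m = (b - a) / 2 by rewrite /m; split; field.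
  have [en en'] : n - c = (d - c) / 2 /\ d - n = (d - c) / 2 by rewrite /n; split; field.
  have [mx xm] : m <= x1 /\ x0 <= m := conj (le_trans mb h3) (le_trans h1 am).
  have [ny yn] : n <= y1 /\ y0 <= n := conj (le_trans nd h6) (le_trans h4 cn).
  have : exists t, ok t /\ (half (a, b) t.1 /\ half (c, d) t.2).
    have [p1|p1] := pselect (P a m c n); last by exists (a, m, (c, n)); do !split.
    have [p2|p2] := pselect (P m b c n); last by exists (m, b, (c, n)); do !split.
    have [p3|p3] := pselect (P a m n d); last by exists (a, m, (n, d)); do !split.
    have [p4|p4] := pselect (P m b n d); last by exists (m, b, (n, d)); do !split.
    by exfalso; apply: h7; exact: split_P.
  by move=> [t [okt ht]]; exists (exist _ t okt).
have /choice[f hf] := step.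
have ok0 : ok (x0, x1, (y0, y1)) by split => //=; split.
pose s n := iter n f (exist _ _ ok0).
pose a n := (sval (s n)).1.1; pose b n := (sval (s n)).1.2.
pose c n := (sval (s n)).2.1; pose d n := (sval (s n)).2.2.
have hs n : half (sval (s n)).1 (sval (s n.+1)).1 /\
            half (sval (s n)).2 (sval (s n.+1)).2 by exact: hf.
have oks n : ok (sval (s n)) by exact: (svalP (s n)).
have [||n|x xP] := @nested_itv a b.
- by move=> n; case: (hs n) => -[].
- by move=> n; case: (hs n) => -[].
- by case: (oks n).
have [||n|y yP] := @nested_itv c d.
- by move=> n; case: (hs n) => _ [].
- by move=> n; case: (hs n) => _ [].
- by case: (oks n) => _ _ _ [].
have ba n : b n - a n = (x1 - x0) / 2 ^+ n.
  elim: n => [|n IH]; first by rewrite expr0 divr1.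
  case: (hs n) => -[_ _ _]; rewrite -/(b _) -/(a _) -/(b n) -/(a n) IH => -> _.
  by rewrite exprSr invfM mulrA.
have dc n : d n - c n = (y1 - y0) / 2 ^+ n.
  elim: n => [|n IH]; first by rewrite expr0 divr1.
  case: (hs n) => _ [_ _ _]; rewrite -/(d _) -/(c _) -/(d n) -/(c n) IH => ->.
  by rewrite exprSr invfM mulrA.
have [||e e0 he] := loc x y.
- exact: (xP 0).
- exact: (yP 0).
have [n hn] := ex_pow2_lt (x1 - x0 + (y1 - y0)) e0.
have p0 : 0 < 2 ^+ n :> R by rewrite exprn_gt0.
have h1 : b n - a n < e.
  by rewrite ba; apply: le_lt_trans hn; rewrite ler_pM2r ?invr_gt0//; lra.
have h2 : d n - c n < e.
  by rewrite dc; apply: le_lt_trans hn; rewrite ler_pM2r ?invr_gt0//; lra.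
case: (oks n) => k1 k2 k3 [k4 k5 k6]; apply.
by apply: he => //; [exact: xP|exact: yP].
Qed.

(** The rectangle is given height 0, so that its upper quarters repeat the lower ones. *)
Lemma itv_bisection (P : R -> R -> Prop) (x0 x1 : R) :
  x0 <= x1 ->
  (forall a b, x0 <= a -> a <= b -> b <= x1 -> let m := (a + b) / 2 in
    P a m -> P m b -> P a b) ->
  (forall x, x0 <= x <= x1 -> exists2 e, 0 < e &
    forall a b, x0 <= a -> b <= x1 -> a <= x <= b -> b - a < e -> P a b) ->
  P x0 x1.
Proof.
move=> hx hs loc; apply: (@rect_bisection (fun a b _ _ => P a b) x0 x1 0 0) => //.
- by move=> a b c d h1 h2 h3 _ _ _ m n p1 p2 _ _; exact: hs.
- move=> x y /loc[e e0 he] _; exists e => // a b c d h1 h2 _ _ h3 _ h4 _; exact: he.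
Qed.

End bisection.

(** * Topology of the plane by real radii, and induction over compact sets *)

Section plane.
Context {R : realType}.
Local Notation C := (R[i]^o).

Lemma nbhs_nrmP (z : C) (A : set C) :
  nbhs z A <-> exists2 e : R, 0 < e & forall w : C, nrm (w - z) < e -> A w.
Proof.
split => [/nbhs_ballP[e /= e0 he]|[e e0 he]].
  have ee : e = rc (Cre e) by move: e0; rewrite ltcE => /andP[/eqP]; case: (e) => a b /= ->.
  exists (Cre e) => [|w hw]; first by move: e0; rewrite ltcE => /andP[].
  by apply: he; rewrite /ball /= nrmE ee ltcR nrmBC.
apply/nbhs_ballP; exists (rc e); first by rewrite /= ltcR.
by move=> w; rewrite /ball /= nrmE ltcR nrmBC; exact: he.
Qed.

Lemma openP (U : set C) : open U <->
  forall z, U z -> exists2 e : R, 0 < e & forall w : C, nrm (w - z) < e -> U w.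
Proof.
rewrite openE; split => [h z /h|h z Uz]; first by rewrite /interior => /nbhs_nrmP.
by apply/nbhs_nrmP/h.
Qed.

Lemma closedP (U : set C) : closed U <->
  forall z, ~ U z -> exists2 e : R, 0 < e & forall w : C, nrm (w - z) < e -> ~ U w.
Proof.
by rewrite -openC openP.
Qed.

Lemma open_ballC (z : C) (e : R) : open [set w : C | nrm (w - z) < e].
Proof.
apply/openP => w /= hw; exists (e - nrm (w - z)) => [|v hv]; first by lra.
by have := nrm_tri w v z; lra.
Qed.

Definition bounded (K : set C) := exists M : R, forall z, K z -> nrm z <= M.

(** This replaces the extraction of finite subcovers: bisect a square that contains [K]. It is
    stated for closed bounded sets because [compactP] is itself derived from it. *)
Lemma bounded_closed_ind (K : set C) (P : set C -> Prop) :
  closed K -> bounded K -> P set0 ->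
  (forall A B, A `<=` B -> P B -> P A) ->
  (forall A B, P A -> P B -> P (A `|` B)) ->
  (forall z, K z -> exists2 e : R, 0 < e & P (K `&` [set w | nrm (w - z) < e])) ->
  P K.
Proof.
move=> /closedP cK [M hM] P0 Psub PU loc.
pose M' := `|M|.
pose S a b c d := [set w : C | a <= Cre w <= b /\ c <= Cim w <= d].
have M'0 : - M' <= M' by have := normr_ge0 M; rewrite /M'; lra.
apply: (Psub _ (K `&` S (-M') M' (-M') M')).
  move=> z Kz; split => //; split; rewrite -ler_norml.
    by apply: le_trans (nrm_Re z) _; apply: le_trans (hM _ Kz) (ler_norm _).
  by apply: le_trans (nrm_Im z) _; apply: le_trans (hM _ Kz) (ler_norm _).
apply: (@rect_bisection R (fun a b c d => P (K `&` S a b c d))) => //.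
- move=> a b c d _ _ _ _ _ _ m n p1 p2 p3 p4.
  apply: Psub (PU _ _ (PU _ _ p1 p2) (PU _ _ p3 p4)) => z [Kz [hz1 hz2]].
  by have [h|h] := lerP (Cre z) m; have [h'|h'] := lerP (Cim z) n;
    [left; left|right; left|left; right|right; right]; do 2!split => //; lra.
- move=> x y _ _; pose z : C := Complex x y.
  have [e e0 he] : exists2 e : R, 0 < e & P (K `&` [set w | nrm (w - z) < e]).
    have [Kz|nKz] := pselect (K z); first exact: loc.
    have [e e0 he] := cK _ nKz; exists e => //; apply: Psub P0 => w [Kw hw].
    exact: he hw Kw.
  exists (e / 2) => [|a b c d _ _ _ _ h1 h2 h3 h4]; first by lra.
  apply: Psub he => w [Kw [k1 k2]]; split => //=.
  apply: le_lt_trans (nrm_ReIm _) _; rewrite CreB CimB /=.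
  have : `|Cre w - x| < e / 2 by rewrite ltr_norml; lra.
  have : `|Cim w - y| < e / 2 by rewrite ltr_norml; lra.
  by lra.
Qed.

Lemma compactP (K : set C) : compact K <-> closed K /\ bounded K.
Proof.
split => [cK|[cK bK]].
  split; first exact: compact_closed (@norm_hausdorff _ _) cK.
  have := cK; rewrite compact_near_coveringP => /(_ nat \oo _).
  move=> /(_ (fun n (z : C) => nrm z <= n%:R)) [].
    move=> z _; exists ([set w : C | nrm (w - z) < 1],
      [set n | (Num.truncn (nrm z + 1) < n)%N]); first split.
    - by apply/nbhs_nrmP; exists 1.
    - by exists (Num.truncn (nrm z + 1)).+1.
    move=> [w n] [/= hw hn].
    have := truncnS_gt (nrm z + 1); have := nrm_sub w z.
    have : (Num.truncn (nrm z + 1)).+1%:R <= n%:R :> R by rewrite ler_nat.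
    by lra.
  by move=> n _ hn; exists n%:R => z Kz; apply: (hn n _ z Kz) => /=.
move=> F FF FK.
have [//|h] := pselect (exists p, K p /\ cluster F p).
(* The sets that some member of [F] avoids form an ideal; without a cluster point, it contains a
   neighbourhood in [K] of every point of [K]. *)
suff [A FA] : exists2 A, F A & A `&` K = set0.
  by move=> AK; have := @filter_ex _ _ _ _ (filterI FA FK); rewrite AK => -[].
apply: (@bounded_closed_ind K (fun S => exists2 A, F A & A `&` S = set0)) => //.
- by exists setT; [exact: filterT|rewrite setI0].
- move=> A B AB [S FS SB]; exists S => //; apply/seteqP; split=> // z [Sz Az].
  by rewrite -SB; split => //; exact: AB.
- move=> A B [S FS SA] [T FT TB]; exists (S `&` T); first exact: filterI.
  apply/seteqP; split=> // z [[Sz Tz]] [Az|Bz]; first by rewrite -SA.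
  by rewrite -TB.
- move=> z Kz; have nz : ~ cluster F z by move=> ?; apply: h; exists z.
  apply: contrapT => hz; apply: nz => A B FA /nbhs_nrmP[e e0 he].
  apply: contrapT => AB; apply: hz; exists e => //; exists A => //.
  apply/seteqP; split => // w [Aw [Kw hw]]; apply: AB; exists w; split => //.
  exact: he.
Qed.

Lemma compact_ind (K : set C) (P : set C -> Prop) :
  compact K -> P set0 ->
  (forall A B, A `<=` B -> P B -> P A) ->
  (forall A B, P A -> P B -> P (A `|` B)) ->
  (forall z, K z -> exists2 e : R, 0 < e & P (K `&` [set w | nrm (w - z) < e])) ->
  P K.
Proof. by move=> /compactP[]; exact: bounded_closed_ind. Qed.

Lemma compact_open_sep (K U : set C) : compact K -> open U -> K `<=` U ->
  exists2 d : R, 0 < d & forall z w : C, K z -> nrm (w - z) < d -> U w.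
Proof.
move=> cK /openP oU KU.
pose P (S : set C) := exists2 d : R, 0 < d & forall z w : C, S z -> nrm (w - z) < d -> U w.
apply: (@compact_ind K P cK).
- by exists 1.
- by move=> A B AB [d d0 h]; exists d => // z w /AB; exact: h.
- move=> A B [d d0 h] [d' d'0 h']; exists (Num.min d d') => [|z w].
    by rewrite lt_min d0.
  by rewrite lt_min => -[Az|Bz] /andP[h1 h2]; [exact: (h z)|exact: (h' z)].
- move=> z Kz; have [e e0 he] := oU z (KU _ Kz).
  exists (e / 2); first by lra.
  exists (e / 2) => [|v w [_ /= hv] hw]; first by lra.
  by apply: he; have := nrm_tri v w z; lra.
Qed.

Lemma compact_bound (K : set C) (f : C -> R) : compact K ->
  (forall z, K z -> exists2 e : R, 0 < e & exists M, forall w, K w -> nrm (w - z) < e -> f w <= M) ->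
  exists2 M, 0 < M & forall z, K z -> f z <= M.
Proof.
move=> cK h; pose P (S : set C) := exists2 M, 0 < M & forall z, S z -> f z <= M.
apply: (@compact_ind K P cK).
- by exists 1.
- by move=> A B AB [d d0 k]; exists d => // z /AB; exact: k.
- move=> A B [d d0 k] [d' d'0 k']; exists (Num.max d d') => [|z].
    by rewrite lt_max d0.
  by rewrite le_max => -[/k|/k'] ->; rewrite ?orbT.
- move=> z Kz; have [e e0 [M hM]] := h z Kz; exists e => //; exists (Num.max M 1).
    by rewrite lt_max ltr01 orbT.
  by move=> w [Kw hw]; rewrite le_max hM.
Qed.

End plane.

(** * Complex derivatives *)

Section complex_derivative.
Context {R : realType}.
Local Notation C := (R[i]^o).
Implicit Types (f g q : C -> C) (z w l : C).

(** Real radii keep the estimates in [R], away from the partial order of [R[i]]. *)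
Definition ccont f z := forall e : R, 0 < e ->
  exists2 d : R, 0 < d & forall w, nrm (w - z) < d -> nrm (f w - f z) < e.

Lemma ccontP f z : ccont f z <-> {for z, continuous f}.
Proof.
split => [h A /= /nbhs_nrmP[e e0 he]|h e e0].
  have [d d0 hd] := h e e0; apply/nbhs_nrmP; exists d => // w hw; exact/he/hd.
have /nbhs_nrmP[d d0 hd] : nbhs z [set w | nrm (f w - f z) < e].
  by apply: (h [set v : C | nrm (v - f z) < e]); apply/nbhs_nrmP; exists e.
by exists d.
Qed.

Lemma ccont_cst l z : ccont (fun=> l) z.
Proof. by move=> e e0; exists 1 => // w _; rewrite subrr nrm0. Qed.
Lemma ccont_id z : ccont (fun w => w) z.
Proof. by move=> e e0; exists e. Qed.
Lemma ccont_comp f g z : ccont f z -> ccont g (f z) -> ccont (fun w => g (f w)) z.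
Proof.
by move=> hf hg e /hg[d d0 hd]; have [d' d'0 hd'] := hf d d0; exists d' => // w /hd'/hd.
Qed.
Lemma ccontD f g z : ccont f z -> ccont g z -> ccont (fun w => f w + g w) z.
Proof.
move=> hf hg; move=> e e0.
have [|d d0 hd] := hf (e / 2); first by lra.
have [|d' d'0 hd'] := hg (e / 2); first by lra.
exists (Num.min d d') => [|w]; first by rewrite lt_min d0.
rewrite lt_min => /andP[/hd + /hd'] => h1 h2.
rewrite opprD addrACA; apply: le_lt_trans (nrmD _ _) _; lra.
Qed.
Lemma ccontM f g z : ccont f z -> ccont g z -> ccont (fun w => f w * g w) z.
Proof.
move=> hf hg; move=> e e0.
pose M := nrm (f z) + nrm (g z) + 1.
have M0 : 0 < M by have := nrm_ge0 (f z); have := nrm_ge0 (g z); rewrite /M; lra.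
have k0 : 0 < Num.min 1 (e / (2 * M)) by rewrite lt_min ltr01 divr_gt0// mulr_gt0.
have [d d0 hd] := hf _ k0; have [d' d'0 hd'] := hg _ k0.
exists (Num.min d d') => [|w]; first by rewrite lt_min d0.
rewrite lt_min => /andP[/hd + /hd']; rewrite !lt_min.
set a := nrm (f w - f z); set b := nrm (g w - g z) => /andP[a1 aM] /andP[b1 bM].
rewrite (_ : _ - _ = (f w - f z) * (g w - g z) + (f w - f z) * g z + f z * (g w - g z)); last by ring.
have k : a * M < e / 2.
  by move: aM; rewrite ltr_pdivlMr ?mulr_gt0// mulrCA; lra.
have k' : b * M < e / 2.
  by move: bM; rewrite ltr_pdivlMr ?mulr_gt0// mulrCA; lra.
have a0 : 0 <= a by exact: nrm_ge0.
have b0 : 0 <= b by exact: nrm_ge0.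
apply: (@le_lt_trans _ _ (a * b + a * nrm (g z) + nrm (f z) * b)).
  by rewrite -!nrmM; apply: le_trans (nrmD _ _) _; rewrite lerD2r; exact: nrmD.
by move: k k'; rewrite /M; have := nrm_ge0 (f z); have := nrm_ge0 (g z); nra.
Qed.
Lemma ccontN f z : ccont f z -> ccont (fun w => - f w) z.
Proof.
move=> h; rewrite (_ : (fun w => _) = fun w => -1 * f w).
  by apply: ccontM => //; exact: ccont_cst.
by apply/funext => w; rewrite mulN1r.
Qed.
Lemma ccontB f g z : ccont f z -> ccont g z -> ccont (fun w => f w - g w) z.
Proof. by move=> hf hg; apply: ccontD => //; exact: ccontN. Qed.
Lemma ccontX f n z : ccont f z -> ccont (fun w => f w ^+ n) z.
Proof.
elim: n => [|n IH] hf; first exact: ccont_cst.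
rewrite (_ : (fun w => _) = fun w => f w * f w ^+ n); last by apply/funext => w; rewrite exprS.
exact/ccontM/IH.
Qed.
Lemma ccont_near f g z : (exists2 e : R, 0 < e & forall w, nrm (w - z) < e -> f w = g w) ->
  ccont f z -> ccont g z.
Proof.
move=> [e e0 fg] h; move=> e' e'0; have [d d0 hd] := h e' e'0.
exists (Num.min d e) => [|w]; first by rewrite lt_min d0.
rewrite lt_min => /andP[h1 h2]; rewrite -!fg ?subrr ?nrm0//; exact: hd.
Qed.

(* Caratheodory's form of the derivative. *)
Definition cderiv f z l := exists q, [/\ ccont q z, q z = l &
  forall w, f w - f z = q w * (w - z)].

(** Derivability is always in the whole plane: on a closed box it includes differentiability across
    the sides. *)
Definition holo (U : set C) f := forall z, U z -> exists l, cderiv f z l.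

Lemma cderivP f z l : cderiv f z l <-> forall e : R, 0 < e ->
  exists2 d : R, 0 < d & forall w, nrm (w - z) < d ->
    nrm (f w - f z - l * (w - z)) <= e * nrm (w - z).
Proof.
split => [[q [cq qz hq]] e e0|h].
  have [d d0 hd] := cq e e0; exists d => // w hw.
  rewrite hq -mulrBl nrmM ler_wpM2r ?nrm_ge0// -qz; exact/ltW/hd.
exists (fun w => if w == z then l else (f w - f z) / (w - z)); rewrite eqxx; split=> //.
  move=> e e0; have [|d d0 hd] := h (e / 2); first by lra.
  exists d => // w hw; rewrite eqxx; have [_|wz] := eqVneq w z.
    by rewrite subrr nrm0.
  have wz0 : w - z != 0 by rewrite subr_eq0.
  have p : 0 < nrm (w - z) by rewrite nrm_gt0.
  have := hd w hw; rewrite -[f w - f z in leLHS](divfK wz0) -mulrBl nrmM.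
  by rewrite ler_pM2r// => k; apply: le_lt_trans k _; lra.
move=> w; have [->|wz] := eqVneq w z; first by rewrite !subrr mulr0.
by rewrite divfK// subr_eq0.
Qed.

Lemma cderiv_near f g z l : (exists2 e : R, 0 < e & forall w, nrm (w - z) < e -> f w = g w) ->
  cderiv f z l -> cderiv g z l.
Proof.
move=> [e e0 fg] /cderivP h; apply/cderivP => e' e'0; have [d d0 hd] := h e' e'0.
exists (Num.min d e) => [|w]; first by rewrite lt_min d0.
rewrite lt_min => /andP[h1 h2]; rewrite -!fg ?subrr ?nrm0//; exact: hd.
Qed.

Lemma cderiv_ccont f z l : cderiv f z l -> ccont f z.
Proof.
move=> [q [cq _ hq]].
rewrite (_ : f = fun w => f z + q w * (w - z)); last first.
  by apply/funext => w; rewrite -hq addrC subrK.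
apply: ccontD; first exact: ccont_cst.
by apply: ccontM => //; apply: ccontB; [exact: ccont_id|exact: ccont_cst].
Qed.

Lemma cderiv_unique f z l l' : cderiv f z l -> cderiv f z l' -> l = l'.
Proof.
move=> /cderivP h /cderivP h'; apply/eqP; rewrite -subr_eq0; apply/eqP.
apply: nrm_le0 => e e0; have [|d d0 hd] := h (e / 2); first by lra.
have [|d' d'0 hd'] := h' (e / 2); first by lra.
pose m := Num.min d d' / 2.
have m0 : 0 < m by rewrite /m divr_gt0// lt_min d0.
have [md md'] : m < d /\ m < d'.
  have : Num.min d d' <= d by rewrite ge_min lexx.
  have : Num.min d d' <= d' by rewrite ge_min lexx orbT.
  by rewrite /m; lra.
have nm : nrm (z + rc m - z) = m by rewrite addrAC subrr add0r nrm_real gtr0_norm.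
have := hd (z + rc m); have := hd' (z + rc m); rewrite nm => /(_ md') k' /(_ md) k.
have : nrm ((l - l') * rc m) <= e * m.
  rewrite (_ : _ * _ = (f (z + rc m) - f z - l' * (z + rc m - z))
                     - (f (z + rc m) - f z - l * (z + rc m - z))); last by ring.
  by apply: le_trans (nrmB _ _) _; lra.
by rewrite nrmM nrm_real gtr0_norm// ler_pM2r.
Qed.

Lemma cderiv_cst l z : cderiv (fun=> l) z 0.
Proof.
by exists (fun=> 0); split => [||w]; rewrite ?subrr ?mul0r//; exact: ccont_cst.
Qed.
Lemma cderiv_id z : cderiv (fun w => w) z 1.
Proof.
by exists (fun=> 1); split => [||w]; rewrite ?mul1r//; exact: ccont_cst.
Qed.
Lemma cderivD f g z l m : cderiv f z l -> cderiv g z m ->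
  cderiv (fun w => f w + g w) z (l + m).
Proof.
move=> [q [cq <- hq]] [p [cp <- hp]]; exists (fun w => q w + p w).
by split => // [|w]; [exact: ccontD|rewrite mulrDl -hq -hp opprD addrACA].
Qed.
Lemma cderivM f g z l m : cderiv f z l -> cderiv g z m ->
  cderiv (fun w => f w * g w) z (l * g z + f z * m).
Proof.
move=> df; have cf := cderiv_ccont df; case: df => [q [cq <- hq]] [p [cp <- hp]].
exists (fun w => q w * g z + f w * p w); split => // [|w].
  by apply: ccontD; apply: ccontM => //; exact: ccont_cst.
transitivity ((f w - f z) * g z + f w * (g w - g z)); first by ring.
by rewrite hq hp; ring.
Qed.
Lemma cderivZ c f z l : cderiv f z l -> cderiv (fun w => c * f w) z (c * l).
Proof.
by move=> h; have := cderivM (cderiv_cst c z) h; rewrite mul0r add0r.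
Qed.
Lemma cderivN f z l : cderiv f z l -> cderiv (fun w => - f w) z (- l).
Proof.
move=> h; rewrite -mulN1r (_ : (fun w => _) = fun w => -1 * f w); first exact: cderivZ.
by apply/funext => w; rewrite mulN1r.
Qed.
Lemma cderivB f g z l m : cderiv f z l -> cderiv g z m ->
  cderiv (fun w => f w - g w) z (l - m).
Proof. by move=> hf hg; apply: cderivD => //; exact: cderivN. Qed.
Lemma cderiv_comp f g z l m : cderiv f z l -> cderiv g (f z) m ->
  cderiv (fun w => g (f w)) z (m * l).
Proof.
move=> df; have cf := cderiv_ccont df; case: df => [q [cq <- hq]] [p [cp <- hp]].
exists (fun w => p (f w) * q w); split => // [|w]; last by rewrite hp hq mulrA.
by apply: ccontM => //; exact: (ccont_comp cf).
Qed.
Lemma cderiv_inv z : z != 0 -> cderiv (fun w => w^-1) z (- (z^-1) ^+ 2).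
Proof.
move=> z0; apply/cderivP => e e0.
have nz : 0 < nrm z by rewrite nrm_gt0.
exists (Num.min (nrm z / 2) (e * nrm z ^+ 3 / 2)).
  by rewrite lt_min !divr_gt0// mulr_gt0// exprn_gt0.
move=> w; rewrite lt_min => /andP[h1 h2].
have nw : nrm z / 2 <= nrm w by have := nrm_sub z w; rewrite nrmBC; lra.
have w0 : w != 0 by rewrite -nrm_gt0; lra.
rewrite (_ : _ - _ = (w - z) ^+ 2 / (z ^+ 2 * w)); last by field; rewrite w0.
rewrite nrmM nrmX nrmV nrmM nrmX expr2 mulrAC ler_wpM2r ?nrm_ge0//.
have k : 0 < nrm z ^+ 2 * nrm w by rewrite mulr_gt0 ?exprn_gt0//; lra.
rewrite ler_pdivrMr//; apply: le_trans (ltW h2) _.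
rewrite (_ : _ / 2 = e * (nrm z ^+ 2 * (nrm z / 2))); last by field.
by rewrite ler_pM2l// ler_pM2l ?exprn_gt0.
Qed.
Lemma ccontV f z : f z != 0 -> ccont f z -> ccont (fun w => (f w)^-1) z.
Proof. by move=> fz hf; exact: (ccont_comp hf (cderiv_ccont (cderiv_inv fz))). Qed.
Lemma cderivV f z l : f z != 0 -> cderiv f z l ->
  cderiv (fun w => (f w)^-1) z (- ((f z)^-1) ^+ 2 * l).
Proof. by move=> fz hf; exact: (cderiv_comp hf (cderiv_inv fz)). Qed.
Lemma cderivX n z : cderiv (fun w => w ^+ n) z (n%:R * z ^+ n.-1).
Proof.
elim: n => [|n IH]; first by rewrite mul0r; exact: cderiv_cst.
rewrite (_ : (fun w => _) = fun w => w * w ^+ n); last by apply/funext => w; rewrite exprS.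
rewrite (_ : _ * _ = 1 * z ^+ n + z * (n%:R * z ^+ n.-1)); last first.
  case: n {IH} => [|n] /=; first by rewrite mul0r mulr0 addr0 expr0.
  by rewrite exprS -natr1; ring.
exact: (cderivM (cderiv_id z) IH).
Qed.

Lemma cderiv_poly (p : {poly R[i]}) z : cderiv (fun w => p.[w]) z p^`().[z].
Proof.
elim/poly_ind: p => [|p c IH].
  rewrite deriv0 horner0 (_ : (fun w => _) = fun=> 0); first exact: cderiv_cst.
  by apply/funext => w; rewrite horner0.
rewrite (_ : (fun w => _) = fun w => p.[w] * w + c); last first.
  by apply/funext => w; rewrite !hornerE.
rewrite (_ : _.[z] = p^`().[z] * z + p.[z] * 1 + 0).
  by apply: cderivD (cderiv_cst _ _); exact: (cderivM IH (cderiv_id z)).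
by rewrite derivD derivM derivX derivC !hornerE.
Qed.

Lemma ccont_poly (p : {poly R[i]}) z : ccont (fun w => p.[w]) z.
Proof. exact: cderiv_ccont (cderiv_poly p z). Qed.

Lemma derivable_cderiv f z : derivable f z 1 <-> exists l, cderiv f z l.
Proof.
split => [df|[l /cderivP h]].
  exists ('D_1 f z); apply/cderivP => e e0.
  have := df => /cvgrPdist_lt/(_ (rc e)); rewrite ltcR => /(_ e0).
  move=> /nbhs_nrmP[d d0 hd]; exists d => // w hw.
  have [->|wz] := eqVneq w z; first by rewrite !subrr mulr0 subr0 nrm0 mulr0.
  have wz0 : w - z != 0 by rewrite subr_eq0.
  have := hd (w - z); rewrite subr0 => /(_ hw wz0).
  rewrite nrmE ltcR nrmBC => k.
  change (is_true (nrm ((w - z)^-1 * (f ((w - z) * 1 + z) - f z) - 'D_1 f z) < e)) in k.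
  rewrite mulr1 subrK in k.
  rewrite (_ : _ - _ - _ = ((w - z)^-1 * (f w - f z) - 'D_1 f z) * (w - z)).
    by rewrite nrmM ler_wpM2r ?nrm_ge0// ltW.
  by field; exact: wz0.
apply/cvg_ex; exists l; apply/cvgrPdist_lt => e e0.
have ee : e = rc (Cre e) by move: e0; rewrite ltcE => /andP[/eqP]; case: (e) => a b /= ->.
have ep : 0 < Cre e by move: e0; rewrite ltcE => /andP[].
have [|d d0 hd] := h (Cre e / 2); first by lra.
apply/nbhs_nrmP; exists d => // k; rewrite subr0 => hk k0.
rewrite ee nrmE ltcR nrmBC.
change (is_true (nrm (k^-1 * (f (k * 1 + z) - f z) - l) < Cre e)); rewrite mulr1.
have := hd (k + z); rewrite addrK => /(_ hk).
have kp : 0 < nrm k by rewrite nrm_gt0.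
rewrite (_ : _ - _ - _ = (k^-1 * (f (k + z) - f z) - l) * k); last by field; exact: k0.
by rewrite nrmM ler_pM2r// => j; apply: le_lt_trans j _; lra.
Qed.

End complex_derivative.

(** * Integration along segments *)

Section integral.
Context {R : realType}.
Local Notation C := (R[i]^o).
Local Notation mu := (@lebesgue_measure R).

Definition rint (x y : R) (u : R -> R) : R := \int[mu]_(t in `[x, y]) u t.
Definition cint (x y : R) (u : R -> C) : C :=
  Complex (rint x y (Cre \o u)) (rint x y (Cim \o u)).

Definition ucont (x y : R) (u : R -> C) := forall t, x <= t <= y ->
  forall e : R, 0 < e -> exists2 d : R, 0 < d &
    forall s, `|s - t| < d -> nrm (u s - u t) < e.

Definition rcont (x y : R) (u : R -> R) := forall t, x <= t <= y ->
  {for t, continuous u}.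

Lemma rcont_re x y u : ucont x y u -> rcont x y (Cre \o u).
Proof.
move=> h t ht; apply/cvgrPdist_lt => e e0; have [d d0 hd] := h t ht e e0.
near=> s; apply: le_lt_trans (hd s _).
  by rewrite /= distrC -CreB; exact: nrm_Re.
by rewrite distrC; near: s; exact: cvgr_dist_lt.
Unshelve. all: by end_near. Qed.

Lemma rcont_im x y u : ucont x y u -> rcont x y (Cim \o u).
Proof.
move=> h t ht; apply/cvgrPdist_lt => e e0; have [d d0 hd] := h t ht e e0.
near=> s; apply: le_lt_trans (hd s _).
  by rewrite /= distrC -CimB; exact: nrm_Im.
by rewrite distrC; near: s; exact: cvgr_dist_lt.
Unshelve. all: by end_near. Qed.

Lemma rcont_integrable x y u : rcont x y u -> mu.-integrable `[x, y] (EFin \o u).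
Proof.
move=> h; apply: continuous_compact_integrable; first exact: segment_compact.
apply: continuous_in_subspaceT => t; rewrite inE /= in_itv /= => ht; exact: h.
Qed.

Lemma rintD x y u v : rcont x y u -> rcont x y v ->
  rint x y (fun t => u t + v t) = rint x y u + rint x y v.
Proof. by move=> hu hv; apply: RintegralD => //; exact: rcont_integrable. Qed.

Lemma rintZ x y c u : rcont x y u -> rint x y (fun t => c * u t) = c * rint x y u.
Proof. by move=> hu; apply: RintegralZl => //; exact: rcont_integrable. Qed.

Lemma rint_ext x y u v : (forall t, x <= t <= y -> u t = v t) ->
  rint x y u = rint x y v.
Proof. by move=> h; apply: eq_Rintegral => t; rewrite inE /= in_itv /=; exact: h. Qed.

Lemma rint_cst x y c : x <= y -> rint x y (fun=> c) = c * (y - x).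
Proof.
move=> xy; rewrite /rint Rintegral_cst//= lebesgue_measure_itv /= lte_fin.
have [yx|yx|->] := ltgtP x y; rewrite ?subrr//; lra.
Qed.

Lemma le_rint x y u v : rcont x y u -> rcont x y v ->
  (forall t, x <= t <= y -> u t <= v t) -> rint x y u <= rint x y v.
Proof.
move=> hu hv h; apply: le_Rintegral => //; exact: rcont_integrable.
Qed.

Lemma rcont_cst x y c : rcont x y (fun=> c).
Proof. by move=> t _; exact: cvg_cst. Qed.

Lemma rint_bound x y u M : x <= y -> rcont x y u ->
  (forall t, x <= t <= y -> `|u t| <= M) -> `|rint x y u| <= M * (y - x).
Proof.
move=> xy hu h; rewrite ler_norml -mulNr -!rint_cst//.
apply/andP; split; apply: le_rint => //; try exact: rcont_cst.
  by move=> t /h; rewrite ler_norml => /andP[].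
by move=> t /h; rewrite ler_norml => /andP[].
Qed.

Lemma rint_split x m y u : x <= m -> m <= y -> rcont x y u ->
  rint x y u = rint x m u + rint m y u.
Proof.
move=> xm my hu; have /rcont_integrable hi := hu.
have hi2 : mu.-integrable `]m, y] (EFin \o u).
  apply: integrableS hi => //; apply: subset_itvr; rewrite bnd_simp//.
rewrite /rint -[X in _ = _ + X]Rintegral_itv_obnd_cbnd//.
rewrite -(@Rintegral_itvB _ u (BLeft x) (BRight y) m) ?bnd_simp//.
by rewrite addrC subrK.
Qed.

Lemma cintD x y u v : ucont x y u -> ucont x y v ->
  cint x y (fun t => u t + v t) = cint x y u + cint x y v.
Proof.
move=> hu hv; apply: eq_ReIm => /=.
  by rewrite -rintD; [apply: rint_ext => t _ /=; rewrite CreD|exact: rcont_re|exact: rcont_re].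
by rewrite -rintD; [apply: rint_ext => t _ /=; rewrite CimD|exact: rcont_im|exact: rcont_im].
Qed.

Lemma rcontZ x y c u : rcont x y u -> rcont x y (fun t => c * u t).
Proof. by move=> hu t ht; apply: cvgMr; exact: hu. Qed.

Lemma cintZ x y c u : ucont x y u -> cint x y (fun t => c * u t) = c * cint x y u.
Proof.
move=> hu; have hr := rcont_re hu; have hi := rcont_im hu; apply: eq_ReIm => /=.
  rewrite CreM /= -mulNr -!rintZ// -rintD; try exact: rcontZ.
  by apply: rint_ext => t _ /=; rewrite CreM mulNr.
rewrite CimM /= -!rintZ// -rintD; try exact: rcontZ.
by apply: rint_ext => t _ /=; rewrite CimM.
Qed.

Lemma cint_ext x y u v : (forall t, x <= t <= y -> u t = v t) ->
  cint x y u = cint x y v.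
Proof.
by move=> h; rewrite /cint; congr Complex; apply: rint_ext => t ht /=; rewrite h.
Qed.

(** The factor 2, from estimating real and imaginary parts separately, is harmless in all that
    follows. *)
Lemma cint_bound x y u M : x <= y -> ucont x y u ->
  (forall t, x <= t <= y -> nrm (u t) <= M) -> nrm (cint x y u) <= 2 * M * (y - x).
Proof.
move=> xy hu h; apply: le_trans (nrm_ReIm _) _ => /=.
have h1 : `|rint x y (Cre \o u)| <= M * (y - x).
  apply: rint_bound => //; first exact: rcont_re.
  by move=> t /h; apply: le_trans; exact: nrm_Re.
have h2 : `|rint x y (Cim \o u)| <= M * (y - x).
  apply: rint_bound => //; first exact: rcont_im.
  by move=> t /h; apply: le_trans; exact: nrm_Im.
lra.
Qed.

Lemma cint_split x m y u : x <= m -> m <= y -> ucont x y u ->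
  cint x y u = cint x m u + cint m y u.
Proof.
move=> xm my hu; apply: eq_ReIm => /=; apply: rint_split => //.
  exact: rcont_re.
exact: rcont_im.
Qed.

Lemma cint_cst x y c : x <= y -> cint x y (fun=> c) = c * rc (y - x).
Proof.
move=> xy; apply: eq_ReIm; rewrite /= ?CreM ?CimM /=.
  by rewrite (@rint_ext _ _ _ (fun=> Cre c))// rint_cst//; ring.
by rewrite (@rint_ext _ _ _ (fun=> Cim c))// rint_cst//; ring.
Qed.

(** An additive function of intervals inherits a bound proportional to the length from arbitrarily
    short intervals, by bisection. The fundamental theorem of calculus, the mean value inequality
    and the change of variable below are all instances. *)
Lemma additive_bound (Phi : R -> R -> C) (x y M : R) : x <= y ->
  (forall a b, x <= a -> a <= b -> b <= y -> let m := (a + b) / 2 in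
     Phi a b = Phi a m + Phi m b) ->
  (forall t, x <= t <= y -> forall e : R, 0 < e -> exists2 d : R, 0 < d &
     forall a b, x <= a -> b <= y -> a <= t <= b -> b - a < d ->
       nrm (Phi a b) <= (M + e) * (b - a)) ->
  nrm (Phi x y) <= M * (y - x).
Proof.
move=> xy add loc.
have key e : 0 < e -> nrm (Phi x y) <= (M + e) * (y - x).
  move=> e0; apply: (@itv_bisection _ (fun a b => nrm (Phi a b) <= (M + e) * (b - a))) => //.
    move=> a b h1 h2 h3 m p1 p2; rewrite add//; apply: le_trans (nrmD _ _) _.
    by rewrite -/m; lra.
  by move=> t ht; exact: loc.
apply/ler_addgt0Pr => e e0.
have p : 0 < y - x + 1 by lra.
have /key h : 0 < e / (y - x + 1) by rewrite divr_gt0.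
apply: le_trans h _; rewrite mulrDl lerD2l mulrAC ler_pdivrMr// ler_wpM2l//; lra.
Qed.

Lemma additive_eq0 (Phi : R -> R -> C) (x y : R) : x <= y ->
  (forall a b, x <= a -> a <= b -> b <= y -> let m := (a + b) / 2 in
     Phi a b = Phi a m + Phi m b) ->
  (forall t, x <= t <= y -> forall e : R, 0 < e -> exists2 d : R, 0 < d &
     forall a b, x <= a -> b <= y -> a <= t <= b -> b - a < d ->
       nrm (Phi a b) <= e * (b - a)) ->
  Phi x y = 0.
Proof.
move=> xy add loc; apply: nrm_le0 => e e0; apply: (@le_trans _ _ 0); last exact: ltW.
rewrite -[leRHS](mul0r (y - x)); apply: additive_bound => // t ht e' e'0.
by have [d d0 hd] := loc t ht e' e'0; exists d => // a b *; rewrite add0r; exact: hd.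
Qed.

Definition cpath (a d : C) (t : R) : C := a + d * rc t.
Definition seg (a d : C) (x y : R) := [set w | exists2 t, x <= t <= y & w = cpath a d t].
Definition econt (a d : C) (x y : R) (f : C -> C) := forall w, seg a d x y w -> ccont f w.
Definition edge (a d : C) (x y : R) (f : C -> C) : C :=
  d * cint x y (fun t => f (cpath a d t)).

Lemma cpathB a d s t : cpath a d s - cpath a d t = d * rc (s - t).
Proof. by rewrite /cpath rmorphB; ring. Qed.

Lemma nrm_cpathB a d s t : nrm (cpath a d s - cpath a d t) = nrm d * `|s - t|.
Proof. by rewrite cpathB nrmM nrm_real. Qed.

Lemma seg_cpath a d x y t : x <= t <= y -> seg a d x y (cpath a d t).
Proof. by exists t. Qed.

Lemma seg_sub a d x y x' y' : x <= x' -> y' <= y -> seg a d x' y' `<=` seg a d x y.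
Proof. by move=> h1 h2 _ [t ht ->]; exists t => //; lra. Qed.

Lemma econt_sub a d x y x' y' f : x <= x' -> y' <= y ->
  econt a d x y f -> econt a d x' y' f.
Proof. by move=> h1 h2 h w hw; apply/h/(seg_sub h1 h2 hw). Qed.

Lemma econt_ucont a d x y f : econt a d x y f -> ucont x y (fun t => f (cpath a d t)).
Proof.
move=> h t ht e e0; have [r r0 hr] := h _ (seg_cpath a d ht) e e0.
have d1 : 0 < nrm d + 1 by have := nrm_ge0 d; lra.
exists (r / (nrm d + 1)) => [|s hs]; first by rewrite divr_gt0.
apply: hr; rewrite nrm_cpathB; move: hs; rewrite ltr_pdivlMr// => hs.
by have := normr_ge0 (s - t); nra.
Qed.

Lemma edgeD a d x y f g : econt a d x y f -> econt a d x y g ->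
  edge a d x y (fun w => f w + g w) = edge a d x y f + edge a d x y g.
Proof. by move=> hf hg; rewrite /edge cintD ?mulrDr//; exact: econt_ucont. Qed.

Lemma edgeZ a d x y c f : econt a d x y f ->
  edge a d x y (fun w => c * f w) = c * edge a d x y f.
Proof. by move=> hf; rewrite /edge cintZ; [ring|exact: econt_ucont]. Qed.

Lemma edge_ext a d x y f g : (forall w, seg a d x y w -> f w = g w) ->
  edge a d x y f = edge a d x y g.
Proof.
by move=> h; congr (_ * _); apply: cint_ext => t ht; apply: h; exact: seg_cpath.
Qed.

Lemma edge_bound a d x y f M : x <= y -> econt a d x y f ->
  (forall w, seg a d x y w -> nrm (f w) <= M) ->
  nrm (edge a d x y f) <= nrm d * (2 * M * (y - x)).
Proof.
move=> xy hf h; rewrite nrmM ler_wpM2l ?nrm_ge0//; apply: cint_bound => //.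
  exact: econt_ucont.
by move=> t ht; apply: h; exact: seg_cpath.
Qed.

Lemma edge_split a d x m y f : x <= m -> m <= y -> econt a d x y f ->
  edge a d x y f = edge a d x m f + edge a d m y f.
Proof.
by move=> xm my hf; rewrite /edge -mulrDr -cint_split//; exact: econt_ucont.
Qed.

Lemma edge_cst a d x y c : x <= y -> edge a d x y (fun=> c) = c * d * rc (y - x).
Proof. by move=> xy; rewrite /edge cint_cst//; ring. Qed.

Lemma econt_cst a d x y c : econt a d x y (fun=> c).
Proof. by move=> w _; exact: ccont_cst. Qed.

Let small_mul (D k l m : R) : 0 <= D -> 0 <= k -> k <= l -> l * (D + 1) < m ->
  D * k < m /\ D * k <= D * l.
Proof. by move=> *; split; nra. Qed.

Let small_sum (D e' e l : R) : 0 <= D -> 0 <= e' -> 0 <= l -> e' * 4 * (D + 1) = e ->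
  D * (2 * e' * l) + D * (2 * e' * l) <= e * l.
Proof. move=> h1 h2 h3 <-; nra. Qed.

(** The difference of the two sides is additive, and near each point it is small compared with the
    length. *)
Lemma edge_ftc a d x y f F : x <= y -> econt a d x y f ->
  (forall w, seg a d x y w -> cderiv F w (f w)) ->
  edge a d x y f = F (cpath a d y) - F (cpath a d x).
Proof.
move=> xy cf dF; apply/eqP; rewrite -subr_eq0; apply/eqP.
apply: (@additive_eq0 (fun p q => edge a d p q f - (F (cpath a d q) - F (cpath a d p)))) => //.
  move=> p q h1 h2 h3 m; have [pm mq] : p <= m /\ m <= q by rewrite /m; lra.
  by rewrite (edge_split pm mq (econt_sub h1 h3 cf)); ring.
move=> t ht e e0; set w := cpath a d t.
have sw : seg a d x y w by exact: seg_cpath.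
have d1 : 0 < nrm d + 1 by have := nrm_ge0 d; lra.
have e1 : 0 < e / (4 * (nrm d + 1)) by rewrite divr_gt0// mulr_gt0.
set e' := e / _ in e1; have e'E : e' * 4 * (nrm d + 1) = e.
  by rewrite /e'; field; rewrite gt_eqF.
have [r r0 hr] := cf w sw _ e1; have /cderivP/(_ _ e1)[r' r'0 hr'] := dF w sw.
exists (Num.min r r' / (nrm d + 1)); first by rewrite divr_gt0// lt_min r0.
move=> p q h1 h2 h3; rewrite ltr_pdivlMr// => h4.
have pq : p <= q by lra.
have close s : p <= s <= q -> nrm (cpath a d s - w) < Num.min r r' /\ nrm (cpath a d s - w) <= nrm d * (q - p).
  move=> hs; have k : `|s - t| <= q - p by rewrite ler_norml; lra.
  by rewrite /w !nrm_cpathB; exact: (small_mul (nrm_ge0 d) (normr_ge0 _) k h4).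
have [] := close p; first by lra.
rewrite lt_min => /andP[_ /hr' k1] k2.
have [] := close q; first by lra.
rewrite lt_min => /andP[_ /hr' k3] k4.
rewrite (_ : edge a d p q f = edge a d p q (fun v => f v - f w) + f w * d * rc (q - p)); last first.
  rewrite -(edge_cst a d (f w) pq) -edgeD; first by apply: edge_ext => v _; rewrite subrK.
    by move=> v hv; apply: ccontB; [apply/cf/(seg_sub h1 h2 hv)|exact: ccont_cst].
  exact: econt_cst.
have k5 : nrm (edge a d p q (fun v => f v - f w)) <= nrm d * (2 * e' * (q - p)).
  apply: edge_bound => //.
    by move=> v hv; apply: ccontB; [apply/cf/(seg_sub h1 h2 hv)|exact: ccont_cst].
  by move=> v [s hs ->]; apply/ltW/hr; have [+ _] := close s hs; rewrite lt_min => /andP[].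
rewrite (_ : _ - _ = edge a d p q (fun v => f v - f w)
   + (F (cpath a d p) - F w - f w * (cpath a d p - w))
   - (F (cpath a d q) - F w - f w * (cpath a d q - w))); last first.
  have -> : rc (q - p) = rc q - rc p :> C by rewrite rmorphB.
  by rewrite /cpath; ring.
apply: le_trans (nrmB _ _) _.
have := nrmD (edge a d p q (fun v => f v - f w)) (F (cpath a d p) - F w - f w * (cpath a d p - w)).
have := small_sum (nrm_ge0 d) (ltW e1) _ e'E; move=> /(_ (q - p) ltac:(lra)).
have j1 : e' * nrm (cpath a d p - w) <= e' * (nrm d * (q - p)) by rewrite ler_pM2l.
have j2 : e' * nrm (cpath a d q - w) <= e' * (nrm d * (q - p)) by rewrite ler_pM2l.
rewrite (_ : nrm d * (2 * e' * (q - p)) = 2 * (e' * (nrm d * (q - p)))) in k5 *; last by ring.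
lra.
Qed.

(** Additivity is applied to the increments of [F] themselves: the derivative is only bounded, not
    integrated. *)
Lemma mean_value_le a d x y F l M : x <= y ->
  (forall w, seg a d x y w -> cderiv F w (l w) /\ nrm (l w) <= M) ->
  nrm (F (cpath a d y) - F (cpath a d x)) <= nrm d * M * (y - x).
Proof.
move=> xy dF.
apply: (@additive_bound (fun p q => F (cpath a d q) - F (cpath a d p))) => //.
  by move=> p q h1 h2 h3 m; ring.
move=> t ht e e0; set w := cpath a d t.
have sw : seg a d x y w by exact: seg_cpath.
have d1 : 0 < nrm d + 1 by have := nrm_ge0 d; lra.
have e1 : 0 < e / (2 * (nrm d + 1)) by rewrite divr_gt0// mulr_gt0.
set e' := e / _ in e1; have e'E : e' * 2 * (nrm d + 1) = e.
  by rewrite /e'; field; rewrite gt_eqF.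
have [/cderivP/(_ _ e1)[r r0 hr] lM] := dF w sw.
exists (r / (nrm d + 1)); first by rewrite divr_gt0.
move=> p q h1 h2 h3; rewrite ltr_pdivlMr// => h4.
have close s : p <= s <= q -> nrm (cpath a d s - w) < r /\ nrm (cpath a d s - w) <= nrm d * (q - p).
  move=> hs; have k : `|s - t| <= q - p by rewrite ler_norml; lra.
  by rewrite /w !nrm_cpathB; exact: (small_mul (nrm_ge0 d) (normr_ge0 _) k h4).
have [/hr k1 k2] := close p ltac:(lra).
have [/hr k3 k4] := close q ltac:(lra).
rewrite (_ : _ - _ = l w * (cpath a d q - cpath a d p)
   + (F (cpath a d q) - F w - l w * (cpath a d q - w))
   - (F (cpath a d p) - F w - l w * (cpath a d p - w))); last by ring.
apply: le_trans (nrmB _ _) _.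
have := nrmD (l w * (cpath a d q - cpath a d p)) (F (cpath a d q) - F w - l w * (cpath a d q - w)).
rewrite (nrmM (l w)) nrm_cpathB ger0_norm; last by lra.
set A := nrm (_ + _); set B := nrm (_ - _ - _) in k3 *; set B' := nrm (_ - _ - _) in k1 *.
have h5 : nrm (l w) * (nrm d * (q - p)) <= M * (nrm d * (q - p)).
  by rewrite ler_wpM2r// mulr_ge0 ?nrm_ge0//; lra.
have := nrm_ge0 d; nra.
Qed.

(** Invariance under translation of the parameter, again because the difference is additive and
    locally negligible. *)
Lemma edge_shift a d x y s f : x <= y -> econt a d (x + s) (y + s) f ->
  edge (a + d * rc s) d x y f = edge a d (x + s) (y + s) f.
Proof.
move=> xy cf; apply/eqP; rewrite -subr_eq0; apply/eqP.
have pE t : cpath (a + d * rc s) d t = cpath a d (t + s) by rewrite /cpath rmorphD; ring.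
have cf' : econt (a + d * rc s) d x y f.
  by move=> _ [t ht ->]; apply: cf; rewrite pE; apply: seg_cpath; lra.
apply: (@additive_eq0 (fun p q => edge (a + d * rc s) d p q f - edge a d (p + s) (q + s) f)) => //.
  move=> p q h1 h2 h3 m.
  have [pm mq] : p <= m /\ m <= q by rewrite /m; lra.
  have [pm' mq'] : p + s <= m + s /\ m + s <= q + s by lra.
  rewrite (edge_split pm mq (econt_sub h1 h3 cf')) (edge_split pm' mq').
    by ring.
  by apply: econt_sub cf; lra.
move=> t ht e e0; set w := cpath a d (t + s).
have d1 : 0 < nrm d + 1 by have := nrm_ge0 d; lra.
have e1 : 0 < e / (4 * (nrm d + 1)) by rewrite divr_gt0// mulr_gt0.
set e' := e / _ in e1; have e'E : e' * 4 * (nrm d + 1) = e.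
  by rewrite /e'; field; rewrite gt_eqF.
have [|r r0 hr] := cf w _ _ e1; first by apply: seg_cpath; lra.
exists (r / (nrm d + 1)); first by rewrite divr_gt0.
move=> p q h1 h2 h3; rewrite ltr_pdivlMr// => h4.
have pq : p <= q by lra.
have close u : p <= u <= q -> nrm (cpath a d (u + s) - w) < r.
  move=> hu; have k : `|u + s - (t + s)| <= q - p by rewrite ler_norml; lra.
  by rewrite /w !nrm_cpathB; exact: (small_mul (nrm_ge0 d) (normr_ge0 _) k h4).1.
have cB b p' q' : econt b d p' q' f -> econt b d p' q' (fun v => f v - f w).
  by move=> h v hv; apply: ccontB; [exact: h|exact: ccont_cst].
have EB b p' q' : p' <= q' -> econt b d p' q' f ->
    edge b d p' q' f = edge b d p' q' (fun v => f v - f w) + f w * d * rc (q' - p').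
  move=> pq' h; rewrite -(edge_cst b d (f w) pq') -edgeD; first by apply: edge_ext => v _; rewrite subrK.
    exact: cB.
  exact: econt_cst.
have c1 : econt (a + d * rc s) d p q f by exact: econt_sub h1 h2 cf'.
have c2 : econt a d (p + s) (q + s) f by apply: econt_sub cf; lra.
rewrite EB// [X in _ - X]EB//; last by lra.
have k1 : nrm (edge (a + d * rc s) d p q (fun v => f v - f w)) <= nrm d * (2 * e' * (q - p)).
  apply: edge_bound; [by []|exact: cB|].
  by move=> v [u hu ->]; apply/ltW/hr; rewrite pE; exact: close.
have k2 : nrm (edge a d (p + s) (q + s) (fun v => f v - f w)) <= nrm d * (2 * e' * (q + s - (p + s))).
  apply: edge_bound; [by lra|exact: cB|].
  move=> v [u hu ->]; apply/ltW/hr; rewrite -(subrK s u); apply: close; lra.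
rewrite (_ : q + s - (p + s) = q - p); last by ring.
rewrite opprD addrACA subrr addr0.
apply: le_trans (nrmB _ _) _; rewrite (_ : q + s - (p + s) = q - p) in k2; last by ring.
have := small_sum (nrm_ge0 d) (ltW e1) _ e'E; move=> /(_ (q - p) ltac:(lra)); lra.
Qed.

End integral.

(** * Abstract integration functionals and Cauchy kernels *)

Section functionals.
Context {R : realType}.
Local Notation C := (R[i]^o).

Definition contS (S : set C) (f : C -> C) := forall w, S w -> ccont f w.

(* The properties of integration along a union of segments contained in S that
   the Cauchy theory uses. *)
Definition functional (S : set C) (L : (C -> C) -> C) := [/\
  forall f g, contS S f -> contS S g -> L (fun w => f w + g w) = L f + L g,
  forall c f, contS S f -> L (fun w => c * f w) = c * L f &
  exists2 B : R, 0 <= B & forall f M, 0 <= M -> contS S f ->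
    (forall w, S w -> nrm (f w) <= M) -> nrm (L f) <= B * M].

Lemma contS_sub S S' f : S `<=` S' -> contS S' f -> contS S f.
Proof. by move=> h hf w /h; exact: hf. Qed.
Lemma contS_cst S c : contS S (fun=> c).
Proof. by move=> w _; exact: ccont_cst. Qed.
Lemma contS_id S : contS S (fun w => w).
Proof. by move=> w _; exact: ccont_id. Qed.
Lemma contSD S f g : contS S f -> contS S g -> contS S (fun w => f w + g w).
Proof. by move=> hf hg w Sw; apply: ccontD; [exact: hf|exact: hg]. Qed.
Lemma contSB S f g : contS S f -> contS S g -> contS S (fun w => f w - g w).
Proof. by move=> hf hg w Sw; apply: ccontB; [exact: hf|exact: hg]. Qed.
Lemma contSM S f g : contS S f -> contS S g -> contS S (fun w => f w * g w).
Proof. by move=> hf hg w Sw; apply: ccontM; [exact: hf|exact: hg]. Qed.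
Lemma contSV S f : (forall w, S w -> f w != 0) -> contS S f -> contS S (fun w => (f w)^-1).
Proof. by move=> h hf w Sw; apply: ccontV; [exact: h|exact: hf]. Qed.
Lemma contSX S f n : contS S f -> contS S (fun w => f w ^+ n).
Proof. by move=> hf w Sw; apply: ccontX; exact: hf. Qed.

Lemma functionalD S L f g : functional S L -> contS S f -> contS S g ->
  L (fun w => f w + g w) = L f + L g.
Proof. by move=> [+ _ _]; exact. Qed.
Lemma functionalZ S L c f : functional S L -> contS S f ->
  L (fun w => c * f w) = c * L f.
Proof. by move=> [_ + _]; exact. Qed.
Lemma functionalB S L f g : functional S L -> contS S f -> contS S g ->
  L (fun w => f w - g w) = L f - L g.
Proof.
move=> hL hf hg; rewrite -mulN1r -(functionalZ _ hL hg) -(functionalD hL hf); last first.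
  by apply: contSM => //; exact: contS_cst.
by congr L; apply/funext => w; rewrite mulN1r.
Qed.
Lemma functional_ext S L f g : functional S L -> contS S f -> contS S g ->
  (forall w, S w -> f w = g w) -> L f = L g.
Proof.
move=> hL hf hg fg; apply/eqP; rewrite -subr_eq0 -(functionalB hL hf hg); apply/eqP.
apply: nrm_le0 => e e0; case: hL => _ _ [B B0 hB].
apply: le_trans (hB _ 0 _ _ _) _ => //; first exact: contSB.
  by move=> w Sw; rewrite fg// subrr nrm0.
by rewrite mulr0 ltW.
Qed.

Lemma functional_sub S S' L : S `<=` S' -> functional S L -> functional S' L.
Proof.
move=> h [h1 h2 [B B0 hB]]; split => [f g hf hg|c f hf|].
- by apply: h1; exact: contS_sub h _.
- by apply: h2; exact: contS_sub h _.
- exists B => // f M M0 hf hM; apply: hB => //; first exact: contS_sub h _.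
  by move=> w /h; exact: hM.
Qed.

Lemma functional_add S L L' : functional S L -> functional S L' ->
  functional S (fun f => L f + L' f).
Proof.
move=> [h1 h2 [B B0 hB]] [h1' h2' [B' B'0 hB']]; split => [f g hf hg|c f hf|].
- by rewrite h1// h1'// addrACA.
- by rewrite h2// h2'// mulrDr.
- exists (B + B') => [|f M M0 hf hM]; first exact: addr_ge0.
  apply: le_trans (nrmD _ _) _; rewrite mulrDl lerD//; [exact: hB|exact: hB'].
Qed.

Lemma functional_scale S L a : functional S L -> functional S (fun f => a * L f).
Proof.
move=> [h1 h2 [B B0 hB]]; split => [f g hf hg|c f hf|].
- by rewrite h1// mulrDr.
- by rewrite h2// mulrCA.
- exists (nrm a * B) => [|f M M0 hf hM]; first by rewrite mulr_ge0// nrm_ge0.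
  by rewrite nrmM -mulrA ler_wpM2l ?nrm_ge0//; exact: hB.
Qed.

Lemma functional0 S : functional S (fun=> 0).
Proof.
split => [f g _ _|c f _|]; rewrite ?addr0 ?mulr0//.
by exists 0 => // f M M0 _ _; rewrite nrm0 mul0r.
Qed.

Lemma functional_sum S I (r : seq I) (L : I -> (C -> C) -> C) :
  (forall i, functional S (L i)) -> functional S (fun f => \sum_(i <- r) L i f).
Proof.
move=> h; elim: r => [|i r IH].
  rewrite (_ : (fun f => _) = fun=> 0); first exact: functional0.
  by apply/funext => f; rewrite big_nil.
rewrite (_ : (fun f => _) = fun f => L i f + \sum_(j <- r) L j f).
  exact: functional_add (h i) IH.
by apply/funext => f; rewrite big_cons.
Qed.

Lemma contS_bounded S f : compact S -> contS S f ->
  exists2 M : R, 0 < M & forall w, S w -> nrm (f w) <= M.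
Proof.
move=> cS cf; apply: (@compact_bound _ S (fun w => nrm (f w)) cS) => z Sz.
have [d d0 hd] := cf z Sz 1 ltr01; exists d => //; exists (nrm (f z) + 1).
by move=> w _ /hd; have := nrm_sub (f w) (f z); lra.
Qed.

Lemma contS_away S f : compact S -> contS S f -> (forall w, S w -> f w != 0) ->
  exists2 d : R, 0 < d & forall w, S w -> d <= nrm (f w).
Proof.
move=> cS cf f0; have [M M0 hM] := contS_bounded cS (contSV f0 cf).
exists M^-1 => [|w Sw]; first by rewrite invr_gt0.
by rewrite -(invrK (nrm (f w))) lef_pV2 ?posrE// ?invr_gt0 ?nrm_gt0 ?f0// -nrmV hM.
Qed.

(** To be read with [X] = 1 / (u - v), [Y] = 1 / (u - z) and [h] = v - z, which satisfy the equation
    required. The point is that [K] depends only on [n] and [b], hence is uniform over the path of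
    integration. *)
Lemma inv_pow_taylor (b : R) (n : nat) : 0 <= b -> exists2 K : R, 0 <= K &
  forall X Y h : C, X = Y + h * X * Y -> nrm X <= b -> nrm Y <= b ->
    nrm (X ^+ n - Y ^+ n - n%:R * h * Y ^+ n.+1) <= K * nrm h ^+ 2.
Proof.
move=> b0; elim: n => [|n [K K0 IH]].
  exists 0 => // X Y h _ _ _; rewrite !expr0 subrr !mul0r subr0 nrm0//.
exists (K * b + n.+1%:R * b ^+ n.+3) => [|X Y h E hX hY].
  by apply: addr_ge0; apply: mulr_ge0; rewrite ?ler0n ?exprn_ge0.
have -> : X ^+ n.+1 - Y ^+ n.+1 - n.+1%:R * h * Y ^+ n.+2 =
    (X ^+ n - Y ^+ n - n%:R * h * Y ^+ n.+1) * X + n.+1%:R * h ^+ 2 * (X * Y ^+ n.+2).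
  apply/eqP; rewrite -subr_eq0; apply/eqP.
  rewrite -natr1 !exprS.
  transitivity ((X - Y - h * X * Y) * (Y ^+ n * (1 + (n%:R + 1) * h * Y))).
    ring.
  by rewrite (_ : X - Y - _ = 0) ?mul0r// {1}E; ring.
apply: le_trans (nrmD _ _) _; rewrite [leRHS]mulrDl; apply: lerD.
  rewrite nrmM [leRHS]mulrAC; apply: ler_pM; rewrite ?nrm_ge0//; exact: IH.
rewrite nrmM (nrmM _ (h ^+ 2)) nrm_nat nrmX (nrmM X) nrmX [leLHS]mulrAC.
apply: ler_wpM2r; first exact: sqr_ge0.
apply: ler_wpM2l; first exact: ler0n.
rewrite [leRHS]exprS; apply: ler_pM; rewrite ?exprn_ge0 ?nrm_ge0//.
by rewrite lerXn2r ?nnegrE ?nrm_ge0.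
Qed.

Lemma kernel_contS S (a u : C -> C) z k : contS S a -> contS S u ->
  (forall w, S w -> u w != z) -> contS S (fun w => a w / (u w - z) ^+ k).
Proof.
move=> ca cu h; apply: contSM => //; apply: contSV.
  by move=> w Sw; rewrite expf_neq0// subr_eq0 h.
by apply: contSX; apply: contSB => //; exact: contS_cst.
Qed.

(* Differentiation under the integral sign for Cauchy kernels: this covers the
   derivatives of a holomorphic function ([u w = w]) and the integrals defining
   the inverse of a univalent one. *)
Lemma kernel_cderiv S L (a u : C -> C) z k : functional S L -> compact S ->
  contS S a -> contS S u -> (forall w, S w -> u w != z) ->
  cderiv (fun v => L (fun w => a w / (u w - v) ^+ k)) z
    (k%:R * L (fun w => a w / (u w - z) ^+ k.+1)).
Proof.
move=> fL cS ca cu hz; have [A A0 hA] := contS_bounded cS ca.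
have [||d d0 hd] := @contS_away S (fun w => u w - z) cS.
- by apply: contSB => //; exact: contS_cst.
- by move=> w Sw; rewrite subr_eq0 hz.
pose b := 2 / d; have b0 : 0 <= b by rewrite divr_ge0// ltW.
have [K K0 hK] := inv_pow_taylor k b0.
have [_ _ [B B0 hB]] := fL.
have e1 (e : R) : 0 < e -> 0 < e / (B * A * K + 1).
  by move=> e0; rewrite divr_gt0// ltr_wpDl// !mulr_ge0// ltW.
(* The radius d / 2 keeps v at distance at least d / 2 from the values of [u]; the other bound turns
   the remainder B A K |v - z|^2 into at most e |v - z|. *)
apply/cderivP => e e0; exists (Num.min (d / 2) (e / (B * A * K + 1))).
  by rewrite lt_min e1// divr_gt0.
move=> v; rewrite lt_min => /andP[hv1 hv2].
have far w : S w -> d / 2 <= nrm (u w - v).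
  by move=> Sw; have := nrm_tri v (u w) z; have := hd w Sw; lra.
have hv w : S w -> u w != v.
  by move=> /far h; rewrite -subr_eq0 -nrm_gt0; lra.
have cv := kernel_contS k ca cu hv; have cz := kernel_contS k ca cu hz.
have cz' := kernel_contS k.+1 ca cu hz.
have cz'' : contS S (fun w => (k%:R * (v - z)) * (a w / (u w - z) ^+ k.+1)).
  by apply: contSM => //; exact: contS_cst.
rewrite (_ : _ - _ = L (fun w => a w / (u w - v) ^+ k - a w / (u w - z) ^+ k
    - (k%:R * (v - z)) * (a w / (u w - z) ^+ k.+1))); last first.
  by rewrite !(functionalB fL)// ?(functionalZ _ fL)//; [ring|exact: contSB].
apply: (@le_trans _ _ (B * (A * (K * nrm (v - z) ^+ 2)))).
  apply: hB.
    by apply: mulr_ge0; [exact: ltW|apply: mulr_ge0 => //; exact: sqr_ge0].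
    by apply: contSB => //; exact: contSB.
  move=> w Sw; have Y0 : u w - z != 0 by rewrite subr_eq0 hz.
  have X0 : u w - v != 0 by rewrite subr_eq0 hv.
  rewrite (_ : _ - _ - _ = a w * ((u w - v)^-1 ^+ k - (u w - z)^-1 ^+ k
     - k%:R * (v - z) * (u w - z)^-1 ^+ k.+1)); last by rewrite !exprVn; ring.
  rewrite nrmM; apply: ler_pM; rewrite ?nrm_ge0 ?hA//; apply: hK.
  - by field; rewrite Y0 X0.
  - by rewrite /b -[2](invrK) -invfM mulrC; apply: nrm_invB; [rewrite divr_gt0|exact: far].
  - rewrite /b; apply: le_trans (nrm_invB d0 (hd w Sw)) _.
    by rewrite ler_peMl ?invr_ge0 ?ler1n// ltW.
rewrite expr2 !mulrA ler_wpM2r ?nrm_ge0//.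
move: hv2; rewrite ltr_pdivlMr; last by rewrite ltr_wpDl// !mulr_ge0// ltW.
by have := nrm_ge0 (v - z); lra.
Qed.

End functionals.

(** * Cauchy theory on rectangles *)

Section rectangles.
Context {R : realType}.
Local Notation C := (R[i]^o).

Definition box (x0 x1 y0 y1 : R) : set C :=
  [set w | x0 <= Cre w <= x1 /\ y0 <= Cim w <= y1].

Definition hedge (y x0 x1 : R) (f : C -> C) := edge (Complex 0 y) 1 x0 x1 f.
Definition vedge (x y0 y1 : R) (f : C -> C) := edge (Complex x 0) ii y0 y1 f.

Definition rect (x0 x1 y0 y1 : R) (f : C -> C) : C :=
  hedge y0 x0 x1 f + vedge x1 y0 y1 f - hedge y1 x0 x1 f - vedge x0 y0 y1 f.

Definition frame (x0 x1 y0 y1 : R) : set C :=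
  [set w | box x0 x1 y0 y1 w /\
    (Cre w = x0 \/ Cre w = x1 \/ Cim w = y0 \/ Cim w = y1)].

Lemma cpath_h y t : cpath (Complex 0 y) 1 t = Complex t y :> C.
Proof. by apply: eq_ReIm; rewrite /cpath ?CreD ?CimD ?CreM ?CimM /=; ring. Qed.
Lemma cpath_v x t : cpath (Complex x 0) ii t = Complex x t :> C.
Proof. by apply: eq_ReIm; rewrite /cpath ?CreD ?CimD ?CreM ?CimM /=; ring. Qed.

Lemma seg_h y x0 x1 : seg (Complex 0 y) 1 x0 x1 = box x0 x1 y y.
Proof.
apply/seteqP; split => [_ [t ht ->]|w [h1 h2]]; first by rewrite cpath_h; split => //=; lra.
by exists (Cre w) => //; rewrite cpath_h; apply: eq_ReIm => //=; lra.
Qed.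
Lemma seg_v x y0 y1 : seg (Complex x 0) ii y0 y1 = box x x y0 y1.
Proof.
apply/seteqP; split => [_ [t ht ->]|w [h1 h2]]; first by rewrite cpath_v; split => //=; lra.
by exists (Cim w) => //; rewrite cpath_v; apply: eq_ReIm => //=; lra.
Qed.

Lemma closed_box x0 x1 y0 y1 : closed (box x0 x1 y0 y1).
Proof.
apply/closedP => z nz.
have hh (w : C) e : nrm (w - z) < e -> `|Cre w - Cre z| < e /\ `|Cim w - Cim z| < e.
  by move=> h; split; [rewrite -CreB; exact: le_lt_trans (nrm_Re _) h|
                       rewrite -CimB; exact: le_lt_trans (nrm_Im _) h].
have [h|h] := ltP (Cre z) x0.
  exists (x0 - Cre z) => [|w /hh]; first by lra.
  by rewrite !ltr_norml => -[k1 k2] [k3 k4]; lra.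
have [h1|h1] := ltP x1 (Cre z).
  exists (Cre z - x1) => [|w /hh]; first by lra.
  by rewrite !ltr_norml => -[k1 k2] [k3 k4]; lra.
have [h2|h2] := ltP (Cim z) y0.
  exists (y0 - Cim z) => [|w /hh]; first by lra.
  by rewrite !ltr_norml => -[k1 k2] [k3 k4]; lra.
have [h3|h3] := ltP y1 (Cim z).
  exists (Cim z - y1) => [|w /hh]; first by lra.
  by rewrite !ltr_norml => -[k1 k2] [k3 k4]; lra.
by exfalso; apply: nz; split; lra.
Qed.

Lemma compact_box x0 x1 y0 y1 : compact (box x0 x1 y0 y1).
Proof.
apply/compactP; split; first exact: closed_box.
exists (`|x0| + `|x1| + (`|y0| + `|y1|)) => w [h1 h2].
apply: le_trans (nrm_ReIm _) _; apply: lerD; rewrite ler_norml.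
  by have := ler_norm x0; have := ler_norm x1; have := ler_norm (-x0); have := ler_norm (-x1);
  rewrite !normrN; lra.
by have := ler_norm y0; have := ler_norm y1; have := ler_norm (-y0); have := ler_norm (-y1);
  rewrite !normrN; lra.
Qed.

Lemma frameE x0 x1 y0 y1 : x0 <= x1 -> y0 <= y1 -> frame x0 x1 y0 y1 =
  box x0 x1 y0 y0 `|` box x1 x1 y0 y1 `|` box x0 x1 y1 y1 `|` box x0 x0 y0 y1.
Proof.
move=> hx hy; apply/seteqP; split => w.
  by move=> [[h1 h2] [h|[h|[h|h]]]];
    [right|left; left; right|left; left; left|left; right]; split; lra.
move=> [[[]|]|] [h1 h2]; (split; [by split; lra|]).
- by right; right; left; lra.
- by right; left; lra.
- by right; right; right; lra.
- by left; lra.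
Qed.

Lemma compact_frame x0 x1 y0 y1 : x0 <= x1 -> y0 <= y1 -> compact (frame x0 x1 y0 y1).
Proof. by move=> hx hy; rewrite frameE//; do !apply: compactU; exact: compact_box. Qed.

Lemma functional_edge a d x y : x <= y -> functional (seg a d x y) (@edge R a d x y).
Proof.
move=> xy; split => [f g|c f|]; [exact: edgeD|exact: edgeZ|].
exists (nrm d * (2 * (y - x))) => [|f M M0 cf hM].
  by apply: mulr_ge0; [exact: nrm_ge0|lra].
by apply: le_trans (edge_bound xy cf hM) _; rewrite -[leRHS]mulrA ler_wpM2l ?nrm_ge0//; lra.
Qed.

Lemma functional_hedge y x0 x1 : x0 <= x1 -> functional (box x0 x1 y y) (hedge y x0 x1).
Proof. by move=> h; rewrite -seg_h; exact: functional_edge. Qed.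
Lemma functional_vedge x y0 y1 : y0 <= y1 -> functional (box x x y0 y1) (vedge x y0 y1).
Proof. by move=> h; rewrite -seg_v; exact: functional_edge. Qed.

Lemma functional_rect x0 x1 y0 y1 : x0 <= x1 -> y0 <= y1 ->
  functional (frame x0 x1 y0 y1) (rect x0 x1 y0 y1).
Proof.
move=> hx hy.
have subN L S : @functional R S L -> functional S (fun f => - L f).
  move=> h; rewrite (_ : (fun f => _) = fun f => -1 * L f); first exact: functional_scale.
  by apply/funext => f; rewrite mulN1r.
rewrite frameE//; apply: functional_add; first apply: functional_add; first apply: functional_add.
- by apply: functional_sub (functional_hedge _ hx) => w ?; do 3!left.
- by apply: functional_sub (functional_vedge _ hy) => w ?; do 2!left; right.
- by apply/subN; apply: functional_sub (functional_hedge _ hx) => w ?; left; right.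
- by apply/subN; apply: functional_sub (functional_vedge _ hy) => w ?; right.
Qed.

Lemma frame_box x0 x1 y0 y1 : frame x0 x1 y0 y1 `<=` box x0 x1 y0 y1.
Proof. by move=> w []. Qed.

Lemma box_sub a b c d x0 x1 y0 y1 : x0 <= a -> b <= x1 -> y0 <= c -> d <= y1 ->
  box a b c d `<=` box x0 x1 y0 y1.
Proof. by move=> h1 h2 h3 h4 w [k1 k2]; split; lra. Qed.

Lemma rect_ftc x0 x1 y0 y1 f F : x0 <= x1 -> y0 <= y1 -> contS (frame x0 x1 y0 y1) f ->
  (forall w, frame x0 x1 y0 y1 w -> cderiv F w (f w)) -> rect x0 x1 y0 y1 f = 0.
Proof.
move=> hx hy cf dF; rewrite frameE// in cf dF.
rewrite /rect /hedge /vedge !(@edge_ftc _ _ _ _ _ f F)// ?seg_h ?seg_v ?cpath_h ?cpath_v.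
- by ring.
- by rewrite /econt seg_v => w hw; apply: cf; right.
- by move=> w hw; apply: dF; right.
- by rewrite /econt seg_h => w hw; apply: cf; left; right.
- by move=> w hw; apply: dF; left; right.
- by rewrite /econt seg_v => w hw; apply: cf; left; left; right.
- by move=> w hw; apply: dF; left; left; right.
- by rewrite /econt seg_h => w hw; apply: cf; do 3!left.
- by move=> w hw; apply: dF; do 3!left.
Qed.

Lemma rect_split_x x0 m x1 y0 y1 f : x0 <= m -> m <= x1 ->
  contS (box x0 x1 y0 y0) f -> contS (box x0 x1 y1 y1) f ->
  rect x0 x1 y0 y1 f = rect x0 m y0 y1 f + rect m x1 y0 y1 f.
Proof.
move=> h1 h2 c0 c1; rewrite /rect /hedge /vedge.
rewrite (@edge_split _ (Complex 0 y0) _ _ m)//; last by rewrite /econt seg_h.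
rewrite (@edge_split _ (Complex 0 y1) _ _ m)//; last by rewrite /econt seg_h.
by repeat match goal with |- context [edge ?a ?d ?x ?y f] =>
  generalize (edge a d x y f); intro end; ring.
Qed.

Lemma rect_split_y x0 x1 y0 m y1 f : y0 <= m -> m <= y1 ->
  contS (box x0 x0 y0 y1) f -> contS (box x1 x1 y0 y1) f ->
  rect x0 x1 y0 y1 f = rect x0 x1 y0 m f + rect x0 x1 m y1 f.
Proof.
move=> h1 h2 c0 c1; rewrite /rect /hedge /vedge.
rewrite (@edge_split _ (Complex x0 0) _ _ m)//; last by rewrite /econt seg_v.
rewrite (@edge_split _ (Complex x1 0) _ _ m)//; last by rewrite /econt seg_v.
by repeat match goal with |- context [edge ?a ?d ?x ?y f] =>
  generalize (edge a d x y f); intro end; ring.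
Qed.

Lemma rect_bound x0 x1 y0 y1 f M : x0 <= x1 -> y0 <= y1 ->
  contS (frame x0 x1 y0 y1) f -> (forall w, frame x0 x1 y0 y1 w -> nrm (f w) <= M) ->
  nrm (rect x0 x1 y0 y1 f) <= 4 * M * ((x1 - x0) + (y1 - y0)).
Proof.
move=> hx hy cf hM; rewrite frameE// in cf hM.
have hh y : (box x0 x1 y y `<=` frame x0 x1 y0 y1) -> nrm (hedge y x0 x1 f) <= 2 * M * (x1 - x0).
  rewrite frameE// => hs; apply: le_trans (edge_bound hx _ _) _.
  - by rewrite /econt seg_h => w /hs; exact: cf.
  - by rewrite seg_h => w /hs; exact: hM.
  by rewrite nrm1 mul1r.
have hv x : (box x x y0 y1 `<=` frame x0 x1 y0 y1) -> nrm (vedge x y0 y1 f) <= 2 * M * (y1 - y0).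
  rewrite frameE// => hs; apply: le_trans (edge_bound hy _ _) _.
  - by rewrite /econt seg_v => w /hs; exact: cf.
  - by rewrite seg_v => w /hs; exact: hM.
  by rewrite nrm_i mul1r.
have k1 : nrm (hedge y0 x0 x1 f) <= 2 * M * (x1 - x0).
  by apply: hh; rewrite frameE// => w ?; do 3!left.
have k2 : nrm (vedge x1 y0 y1 f) <= 2 * M * (y1 - y0).
  by apply: hv; rewrite frameE// => w ?; do 2!left; right.
have k3 : nrm (hedge y1 x0 x1 f) <= 2 * M * (x1 - x0).
  by apply: hh; rewrite frameE// => w ?; left; right.
have k4 : nrm (vedge x0 y0 y1 f) <= 2 * M * (y1 - y0).
  by apply: hv; rewrite frameE// => w ?; right.
apply: le_trans (nrmB _ _) _; apply: le_trans (lerD (nrmB _ _) k4) _.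
apply: le_trans (lerD (lerD (nrmD _ _) k3) (lexx _)) _.
apply: le_trans (lerD (lerD (lerD k1 k2) (lexx _)) (lexx _)) _.
by rewrite le_eqVlt; apply/orP; left; apply/eqP; ring.
Qed.

Lemma holo_contS (U : set C) f : holo U f -> contS U f.
Proof. by move=> h w /h [l]; exact: cderiv_ccont. Qed.

Lemma holo_sub (U V : set C) f : U `<=` V -> holo V f -> holo U f.
Proof. by move=> h hf w /h; exact: hf. Qed.

(** The bound e ((b - a)^2 + (d - c)^2) is preserved exactly when four quarters are put together, so
    it suffices to prove it on small rectangles about each point. *)
Theorem goursat x0 x1 y0 y1 f : x0 <= x1 -> y0 <= y1 ->
  holo (box x0 x1 y0 y1) f -> rect x0 x1 y0 y1 f = 0.
Proof.
move=> hx hy hf.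
have key e : 0 < e -> nrm (rect x0 x1 y0 y1 f) <= e * ((x1 - x0) ^+ 2 + (y1 - y0) ^+ 2).
  move=> e0; apply: (@rect_bisection _ (fun a b c d =>
     nrm (rect a b c d f) <= e * ((b - a) ^+ 2 + (d - c) ^+ 2))) => //.
    move=> a b c d h1 h2 h3 h4 h5 h6 m n p1 p2 p3 p4.
    have [am mb] : a <= m /\ m <= b by rewrite /m; clear -h2; lra.
    have [cn nd] : c <= n /\ n <= d by rewrite /n; clear -h5; lra.
    have cf a' b' c' d' : a <= a' -> b' <= b -> c <= c' -> d' <= d -> contS (box a' b' c' d') f.
      by move=> k1 k2 k3 k4; apply/holo_contS; apply: holo_sub hf; apply: box_sub; [exact: le_trans k1|exact: le_trans h3|exact: le_trans k3|exact: le_trans h6].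
    rewrite (rect_split_y cn nd); [|by apply: cf..].
    rewrite !(rect_split_x am mb); [|by apply: cf..].
    apply: le_trans (nrmD _ _) _; apply: le_trans (lerD (nrmD _ _) (nrmD _ _)) _.
    apply: le_trans (lerD (lerD p1 p2) (lerD p3 p4)) _.
    by rewrite le_eqVlt; apply/orP; left; apply/eqP; rewrite /m /n; field.
  move=> x y xb yb; pose z : C := Complex x y.
  have [l /cderivP] : exists l, cderiv f z l by apply: hf.
  have e8 : 0 < e / 8 by lra.
  move=> /(_ _ e8) [r r0 hr]; exists (r / 2) => [|a b c d h1 h2 h3 h4 h5 h6 h7 h8]; first by lra.
  have [ab cd] : a <= b /\ c <= d by lra.
  have cf : contS (frame a b c d) f.
    by apply/holo_contS; apply: holo_sub hf; apply: subset_trans (@frame_box _ _ _ _) _; exact: box_sub.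
  pose g (w : C) := f z + l * (w - z).
  have cg : contS (frame a b c d) g.
    by apply: contSD; [exact: contS_cst|apply: contSM; [exact: contS_cst|apply: contSB; [exact: contS_id|exact: contS_cst]]].
  (* The affine part has a primitive; only the remainder of first order is left. *)
  have -> : rect a b c d f = rect a b c d (fun w => f w - g w).
    rewrite (functionalB (functional_rect ab cd))//.
    rewrite (@rect_ftc _ _ _ _ g (fun w => f z * (w - z) + l / 2 * (w - z) ^+ 2))// ?subr0//.
    move=> w _; rewrite (_ : g w = f z * (1 - 0) + l / 2 * ((2%:R * (w - z) ^+ 1) * (1 - 0))); last first.
      by rewrite /g expr1; field.
    have dz : cderiv (fun w : C => w - z) w (1 - 0).
      by apply: cderivB; [exact: cderiv_id|exact: cderiv_cst].
    apply: cderivD; apply: cderivZ => //.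
    exact: (cderiv_comp dz (cderivX 2 (w - z))).
  (* With u and v the sides, the bound is (e / 2) (u + v)^2 <= e (u^2 + v^2); hence e / 8. *)
  apply: le_trans (@rect_bound _ _ _ _ _ (e / 8 * ((b - a) + (d - c))) ab cd _ _) _.
  - exact: contSB.
  - move=> w [[k1 k2] _].
    have nw : nrm (w - z) <= (b - a) + (d - c).
      apply: le_trans (nrm_ReIm _) _; rewrite CreB CimB /=; apply: lerD; rewrite ler_norml; lra.
    rewrite /g opprD addrA; apply: le_trans (hr _ _) _; first by lra.
    by rewrite ler_wpM2l//; lra.
  - set u := b - a; set v := d - c; have := sqr_ge0 (u - v); nra.
apply: nrm_le0 => e e0; set K := (x1 - x0) ^+ 2 + (y1 - y0) ^+ 2 in key.
have K1 : 0 < K + 1 by rewrite ltr_wpDl// addr_ge0// sqr_ge0.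
apply: le_trans (key (e / (K + 1)) _) _; first by rewrite divr_gt0.
by rewrite mulrAC ler_pdivrMr// ler_wpM2l//; lra.
Qed.

End rectangles.

(** * Removable singularities and Cauchy's formula *)

Section cauchy.
Context {R : realType}.
Local Notation C := (R[i]^o).
Implicit Types (f F : C -> C) (z w : C).

Definition inner (x0 x1 y0 y1 : R) : set C :=
  [set w | x0 < Cre w < x1 /\ y0 < Cim w < y1].

Lemma inner_box x0 x1 y0 y1 : inner x0 x1 y0 y1 `<=` box x0 x1 y0 y1.
Proof. by move=> w [h1 h2]; split; lra. Qed.

Lemma inner_frame x0 x1 y0 y1 w z :
  inner x0 x1 y0 y1 z -> frame x0 x1 y0 y1 w -> w != z.
Proof. by move=> [h1 h2] [_ h]; apply/eqP => wz; subst w; lra. Qed.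

Lemma open_inner x0 x1 y0 y1 : open (inner x0 x1 y0 y1).
Proof.
apply/openP => z [h1 h2].
exists (Num.min (Num.min (Cre z - x0) (x1 - Cre z)) (Num.min (Cim z - y0) (y1 - Cim z))).
  by rewrite !lt_min; lra.
move=> w; rewrite !lt_min => /andP[/andP[k1 k2] /andP[k3 k4]].
have := nrm_Re (w - z); have := nrm_Im (w - z); rewrite CreB CimB.
have := ler_norm (Cre w - Cre z); have := ler_norm (- (Cre w - Cre z)).
have := ler_norm (Cim w - Cim z); have := ler_norm (- (Cim w - Cim z)).
by rewrite !normrN /inner /=; split; lra.
Qed.

(* Cutting along the lines carrying the sides of the small square. *)
Lemma rect_shrink x0 x1 y0 y1 f z h : 0 < h ->
  x0 <= Cre z - h -> Cre z + h <= x1 -> y0 <= Cim z - h -> Cim z + h <= y1 ->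
  (forall w, box x0 x1 y0 y1 w -> w != z -> exists l, cderiv f w l) ->
  rect x0 x1 y0 y1 f = rect (Cre z - h) (Cre z + h) (Cim z - h) (Cim z + h) f.
Proof.
move=> h0; set p := Cre z; set q := Cim z => k1 k2 k3 k4 hf.
have off a b c d : x0 <= a -> b <= x1 -> y0 <= c -> d <= y1 ->
    (b < p) || (p < a) || (d < q) || (q < c) -> holo (box a b c d) f.
  move=> j1 j2 j3 j4 j5 w hw; apply: hf; first exact: box_sub hw.
  apply/eqP => wz; subst w; case: hw => /andP[i1 i2] /andP[i3 i4]; case/orP: j5 => [/orP[/orP[]|]|].
  - by rewrite ltNge i2.
  - by rewrite ltNge i1.
  - by rewrite ltNge i4.
  - by rewrite ltNge i3.
have ph : p - h < p by clear -h0; lra.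
have ph' : p < p + h by clear -h0; lra.
have qh : q - h < q by clear -h0; lra.
have qh' : q < q + h by clear -h0; lra.
have j1 : p - h <= p + h by clear -h0; lra.
have j2 : q - h <= q + h by clear -h0; lra.
have y01 : y0 <= y1 by clear -j2 k3 k4; lra.
have j3 : p - h <= x1 by clear -j1 k2; lra.
have j4 : q - h <= y1 by clear -j2 k4; lra.
have j5 : y0 <= q + h by clear -j2 k3; lra.
have y0q : y0 < q by clear -k3 qh; lra.
have qy1 : q < y1 by clear -k4 qh'; lra.
have j6 : x0 <= p + h by clear -k1 j1; lra.
have j7 : x0 <= x1 by clear -k1 j3; lra.
rewrite (rect_split_x k1 j3); [|apply/holo_contS/off..]; rewrite ?lexx ?y0q ?qy1 ?orbT//.
rewrite (goursat k1 y01); last by apply: off; rewrite ?lexx ?ph.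
rewrite add0r (rect_split_x j1 k2); [|apply/holo_contS/off..]; rewrite ?lexx ?y0q ?qy1 ?orbT//.
rewrite (goursat k2 y01); last by apply: off; rewrite ?lexx ?ph' ?orbT.
rewrite addr0 (rect_split_y k3 j4); [|apply/holo_contS/off..]; rewrite ?lexx ?ph ?ph' ?orbT//.
rewrite (goursat j1 k3); last by apply: off; rewrite ?lexx ?qh ?orbT.
rewrite add0r (rect_split_y j2 k4); [|apply/holo_contS/off..]; rewrite ?lexx ?ph ?ph' ?orbT//.
rewrite (goursat j1 k4) ?addr0//; apply: off; rewrite ?lexx ?qh' ?orbT//.
Qed.

Lemma inner_room x0 x1 y0 y1 z : inner x0 x1 y0 y1 z -> exists2 h : R, 0 < h &
  forall k, 0 < k -> k <= h -> x0 <= Cre z - k /\ Cre z + k <= x1 /\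
     y0 <= Cim z - k /\ Cim z + k <= y1.
Proof.
move=> [h1 h2].
exists (Num.min (Num.min (Cre z - x0) (x1 - Cre z)) (Num.min (Cim z - y0) (y1 - Cim z))).
  by rewrite !lt_min; lra.
by move=> k k0; rewrite !le_min => /andP[/andP[? ?] /andP[? ?]]; lra.
Qed.

(** The rectangle shrinks to a square about [z], on which [f] stays bounded while the perimeter
    tends to 0. *)
Lemma rect_removable x0 x1 y0 y1 f z r M : inner x0 x1 y0 y1 z -> 0 < r ->
  (forall w, box x0 x1 y0 y1 w -> w != z -> exists l, cderiv f w l) ->
  (forall w, w != z -> nrm (w - z) < r -> nrm (f w) <= M) ->
  rect x0 x1 y0 y1 f = 0.
Proof.
move=> hz r0 hf hM; have [h h0 hh] := inner_room hz.
have M0 : 0 <= `|M| by exact: normr_ge0.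
apply: nrm_le0 => e e0.
(* On a square of half side k, [rect_bound] gives 16 |M| k, and points of the frame are within 2 k <
   r of z. *)
pose k := Num.min h (Num.min (r / 3) (e / (16 * (`|M| + 1)))).
have k0 : 0 < k.
  rewrite !lt_min h0 !divr_gt0// mulr_gt0//; clear -M0; lra.
have kr : k <= r / 3 by rewrite /k !ge_min lexx orbT.
have ke : k <= e / (16 * (`|M| + 1)) by rewrite /k !ge_min lexx !orbT.
have [|a1 [a2 [a3 a4]]] := hh k k0; first by rewrite /k ge_min lexx.
rewrite (@rect_shrink _ _ _ _ _ z k)//.
have i : inner (Cre z - k) (Cre z + k) (Cim z - k) (Cim z + k) z by clear -k0; split; lra.
have xk : Cre z - k <= Cre z + k by clear -k0; lra.
have yk : Cim z - k <= Cim z + k by clear -k0; lra.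
apply: le_trans (@rect_bound _ _ _ _ _ _ `|M| xk yk _ _) _.
- move=> w fw; have [||l] := hf w; [exact: box_sub (frame_box fw)|exact: inner_frame i fw|].
  exact: cderiv_ccont.
- move=> w fw; apply: le_trans (ler_norm M); apply: hM; first exact: inner_frame i fw.
  case: fw => -[b1 b2] _; apply: le_lt_trans (nrm_ReIm _) _; rewrite CreB CimB.
  have c1 : `|Cre w - Cre z| <= k by rewrite ler_norml; clear -b1; lra.
  have c2 : `|Cim w - Cim z| <= k by rewrite ler_norml; clear -b2; lra.
  by clear -c1 c2 kr r0; lra.
- have p : 0 < 16 * (`|M| + 1) by clear -M0; lra.
  move: ke; rewrite ler_pdivlMr// => ke; clear -ke M0 k0; nra.
Qed.

(* This is [2 * pi * i], but only [wind != 0] matters. *)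
Definition wind : C := rect (-1) 1 (-1) 1 (fun w => w^-1).

Lemma cderiv_kernel1 (w z : C) : w != z -> cderiv (fun v => (v - z)^-1) w (- ((w - z)^-1 ^+ 2)).
Proof.
move=> wz; rewrite -[X in cderiv _ _ X]mulr1 -[X in _ * X]subr0.
apply: (@cderivV _ (fun v : C => v - z)); first by rewrite subr_eq0.
by apply: cderivB; [exact: cderiv_id|exact: cderiv_cst].
Qed.

Lemma rect_shift x0 x1 y0 y1 f z : x0 <= x1 -> y0 <= y1 ->
  contS (frame (x0 - Cre z) (x1 - Cre z) (y0 - Cim z) (y1 - Cim z)) f ->
  rect x0 x1 y0 y1 (fun w => f (w - z)) =
  rect (x0 - Cre z) (x1 - Cre z) (y0 - Cim z) (y1 - Cim z) f.
Proof.
move=> hx hy cf; set p := Cre z in cf *; set q := Cim z in cf *.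
have hx' : x0 - p <= x1 - p by rewrite lerD2r.
have hy' : y0 - q <= y1 - q by rewrite lerD2r.
rewrite frameE// in cf.
have hE y : contS (box (x0 - p) (x1 - p) (y - q) (y - q)) f ->
    hedge y x0 x1 (fun w => f (w - z)) = hedge (y - q) (x0 - p) (x1 - p) f.
  move=> cy; rewrite /hedge -edge_shift//; last by rewrite /econt seg_h.
  congr (_ * _); apply: cint_ext => t _; congr f.
  by apply: eq_ReIm; rewrite /cpath !(CreD, CimD, CreM, CimM, CreN, CimN) /= -?/p -?/q; ring.
have vE x : contS (box (x - p) (x - p) (y0 - q) (y1 - q)) f ->
    vedge x y0 y1 (fun w => f (w - z)) = vedge (x - p) (y0 - q) (y1 - q) f.
  move=> cy; rewrite /vedge -edge_shift//; last by rewrite /econt seg_v.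
  congr (_ * _); apply: cint_ext => t _; congr f.
  by apply: eq_ReIm; rewrite /cpath !(CreD, CimD, CreM, CimM, CreN, CimN) /= -?/p -?/q; ring.
rewrite /rect !hE ?vE//.
- by apply: contS_sub cf => w ?; right.
- by apply: contS_sub cf => w ?; left; left; right.
- by apply: contS_sub cf => w ?; left; right.
- by apply: contS_sub cf => w ?; do 3!left.
Qed.

(** Both rectangles shrink to squares of the same half side k, which differ by a translation. *)
Lemma rect_wind x0 x1 y0 y1 z : inner x0 x1 y0 y1 z ->
  rect x0 x1 y0 y1 (fun w => (w - z)^-1) = wind.
Proof.
move=> hz; have [h h0 hh] := inner_room hz.
pose k := Num.min h 1; have k0 : 0 < k by rewrite lt_min h0 ltr01.
have k1 : k <= 1 by rewrite ge_min lexx orbT.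
have [|a1 [a2 [a3 a4]]] := hh k k0; first by rewrite ge_min lexx.
rewrite (@rect_shrink _ _ _ _ _ z k)//; last first.
  by move=> w _ wz; eexists; exact: cderiv_kernel1.
rewrite (@rect_shift _ _ _ _ (fun w => w^-1)); [|by clear -k0; lra..|]; last first.
  move=> w fw; apply: cderiv_ccont (cderiv_inv _).
  have i : inner (Cre z - k - Cre z) (Cre z + k - Cre z) (Cim z - k - Cim z) (Cim z + k - Cim z) (0 : C).
    by clear -k0; rewrite /inner /=; lra.
  exact: inner_frame i fw.
have b1 : -1 <= 0 - k by clear -k1; lra.
have b2 : 0 + k <= 1 by clear -k1; lra.
rewrite /wind (@rect_shrink _ _ _ _ _ (0 : C) k k0 b1 b2 b1 b2) /=; last first.
  by move=> w _ w0; eexists; exact: cderiv_inv.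
have E1 (t : R) : t - k - t = 0 - k by ring.
have E2 (t : R) : t + k - t = 0 + k by ring.
by rewrite !E1 !E2.
Qed.

(** Along each side the imaginary part of the integrand is 1 / (1 + t^2) >= 1/2, so every side
    contributes at least 1 and the imaginary part of [wind] is at least 4. *)
Lemma wind_neq0 : wind != 0.
Proof.
have m11 : -1 <= 1 :> R by lra.
have sq0 t : 0 < 1 + t ^+ 2 :> R by rewrite ltr_pwDl ?sqr_ge0.
have low (u : R -> C) : ucont (-1) 1 u -> (forall t, -1 <= t <= 1 -> 2^-1 <= Cim (u t)) ->
    1 <= Cim (cint (-1) 1 u).
  move=> cu hu; apply: (@le_trans _ _ (rint (-1) 1 (fun=> 2^-1))).
    by rewrite rint_cst//; clear; lra.
  exact: (le_rint (@rcont_cst _ _ _ _) (rcont_im cu) hu).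
have half t : -1 <= t <= 1 -> 2^-1 <= (1 + t ^+ 2)^-1 :> R.
  move=> ht; rewrite lef_pV2 ?posrE//; nra.
have invE (x y : R) : (Complex x y : C)^-1 = Complex (x / (x ^+ 2 + y ^+ 2)) (- (y / (x ^+ 2 + y ^+ 2))).
  by [].
have cinv S : (forall w, S w -> w != 0) -> contS S (fun w : C => w^-1).
  by move=> h w /h w0; exact: cderiv_ccont (cderiv_inv w0).
have key c a d (u : R -> C) : econt a d (-1) 1 (fun w => w^-1) ->
   (forall t, u t = c * d * (cpath a d t)^-1) ->
   (forall t, -1 <= t <= 1 -> 2^-1 <= Cim (u t)) ->
   1 <= Cim (c * edge a d (-1) 1 (fun w => w^-1)).
  move=> ce uE hu; have cu := econt_ucont ce.
  rewrite /edge mulrA -cintZ// -(@cint_ext _ _ _ u) => [|t _]; last exact: uE.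
  apply: low => //; have : econt a d (-1) 1 (fun w => c * d * w^-1).
    by apply: contSM; [exact: contS_cst|exact: ce].
  by move=> /econt_ucont; congr ucont; apply/funext => t; rewrite uE.
have k1 : 1 <= Cim (1 * hedge (-1) (-1) 1 (fun w => w^-1)).
  apply: (@key _ _ _ (fun t => (Complex t (-1))^-1)).
  - rewrite /econt seg_h; apply: cinv => w [_ h]; apply/eqP => w0; subst w.
    by move: h => /=; clear; lra.
  - by move=> t; rewrite cpath_h !mul1r.
  - by move=> t ht; rewrite invE /= mulN1r opprK sqrrN expr1n addrC; exact: half.
have k2 : 1 <= Cim (1 * vedge 1 (-1) 1 (fun w => w^-1)).
  apply: (@key _ _ _ (fun t => ii * (Complex 1 t)^-1)).
  - rewrite /econt seg_v; apply: cinv => w [h _]; apply/eqP => w0; subst w.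
    by move: h => /=; clear; lra.
  - by move=> t; rewrite cpath_v mul1r.
  - by move=> t ht; rewrite CimM invE /= mul0r add0r !mul1r expr1n; exact: half.
have k3 : 1 <= Cim (-1 * hedge 1 (-1) 1 (fun w => w^-1)).
  apply: (@key _ _ _ (fun t => - (Complex t 1)^-1)).
  - rewrite /econt seg_h; apply: cinv => w [_ h]; apply/eqP => w0; subst w.
    by move: h => /=; clear; lra.
  - by move=> t; rewrite cpath_h mulr1 mulN1r.
  - by move=> t ht; rewrite CimN invE /= opprK mul1r expr1n addrC; exact: half.
have k4 : 1 <= Cim (-1 * vedge (-1) (-1) 1 (fun w => w^-1)).
  apply: (@key _ _ _ (fun t => - (ii * (Complex (-1) t)^-1))).
  - rewrite /econt seg_v; apply: cinv => w [h _]; apply/eqP => w0; subst w.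
    by move: h => /=; clear; lra.
  - by move=> t; rewrite cpath_v mulN1r mulNr.
  - move=> t ht; rewrite CimN CimM invE /= mul0r add0r mul1r sqrrN expr1n mulN1r opprK.
    exact: half.
rewrite !mul1r in k1 k2; rewrite !mulN1r !CimN in k3 k4.
have h4 : 4 <= Cim wind.
  by rewrite /wind /rect !CimB CimD; move: k1 k2 k3 k4; clear; lra.
by apply/eqP => w0; move: h4; rewrite w0 /=; clear; lra.
Qed.

(** The quotient (f w - f z) / (w - z) is bounded near [z] by derivability, so its singularity is
    removable. *)
Lemma cauchy_formula x0 x1 y0 y1 f z : holo (box x0 x1 y0 y1) f ->
  inner x0 x1 y0 y1 z ->
  rect x0 x1 y0 y1 (fun w => f w / (w - z)) = f z * wind.
Proof.
move=> hf hz; have [hx hy] : x0 <= x1 /\ y0 <= y1 by case: hz => /andP[h1 h2] /andP[h3 h4]; split; [exact: ltW (lt_trans h1 h2)|exact: ltW (lt_trans h3 h4)].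
have fr := functional_rect hx hy.
have nz w : frame x0 x1 y0 y1 w -> w - z != 0.
  by move=> /(inner_frame hz); rewrite subr_eq0.
have cz : contS (frame x0 x1 y0 y1) (fun w => (w - z)^-1).
  by apply: contSV => //; apply: contSB; [exact: contS_id|exact: contS_cst].
have cf : contS (frame x0 x1 y0 y1) f by apply/holo_contS/(holo_sub _ hf)/frame_box.
rewrite -(rect_wind hz) -(functionalZ _ fr)//.
apply/eqP; rewrite -subr_eq0 -(functionalB fr); last 2 first.
- exact: contSM.
- by apply: contSM => //; exact: contS_cst.
rewrite (_ : (fun w => _) = fun w => (f w - f z) / (w - z)); last first.
  by apply/funext => w; rewrite mulrBl.
apply/eqP; have [l /cderivP dl] : exists l, cderiv f z l by apply/hf/inner_box.
have [d d0 hd] := dl 1 ltr01.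
apply: (@rect_removable _ _ _ _ _ z d (nrm l + 1)) => //.
  move=> w bw wz; have [l' dl'] := hf w bw; eexists.
  apply: cderivM; last exact: cderiv_kernel1.
  by apply: cderivB; [exact: dl'|exact: cderiv_cst].
move=> w wz hw; have p : 0 < nrm (w - z) by rewrite nrm_gt0 subr_eq0.
rewrite nrmM nrmV ler_pdivrMr// mulrDl mul1r.
have := hd w hw; rewrite mul1r => h; have := nrmD (f w - f z - l * (w - z)) (l * (w - z)).
by rewrite subrK nrmM; move: h; clear; lra.
Qed.

Lemma holo_kernel_eq0 x0 x1 y0 y1 f z : x0 <= x1 -> y0 <= y1 ->
  holo (box x0 x1 y0 y1) f -> ~ box x0 x1 y0 y1 z ->
  rect x0 x1 y0 y1 (fun w => f w / (w - z)) = 0.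
Proof.
move=> hx hy hf nz; apply: goursat => // w bw; have [l dl] := hf w bw; eexists.
apply: cderivM; first exact: dl.
by apply: cderiv_kernel1; apply/eqP => wz; subst w.
Qed.

End cauchy.

(** * Derivatives, locally uniform limits and the identity theorem *)

Section holomorphic_functions.
Context {R : realType}.
Local Notation C := (R[i]^o).
Implicit Types (f F g a : C -> C) (z w v : C) (U : set C).

Definition sqbox z (s : R) := box (Cre z - s) (Cre z + s) (Cim z - s) (Cim z + s).
Definition sqframe z (s : R) := frame (Cre z - s) (Cre z + s) (Cim z - s) (Cim z + s).
Definition sqint z (s : R) := rect (Cre z - s) (Cre z + s) (Cim z - s) (Cim z + s).
Definition sqinner z (s : R) := inner (Cre z - s) (Cre z + s) (Cim z - s) (Cim z + s).

Lemma sqboxP z s w : sqbox z s w <-> `|Cre (w - z)| <= s /\ `|Cim (w - z)| <= s.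
Proof.
rewrite /sqbox /box /= CreB CimB !ler_norml; split => -[h1 h2]; split; move: h1 h2; clear; lra.
Qed.

Lemma sqbox_nrm z s w : sqbox z s w -> nrm (w - z) <= 2 * s.
Proof.
by move=> /sqboxP[h1 h2]; have := nrm_ReIm (w - z); move: h1 h2; clear; lra.
Qed.

Lemma sqinner_nrm z s w : nrm (w - z) < s -> sqinner z s w.
Proof.
move=> h; have := le_lt_trans (nrm_Re _) h; have := le_lt_trans (nrm_Im _) h.
rewrite /sqinner /inner /= CreB CimB !ltr_norml; clear; lra.
Qed.

Lemma sqframe_nrm z s w : sqframe z s w -> s <= nrm (w - z).
Proof.
move=> [[/andP[h1 h2] /andP[h3 h4]] h]; have := nrm_Re (w - z); have := nrm_Im (w - z).
rewrite CreB CimB; have := ler_norm (Cre w - Cre z); have := ler_norm (- (Cre w - Cre z)).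
have := ler_norm (Cim w - Cim z); have := ler_norm (- (Cim w - Cim z)); rewrite !normrN.
by case: h => [|[|[|]]] ->; clear; lra.
Qed.

Lemma sq_le (x s : R) : 0 < s -> x - s <= x + s. Proof. by move=> h; lra. Qed.

Lemma functional_sq z s : 0 < s -> functional (sqframe z s) (sqint z s).
Proof. by move=> s0; apply: functional_rect; exact: sq_le. Qed.

Lemma compact_sqframe z s : 0 < s -> compact (sqframe z s).
Proof. by move=> s0; apply: compact_frame; exact: sq_le. Qed.

Lemma open_sqbox U z : open U -> U z -> exists2 s : R, 0 < s & sqbox z s `<=` U.
Proof.
move=> /openP oU /oU[e e0 he]; exists (e / 3) => [|w /sqbox_nrm hw]; first by lra.
by apply: he; move: hw e0; clear; lra.
Qed.

(** The exponent 1 is kept so that the right-hand side has the form that [sq_kernel_cderiv]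
    differentiates. *)
Lemma cauchy_sq f z s v : 0 < s -> holo (sqbox z s) f -> sqinner z s v ->
  f v = wind^-1 * sqint z s (fun w => f w / (w - v) ^+ 1).
Proof.
move=> s0 hf iv; under eq_fun do rewrite expr1.
by rewrite /sqint (cauchy_formula hf iv) mulrC mulfK// wind_neq0.
Qed.

Lemma sq_kernel_cderiv z s a k v : 0 < s -> contS (sqframe z s) a -> sqinner z s v ->
  cderiv (fun v => sqint z s (fun w => a w / (w - v) ^+ k)) v
    (k%:R * sqint z s (fun w => a w / (w - v) ^+ k.+1)).
Proof.
move=> s0 ca iv.
have h w : sqframe z s w -> (fun w : C => w) w != v by move=> fw; exact: inner_frame iv fw.
exact: (@kernel_cderiv R _ _ a (fun w => w) v k (@functional_sq z s s0) (@compact_sqframe z s s0) ca (@contS_id _ _) h).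
Qed.

Definition cder f z : C := get [set l | cderiv f z l].

Lemma cderE f z l : cderiv f z l -> cder f z = l.
Proof.
move=> h; have : [set l | cderiv f z l] (cder f z) by apply: getI; exact: h.
by move=> h'; exact: cderiv_unique h' h.
Qed.

Lemma holo_cder U f z : holo U f -> U z -> cderiv f z (cder f z).
Proof. by move=> h Uz; have [l dl] := h z Uz; rewrite (cderE dl). Qed.

Lemma sqinner_open z s v : sqinner z s v ->
  exists2 e : R, 0 < e & forall w, nrm (w - v) < e -> sqinner z s w.
Proof. by move=> h; have /openP/(_ v h) := @open_inner R (Cre z - s) (Cre z + s) (Cim z - s) (Cim z + s). Qed.

Lemma sqinner_center z s : 0 < s -> sqinner z s z.
Proof. by move=> s0; apply: sqinner_nrm; rewrite subrr nrm0. Qed.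

Lemma sqframe_box z s : sqframe z s `<=` sqbox z s. Proof. exact: frame_box. Qed.

Lemma holo_deriv U f : open U -> holo U f -> holo U (cder f).
Proof.
move=> oU hf z Uz; have [s s0 sU] := open_sqbox oU Uz.
have hb : holo (sqbox z s) f by exact: holo_sub sU hf.
have cf : contS (sqframe z s) f by apply/holo_contS/(holo_sub (@sqframe_box _ _) hb).
have d1 v : sqinner z s v ->
    cder f v = wind^-1 * sqint z s (fun w => f w / (w - v) ^+ 2).
  move=> iv; apply: cderE; have [e e0 he] := sqinner_open iv.
  apply: (@cderiv_near _ (fun v => wind^-1 * sqint z s (fun w => f w / (w - v) ^+ 1))).
    by exists e => // w /he iw; rewrite -cauchy_sq.
  rewrite -[X in cderiv _ _ (_ * X)]mul1r; apply: cderivZ; exact: (sq_kernel_cderiv 1 s0 cf iv).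
have iz := @sqinner_center z s s0; have [e e0 he] := sqinner_open iz.
eexists; apply: (@cderiv_near _ (fun v => wind^-1 * sqint z s (fun w => f w / (w - v) ^+ 2))).
  by exists e => // w /he iw; rewrite -d1.
by apply: cderivZ; exact: (sq_kernel_cderiv 2 s0 cf iz).
Qed.

(** Cauchy's formula on squares passes to the uniform limit [f], and its right-hand side is
    derivable as soon as [f] is continuous on the frame. *)
Theorem weierstrass U f : open U ->
  (forall K, compact K -> K `<=` U -> forall e : R, 0 < e ->
    exists2 g, holo U g & forall z, K z -> nrm (f z - g z) <= e) -> holo U f.
Proof.
move=> oU app z Uz; have [s s0 sU] := open_sqbox oU Uz.
have cb : compact (sqbox z s) by exact: compact_box.
have cf : contS U f.
  move=> w Uw e e0; have [r r0 rU] := open_sqbox oU Uw.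
  have [|g hg hb] := app (sqbox w r) (@compact_box _ _ _ _ _) rU (e / 4); first by lra.
  have cg : ccont g w by have [l /cderiv_ccont] := hg w Uw.
  have e4 : 0 < e / 4 by lra.
  have [d d0 hd] := cg _ e4; exists (Num.min d r) => [|v]; first by rewrite lt_min d0.
  rewrite lt_min => /andP[/hd h1 /sqinner_nrm/inner_box h2].
  have := hb v h2; have := hb w (inner_box (@sqinner_center w r r0)).
  rewrite (_ : f v - f w = (f v - g v) + (g v - g w) - (f w - g w)); last by ring.
  have := nrmB (f v - g v + (g v - g w)) (f w - g w); have := nrmD (f v - g v) (g v - g w).
  by move: h1 e0; clear; lra.
have cff : contS (sqframe z s) f by apply: contS_sub cf => w /sqframe_box/sU.
have iz := @sqinner_center z s s0; have [r r0 hr] := sqinner_open iz.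
eexists; apply: (@cderiv_near _ (fun v => wind^-1 * sqint z s (fun w => f w / (w - v) ^+ 1))); last first.
  by apply: cderivZ; exact: (sq_kernel_cderiv 1 s0 cff iz).
exists r => // v /hr iv; apply/esym/eqP; rewrite -subr_eq0; apply/eqP.
have nv w : sqframe z s w -> w - v != 0 by move=> fw; rewrite subr_eq0 (inner_frame iv fw).
have cv : contS (sqframe z s) (fun w => w - v) by apply: contSB; [exact: contS_id|exact: contS_cst].
have [d d0 hd] := contS_away (@compact_sqframe z s s0) cv nv.
have fL := @functional_sq z s s0; have [_ _ [B B0 hB]] := fL.
(* If [g] is within e / K of [f], the values at v differ by at most e / K and the Cauchy integrals
   by at most (K - 1) e / K. *)
apply: nrm_le0 => e e0; pose K := nrm (wind^-1 : C) * (B * d^-1) + 1.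
have K0 : 0 < K.
  by rewrite ltr_wpDl// mulr_ge0 ?nrm_ge0// mulr_ge0// invr_ge0 ltW.
have [|g hg hb] := app _ cb sU (e / K); first by rewrite divr_gt0.
have hbg : holo (sqbox z s) g by exact: holo_sub sU hg.
have cg : contS (sqframe z s) g by apply/holo_contS/(holo_sub (@sqframe_box _ _) hbg).
have kc a : contS (sqframe z s) a -> contS (sqframe z s) (fun w => a w / (w - v) ^+ 1).
  by move=> ca; apply: contSM => //; apply: contSV; [move=> w fw; rewrite expr1 nv|exact: contSX].
rewrite (_ : _ - _ = (f v - g v) - wind^-1 * sqint z s (fun w => f w / (w - v) ^+ 1 - g w / (w - v) ^+ 1)); last first.
  rewrite (functionalB fL (kc _ cff) (kc _ cg)) (cauchy_sq s0 hbg iv); ring.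
apply: le_trans (nrmB _ _) _.
have h1 : nrm (f v - g v) <= e / K by apply: hb; exact: inner_box iv.
have h2 : nrm (sqint z s (fun w => f w / (w - v) ^+ 1 - g w / (w - v) ^+ 1)) <= B * (e / K * d^-1).
  apply: hB; first by rewrite mulr_ge0 ?divr_ge0 ?invr_ge0 ?ltW.
    by apply: contSB; exact: kc.
  move=> w fw; rewrite -mulrBl nrmM expr1; apply: ler_pM; rewrite ?nrm_ge0//.
    by apply: hb; exact: sqframe_box.
  by apply: nrm_invB => //; exact: hd.
apply: (@le_trans _ _ (e / K + nrm (wind^-1 : C) * (B * (e / K * d^-1)))).
  by apply: lerD => //; rewrite nrmM ler_wpM2l ?nrm_ge0.
rewrite (_ : _ + _ = e / K * K); last by rewrite /K; ring.
by rewrite divfK// gt_eqF.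
Qed.

(* All derivatives of [f] at the centre vanish, so that expanding the Cauchy
   kernel about the centre leaves only a remainder that tends to 0. *)
Lemma vanish_spread b s f : 0 < s -> holo (sqbox b s) f ->
  (exists2 e : R, 0 < e & forall w, nrm (w - b) < e -> f w = 0) ->
  forall z, nrm (z - b) <= s / 2 -> f z = 0.
Proof.
move=> s0 hf [e0 e00 f0] z hz.
have cf : contS (sqframe b s) f by apply/holo_contS/(holo_sub (@sqframe_box _ _) hf).
have fL := @functional_sq b s s0.
have [e e_gt0 [he0 hes]] : exists2 e : R, 0 < e & e <= e0 /\ e <= s.
  by exists (Num.min e0 s); rewrite ?lt_min ?e00 ?s0// !ge_min !lexx orbT.
(* By induction on k: the integral with exponent k + 1 vanishes near b, and its derivative is k + 1
   times the next one. *)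
have G0 k v : nrm (v - b) < e -> sqint b s (fun w => f w / (w - v) ^+ k.+1) = 0.
  elim: k v => [|k IH] v hv.
    have iv : sqinner b s v by apply: sqinner_nrm; exact: lt_le_trans hes.
    have := cauchy_sq s0 hf iv; rewrite f0; last exact: lt_le_trans he0.
    move/esym/eqP; rewrite mulf_eq0 invr_eq0 (negbTE wind_neq0) /= => /eqP; exact.
  have iv : sqinner b s v by apply: sqinner_nrm; exact: lt_le_trans hes.
  have := sq_kernel_cderiv k.+1 s0 cf iv.
  have : cderiv (fun v => sqint b s (fun w => f w / (w - v) ^+ k.+1)) v 0.
    apply: (@cderiv_near _ (fun=> 0)); last exact: cderiv_cst.
    exists (e - nrm (v - b)); first by rewrite subr_gt0.
    move=> w hw; rewrite IH//; have := nrm_tri v w b; move: hw; clear; lra.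
  move=> d1 d2; have /esym/eqP := cderiv_unique d1 d2.
  by rewrite mulf_eq0 pnatr_eq0 /= => /eqP.
have zs : nrm (z - b) < s by move: hz s0; clear; lra.
have iz := sqinner_nrm zs.
have nz w : sqframe b s w -> w - z != 0 by move=> fw; rewrite subr_eq0 (inner_frame iz fw).
have nb w : sqframe b s w -> w - b != 0.
  by move=> /sqframe_nrm h; rewrite -nrm_gt0; exact: lt_le_trans h.
have cz c : contS (sqframe b s) (fun w => w - c) by apply: contSB; [exact: contS_id|exact: contS_cst].
(* Up to the factor [f], [h n] is the remainder of 1 / (w - z) after n terms of its expansion in
   powers of (z - b) / (w - b), a ratio of modulus at most 1/2 on the frame. *)
pose h n w := f w * (((z - b) / (w - b)) ^+ n / (w - z)).
have ch n : contS (sqframe b s) (h n).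
  apply: contSM => //; apply: contSM; last exact: contSV.
  by apply: contSX; apply: contSM; [exact: contS_cst|exact: contSV].
have ck n : contS (sqframe b s) (fun w => f w / (w - b) ^+ n.+1).
  by apply: contSM => //; apply: contSV; [move=> w fw; rewrite expf_neq0// nb|exact: contSX].
have step n : sqint b s (h n) = sqint b s (h n.+1).
  rewrite -[RHS]add0r -(mulr0 ((z - b) ^+ n)) -(G0 n b) ?subrr ?nrm0//.
  rewrite -(functionalZ _ fL)// -(functionalD fL)//; last first.
    by apply: contSM => //; exact: contS_cst.
  apply: (functional_ext fL) => //.
    by apply: contSD => //; apply: contSM => //; exact: contS_cst.
  move=> w fw; rewrite /h !exprMn !exprVn !exprS; have := expf_neq0 n (nb w fw).
  move: (nb w fw) (nz w fw); set X := (w - b) ^+ n; set Y := (z - b) ^+ n => h1 h2 h3.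
  by field; rewrite h1 h2 h3.
have all n : sqint b s (h 0) = sqint b s (h n) by elim: n => [//|n ->].
have [A A0 hA] := contS_bounded (@compact_sqframe b s s0) cf.
have [d d0 hd] := contS_away (@compact_sqframe b s s0) (cz z) nz.
have [_ _ [B B0 hB]] := fL.
have bnd n : nrm (sqint b s (h n)) <= B * (A * ((2^-1) ^+ n * d^-1)).
  apply: hB => //.
    by rewrite mulr_ge0 ?mulr_ge0 ?exprn_ge0 ?invr_ge0// ltW.
  move=> w fw; rewrite /h nrmM; apply: ler_pM; rewrite ?nrm_ge0 ?hA//.
  rewrite nrmM; apply: ler_pM; rewrite ?nrm_ge0//; last by apply: nrm_invB => //; exact: hd.
  rewrite nrmX; apply: lerXn2r; rewrite ?nnegrE ?nrm_ge0 ?invr_ge0//.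
  have wb := sqframe_nrm fw; rewrite nrmM nrmV ler_pdivrMr; last exact: lt_le_trans wb.
  by move: hz wb; clear; lra.
have sz : sqint b s (h 0) = 0.
  apply: nrm_le0 => e1 e10; have [n hn] := ex_pow2_lt (B * (A * d^-1)) e10.
  rewrite (all n); apply: le_trans (bnd n) (ltW _).
  by rewrite (_ : _ * _ = B * (A * d^-1) / 2 ^+ n)// exprVn; ring.
rewrite (cauchy_sq s0 hf iz) (_ : (fun w => _) = h 0) ?sz ?mulr0//.
by apply/funext => w; rewrite /h expr0 expr1 mul1r.
Qed.

(** The points near which [f] vanishes form an open set, closed in [U] because [vanish_spread]
    reaches a distance that depends only on the room left in [U]. *)
Theorem identity_theorem U f z0 : open U -> connected U -> holo U f -> U z0 ->
  (exists2 e : R, 0 < e & forall w, nrm (w - z0) < e -> f w = 0) ->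
  forall z, U z -> f z = 0.
Proof.
move=> oU cU hf Uz0 f0.
pose Z := [set z | U z /\ exists2 e : R, 0 < e & forall w, nrm (w - z) < e -> f w = 0].
have oZ : open Z.
  apply/openP => z [Uz [e e0 he]]; have /openP/(_ z Uz)[r r0 hr] := oU.
  exists (Num.min (e / 2) r) => [|w]; first by rewrite lt_min r0 divr_gt0.
  rewrite lt_min => /andP[h1 h2]; split; first exact: hr.
  exists (e / 2) => [|v hv]; first by rewrite divr_gt0.
  by apply: he; have := nrm_tri w v z; move: hv h1; clear; lra.
have -> // : U = Z; last first.
  by move=> z [_ [e e0 he]]; apply: he; rewrite subrr nrm0.
apply/esym; apply: cU.
- by exists z0.
- by exists Z => //; apply/seteqP; split => [z [Uz ?]|z []//]; split => //; split.
exists (closure Z); first exact: closed_closure.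
apply/seteqP; split => [z Zz|a [Ua clZ]].
  by split; [case: Zz|exact: subset_closure].
split => //; have /openP/(_ a Ua)[r r0 hr] := oU.
(* For b within r / 8 of a, the square of half side r / 4 about b stays at distance less than r from
   a, and vanishing spreads from b to distance r / 8, hence beyond a. *)
have r8 : 0 < r / 8 by rewrite divr_gt0.
have [|b [[Ub fb] /= hb]] := clZ [set w | nrm (w - a) < r / 8].
  by apply/nbhs_nrmP; exists (r / 8).
have s0 : 0 < r / 4 by rewrite divr_gt0.
have hsq : holo (sqbox b (r / 4)) f.
  apply: holo_sub hf => w /sqbox_nrm hw; apply: hr; have := nrm_tri b w a.
  by move: hw hb r0; clear; lra.
exists (r / 8 - nrm (b - a)) => [|w hw]; first by rewrite subr_gt0.
apply: (vanish_spread s0 hsq fb); have := nrm_tri a w b; rewrite (nrmBC a b).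
by move: hw r0; clear; lra.
Qed.

End holomorphic_functions.

(** * Polynomial convexity and Runge theory *)

Section hulls.
Context {R : realType}.
Local Notation C := (R[i]^o).
Implicit Types (p q : {poly R[i]}) (z w b : C) (K N U A B : set C).

(* The polynomially convex hull. [M] may be negative, so that [hull set0] is
   empty. *)
Definition hull K : set C := [set b | forall p (M : R),
  (forall z, K z -> nrm p.[z] <= M) -> nrm p.[b] <= M].

Definition papprox K (f : C -> C) := forall e : R, 0 < e ->
  exists p, forall z, K z -> nrm (f z - p.[z]) <= e.

Lemma sub_hull K : K `<=` hull K. Proof. by move=> z Kz p M; apply. Qed.

Lemma hullS A B : A `<=` B -> hull A `<=` hull B.
Proof. by move=> AB z hz p M h; apply: hz => w /AB; exact: h. Qed.

Lemma hullK K : hull (hull K) = hull K.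
Proof.
apply/seteqP; split; last exact: sub_hull.
by move=> z hz p M h; apply: hz => w; exact.
Qed.

Lemma closed_hull K : closed (hull K).
Proof.
apply/closedP => z nz; have [p [M [hM hz]]] : exists p M, (forall w, K w -> nrm p.[w] <= M) /\ M < nrm p.[z].
  apply: contrapT => h; apply: nz => p M hM; rewrite leNgt; apply/negP => hz.
  by apply: h; exists p, M.
have e0 : 0 < nrm p.[z] - M by rewrite subr_gt0.
have [d d0 hd] := ccont_poly p z e0; exists d => // w /hd hw hull_w.
have := hull_w p M hM; have := nrm_sub p.[z] p.[w]; rewrite nrmBC.
by move: hw; clear; lra.
Qed.

Lemma bounded_hull K : bounded K -> bounded (hull K).
Proof.
by move=> [M hM]; exists M => z /(_ 'X M); rewrite !hornerX; apply => w; rewrite hornerX; exact: hM.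
Qed.

Lemma compact_hull K : compact K -> compact (hull K).
Proof. by move=> /compactP[_ bK]; apply/compactP; split; [exact: closed_hull|exact: bounded_hull]. Qed.

Lemma ex_expr_lt (r e : R) : 0 <= r < 1 -> 0 < e -> exists n, r ^+ n < e.
Proof.
move=> /andP[r0 r1] e0; have := @cvg_expr R r; rewrite ger0_norm// => /(_ r1).
move=> /cvgrPdist_lt/(_ e e0)[n _ /(_ n (leqnn n))] /=.
by rewrite sub0r normrN ger0_norm ?exprn_ge0// => h; exists n.
Qed.

(** Normalise a separating polynomial at [b] and raise it to a high power. The constant 1/4 leaves
    room for a perturbation of the same size. *)
Lemma nhullP K b : ~ hull K b ->
  exists2 p, p.[b] = 1 & forall z, K z -> nrm p.[z] <= 4^-1.
Proof.
move=> nb; have [p [M [hM hb]]] : exists p M, (forall w, K w -> nrm p.[w] <= M) /\ M < nrm p.[b].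
  apply: contrapT => h; apply: nb => p M hM; rewrite leNgt; apply/negP => hz.
  by apply: h; exists p, M.
have [K0|/set0P[z0 Kz0]] := eqVneq K set0.
  by exists 1; [rewrite hornerC|rewrite K0].
have M0 : 0 <= M by apply: le_trans (nrm_ge0 _) (hM _ Kz0).
have p0 : 0 < nrm p.[b] by exact: le_lt_trans hb.
have pb : p.[b] != 0 by rewrite -nrm_gt0.
have [||n hn] := @ex_expr_lt (M / nrm p.[b]) 4^-1; first 2 last.
- exists (((p.[b])^-1 *: p) ^+ n); first by rewrite horner_exp hornerZ mulVf// expr1n.
  move=> z /hM h; rewrite horner_exp nrmX; apply: le_trans (ltW hn).
  apply: lerXn2r; rewrite ?nnegrE ?nrm_ge0 ?divr_ge0 ?nrm_ge0//.
  by rewrite hornerZ nrmM nrmV mulrC ler_pM2r// invr_gt0.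
- by apply/andP; split; [rewrite divr_ge0// nrm_ge0|rewrite ltr_pdivrMr// mul1r].
- by rewrite invr_gt0.
Qed.

Lemma poly_bound K p : compact K -> exists2 M : R, 0 < M & forall z, K z -> nrm p.[z] <= M.
Proof. by move=> cK; apply: (@contS_bounded _ K (fun w => p.[w]) cK) => w _; exact: ccont_poly. Qed.

(* If [p b = 1] and [p] is small on K, then [1 - p = ('X - b) q] and
   [(z - b)^-1 = q z / (1 - p z)] is a geometric series in [p z]. *)
Lemma papprox_inv_nbhs K b : compact K -> ~ hull K b -> exists N, [/\ open N, K `<=` N, ~ N b &
  forall e : R, 0 < e -> exists p, forall z, N z -> nrm ((z - b)^-1 - p.[z]) <= e].
Proof.
move=> cK /nhullP[p pb hr].
have [q qE] : exists q, 1 - p = q * ('X - b%:P).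
  by apply/factor_theorem; rewrite /root hornerD hornerN hornerC pb subrr.
have qz z : 1 - p.[z] = q.[z] * (z - b).
  by have := congr1 (fun q => q.[z]) qE; rewrite hornerM hornerXsubC hornerD hornerN hornerC.
have [M M0 hM] := poly_bound q cK.
(* On this set |1 - p| >= 1/2, so the remainder q p^n / (1 - p) of the series is at most 2 (M + 1)
   2^-n. *)
exists [set z : C | nrm p.[z] < 2^-1 /\ nrm q.[z] < M + 1]; split.
- apply/openP => z [h1 h2].
  have e1 : 0 < 2^-1 - nrm p.[z] by rewrite subr_gt0.
  have e2 : 0 < M + 1 - nrm q.[z] by rewrite subr_gt0.
  have [d d0 hd] := ccont_poly p z e1; have [d' d'0 hd'] := ccont_poly q z e2.
  exists (Num.min d d') => [|w]; first by rewrite lt_min d0.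
  rewrite lt_min => /andP[/hd k1 /hd' k2].
  have := nrm_sub p.[w] p.[z]; have := nrm_sub q.[w] q.[z].
  by move: k1 k2; clear; split; lra.
- move=> z Kz; split; first by apply: le_lt_trans (hr _ Kz) _; clear; lra.
  by have := hM z Kz; clear; lra.
- by move=> [+ _]; rewrite pb nrm1; clear; lra.
move=> e e0; have [n hn] := @ex_pow2_lt R (2 * (M + 1)) e e0.
exists (q * \sum_(i < n) p ^+ i) => z [h1 h2].
have up : 2^-1 <= nrm (1 - p.[z]).
  by have := nrm_sub 1 p.[z]; rewrite nrm1; move: h1; clear; lra.
have zb : z - b != 0.
  apply/eqP => zb; move: up; rewrite qz zb mulr0 nrm0; clear; lra.
have q0 : q.[z] != 0.
  apply/eqP => qz0; move: up; rewrite qz qz0 mul0r nrm0; clear; lra.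
have p1 : 1 - p.[z] != 0 by rewrite qz mulf_neq0.
have -> : (z - b)^-1 - (q * \sum_(i < n) p ^+ i).[z] = q.[z] * (p.[z] ^+ n / (1 - p.[z])).
  have sE : (1 - p.[z]) * (\sum_(i < n) p ^+ i).[z] = 1 - p.[z] ^+ n.
    rewrite -[RHS]opprB subrX1 -mulNr opprB; congr (_ * _).
    by rewrite horner_sum; apply: eq_bigr => i _; rewrite horner_exp.
  have SE : (\sum_(i < n) p ^+ i).[z] = (1 - p.[z] ^+ n) / (1 - p.[z]).
    by rewrite -sE mulrC mulKf.
  have zE : (z - b)^-1 = q.[z] / (1 - p.[z]) by rewrite qz invfM mulrA divff// mul1r.
  by rewrite hornerM SE zE; field; exact: p1.
apply: le_trans (ltW hn); rewrite !nrmM nrmV.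
have h3 : nrm p.[z] ^+ n <= 2^-1 ^+ n.
  by apply: lerXn2r; rewrite ?nnegrE ?nrm_ge0 ?invr_ge0// ltW.
have h4 : (nrm (1 - p.[z]))^-1 <= 2.
  by rewrite -[leRHS]invrK lef_pV2 ?posrE ?invr_gt0//; exact: lt_le_trans up.
rewrite (_ : 2 * (M + 1) / 2 ^+ n = (M + 1) * (2^-1 ^+ n * 2)); last by rewrite exprVn; ring.
apply: ler_pM; rewrite ?nrm_ge0 ?mulr_ge0 ?invr_ge0 ?nrm_ge0//; first exact: ltW.
by rewrite nrmX; apply: ler_pM; rewrite ?exprn_ge0 ?invr_ge0 ?nrm_ge0.
Qed.

Lemma papprox_inv K b : compact K -> ~ hull K b -> papprox K (fun z => (b - z)^-1).
Proof.
move=> cK nb e e0; have [N [_ KN _ /(_ e e0)[p hp]]] := papprox_inv_nbhs cK nb.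
exists (- p) => z /KN/hp; rewrite -nrmN hornerN; congr (nrm _ <= _).
by rewrite opprB opprK addrC -invrN opprB.
Qed.

(* If b in the hull had points b' outside it arbitrarily near, a polynomial
   close to [(b' - b) / (b' - z)] would be 1 at b and small on K. *)
Lemma open_hullD K : compact K -> open (hull K `\` K).
Proof.
move=> cK; apply/openP => b [hb nKb].
have [|d d0 hd] := @contS_away _ K (fun z => z - b) cK (contSB (@contS_id _ _) (@contS_cst _ _ _)).
  by move=> w Kw; rewrite subr_eq0; apply/eqP => wb; subst w.
exists (d / 4) => [|b' hb']; first by rewrite divr_gt0.
have far z : K z -> d * (3 / 4) <= nrm (z - b').
  by move=> /hd; have := nrm_tri b' z b; rewrite -[X in _ <= _ + X]nrmN; rewrite nrmN; move: hb'; clear; lra.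
have nKb' : ~ K b' by move=> /far; rewrite subrr nrm0; move: d0; clear; lra.
split => //; apply: contrapT => nb'.
have [M M0 hM] : exists2 M : R, 0 < M & forall z, K z -> nrm (z - b) <= M.
  apply: (@contS_bounded _ K (fun z => z - b) cK).
  by apply: contSB; [exact: contS_id|exact: contS_cst].
(* The quotient (b' - b) / (b' - z) is at most (d / 4) / (3 d / 4) = 1/3 on K, and this accuracy for
   [a] costs another 1/3, as |z - b| <= M. *)
have e0 : 0 < (3 * M)^-1 by rewrite invr_gt0 mulr_gt0.
have [a ha] := papprox_inv cK nb' e0.
have PE z : (1%:P + ('X - b%:P) * a).[z] = 1 + (z - b) * a.[z].
  by rewrite hornerD hornerC hornerM hornerXsubC.
have := hb (1%:P + ('X - b%:P) * a) (2 / 3); rewrite PE subrr mul0r addr0 nrm1 => H.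
suff : 1 <= 2 / 3 :> R by clear; lra.
apply: H => z Kz; rewrite PE.
have zb' : b' - z != 0.
  by rewrite -nrm_gt0 nrmBC; apply: lt_le_trans (far _ Kz); move: d0; clear; lra.
rewrite (_ : 1 + _ = (b' - b) / (b' - z) - (z - b) * ((b' - z)^-1 - a.[z])); last by field.
apply: le_trans (nrmB _ _) _.
have h1 : nrm ((b' - b) / (b' - z)) <= 1 / 3.
  rewrite nrmM nrmV ler_pdivrMr ?nrm_gt0//; have := far _ Kz; rewrite (nrmBC b' z).
  by move: hb'; clear; lra.
have h2 : nrm ((z - b) * ((b' - z)^-1 - a.[z])) <= 1 / 3.
  rewrite nrmM (_ : 1 / 3 = M * (3 * M)^-1); last by field; rewrite gt_eqF.
  by apply: ler_pM; rewrite ?nrm_ge0 ?hM ?ha.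
by move: h1 h2; clear; lra.
Qed.

(* [hull K `\` K] is bounded, and open and closed in the complement of K. *)
Lemma hull_compl_connected K : compact K -> connected (~` K) -> hull K `<=` K.
Proof.
move=> cK conn; apply: contrapT => /existsNP[b /not_implyP[hb nKb]].
have E : hull K `\` K = ~` K.
  apply: conn.
  - by exists b.
  - by exists (hull K `\` K); [exact: open_hullD|apply/seteqP; split => z; [by move=> [h1 h2]|by move=> []]].
  - by exists (hull K); [exact: closed_hull|rewrite setDE setIC].
have /compactP[_ [M hM]] := compact_hull cK.
have [_ [M' hM']] := (compactP K).1 cK.
pose z : C := rc (`|M| + `|M'| + 1).
have nz : nrm z = `|M| + `|M'| + 1.
  by rewrite nrm_real ger0_norm// addr_ge0 ?addr_ge0.
have : (~` K) z.
  by move=> /hM'; rewrite nz; have := ler_norm M'; have := normr_ge0 M; clear; lra.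
rewrite -E => -[/hM + _]; rewrite nz; have := ler_norm M; have := normr_ge0 M'; clear; lra.
Qed.

Lemma poly_primitive p : exists P, P^`() = p.
Proof.
exists (\sum_(i < size p) (p`_i / i.+1%:R) *: 'X^(i.+1)).
rewrite raddf_sum /= -[RHS]coefK poly_def; apply: eq_bigr => i _.
by rewrite derivZ derivXn /= -scalerMnr scalerMnl -(mulr_natr (p`_i / _)) divfK ?pnatr_eq0.
Qed.

End hulls.

(** * Chains of grid edges and approximation of Cauchy integrals *)

Section grid.
Context {R : realType}.
Local Notation C := (R[i]^o).

Lemma sum_shift (t b : nat -> C) N : t 0 = 0 -> t N = 0 ->
  \sum_(k < N.+1) t k * (b k - b k.+1) = \sum_(k < N.+1) (t k - t k.-1) * b k.
Proof.
move=> t0 tN; under eq_bigr do rewrite mulrBr.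
rewrite sumrB; under [RHS]eq_bigr do rewrite mulrBl.
rewrite sumrB; congr (_ - _).
by rewrite big_ord_recr /= tN mul0r addr0 big_ord_recl /= t0 mul0r add0r.
Qed.

(** Summation by parts in both directions: with [t] the weights of the cells, an edge carries the
    difference of the weights of its two cells. At index 0 the convention [0.-1 = 0] makes this
    difference 0, which is correct since [t] vanishes on the border. *)
Lemma grid_identity (t : nat -> nat -> C) (b v : nat -> nat -> C) N :
  (forall j, t j 0 = 0) -> (forall j, t j N = 0) ->
  (forall k, t 0 k = 0) -> (forall k, t N k = 0) ->
  \sum_(j < N.+1) \sum_(k < N.+1) t j k * (b j k + v j.+1 k - b j k.+1 - v j k) =
  \sum_(j < N.+1) \sum_(k < N.+1)
     ((t j k - t j k.-1) * b j k + (t j.-1 k - t j k) * v j k).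
Proof.
move=> tj0 tjN t0k tNk.
transitivity (\sum_(j < N.+1) \sum_(k < N.+1) t j k * (b j k - b j k.+1) -
  \sum_(j < N.+1) \sum_(k < N.+1) t j k * (v j k - v j.+1 k)).
  rewrite -sumrB; apply: eq_bigr => j _; rewrite -sumrB; apply: eq_bigr => k _; ring.
rewrite [X in _ - X]exchange_big /=.
under [X in X - _]eq_bigr do rewrite (@sum_shift (t _) (b _))//.
under [X in _ - X]eq_bigr => k _ do rewrite (@sum_shift (t^~ k) (v^~ k))//.
rewrite [X in _ - X]exchange_big /= -sumrB; apply: eq_bigr => j _.
by rewrite -sumrB; apply: eq_bigr => k _; ring.
Qed.

Implicit Types (K S : set C).

Lemma papproxD K (f g : C -> C) : papprox K f -> papprox K g ->
  papprox K (fun z => f z + g z).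
Proof.
move=> hf hg e e0; have e2 : 0 < e / 2 by rewrite divr_gt0.
have [p hp] := hf _ e2; have [q hq] := hg _ e2; exists (p + q) => z Kz.
rewrite hornerD opprD addrACA; apply: le_trans (nrmD _ _) _.
by have := hp z Kz; have := hq z Kz; clear; lra.
Qed.

Lemma papproxZ K c (f : C -> C) : papprox K f -> papprox K (fun z => c * f z).
Proof.
move=> hf e e0; have c1 : 0 < nrm c + 1 by have := nrm_ge0 c; clear; lra.
have [|p hp] := hf (e / (nrm c + 1)); first by rewrite divr_gt0.
exists (c *: p) => z Kz; rewrite hornerZ -mulrBr nrmM.
have := hp z Kz; rewrite ler_pdivlMr// mulrDr mulr1 mulrC.
by have := nrm_ge0 (f z - p.[z]); clear; lra.
Qed.

Lemma papprox0 K : papprox K (fun=> 0).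
Proof. by move=> e e0; exists 0 => z _; rewrite horner0 subrr nrm0 ltW. Qed.

Lemma papprox_sum K n (f : 'I_n -> C -> C) : (forall i, papprox K (f i)) ->
  papprox K (fun z => \sum_(i < n) f i z).
Proof.
move=> h; elim: n f h => [|n IH] f h.
  rewrite (_ : (fun z => _) = fun=> 0); first exact: papprox0.
  by apply/funext => z; rewrite big_ord0.
rewrite (_ : (fun z => _) = fun z => f ord0 z + \sum_(i < n) f (lift ord0 i) z).
  by apply: papproxD => //; apply: IH => i; exact: h.
by apply/funext => z; rewrite big_ord_recl.
Qed.

(** A Riemann sum by bisection: on a short piece about w0 the integrand is replaced by its value at
    w0, a multiple of 1 / (w0 - z), with an error proportional to the length and uniform in z. *)
Lemma papprox_edge K a d x y f : compact K -> x <= y -> econt a d x y f ->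
  (forall w, seg a d x y w -> ~ hull K w) ->
  papprox K (fun z => edge a d x y (fun w => f w / (w - z))).
Proof.
move=> cK xy cf sep.
have sepK w z : seg a d x y w -> K z -> w - z != 0.
  by move=> sw Kz; rewrite subr_eq0; apply/eqP => wz; apply: (sep w sw); rewrite wz; exact: sub_hull.
have ck x' y' z : x <= x' -> y' <= y -> K z -> econt a d x' y' (fun w => f w / (w - z)).
  move=> h1 h2 Kz w /(seg_sub h1 h2) sw; apply: ccontM; first exact: cf.
  by apply: ccontV; [exact: sepK|apply: ccontB; [exact: ccont_id|exact: ccont_cst]].
suff key e : 0 < e -> exists p, forall z, K z ->
    nrm (edge a d x y (fun w => f w / (w - z)) - p.[z]) <= e * (y - x).
  move=> e e0; have p : 0 < y - x + 1 by move: xy; clear; lra.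
  have [|P hP] := key (e / (y - x + 1)); first by rewrite divr_gt0.
  exists P => z /hP h; apply: le_trans h _.
  by rewrite mulrAC ler_pdivrMr// ler_pM2l//; clear; lra.
move=> e0; apply: (@itv_bisection _ (fun x' y' => exists p : {poly R[i]}, forall z, K z ->
    nrm (edge a d x' y' (fun w => f w / (w - z)) - p.[z]) <= e * (y' - x'))) => //.
  move=> x' y' h1 h2 h3 m [p hp] [q hq]; exists (p + q) => z Kz.
  have [xm my] : x' <= m /\ m <= y' by rewrite /m; move: h2; clear; lra.
  rewrite (edge_split xm my (ck _ _ _ h1 h3 Kz)) hornerD opprD addrACA.
  apply: le_trans (nrmD _ _) _; have := hp z Kz; have := hq z Kz; clear; lra.
move=> t ht; set w0 := cpath a d t.
have sw0 : seg a d x y w0 by exact: seg_cpath.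
have [rho rho0 hrho] : exists2 rho : R, 0 < rho & forall z, K z -> rho <= nrm (w0 - z).
  apply: (@contS_away _ K (fun z => w0 - z) cK).
    by apply: contSB; [exact: contS_cst|exact: contS_id].
  by move=> z; exact: sepK.
have d1 : 0 < nrm d + 1 by have := nrm_ge0 d; clear; lra.
pose A := nrm (f w0) + 1.
have A0 : 0 < A by have := nrm_ge0 (f w0); rewrite /A; clear; lra.
(* Freezing the integrand costs 4 e1 |d| per unit of length and the polynomial costs e1 |d|; 6 e1
   (|d| + 1) = e covers both. *)
pose e1 := e / (6 * (nrm d + 1)); have e10 : 0 < e1 by rewrite divr_gt0// mulr_gt0.
have e1E : e1 * 6 * (nrm d + 1) = e by rewrite /e1; field; rewrite gt_eqF.
have eta0 : 0 < e1 * rho / 2 by rewrite divr_gt0// mulr_gt0.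
(* [r] controls the variation of [f] and [r1] that of the kernel: w stays at distance at least rho /
   2 from z, and A r1 (2 / rho) (1 / rho) <= e1. *)
have [r r0 hr] := cf w0 sw0 _ eta0.
pose r1 := Num.min (rho / 2) (e1 * rho ^+ 2 / (2 * A)).
have r10 : 0 < r1.
  have rr : 0 < rho ^+ 2 by exact: exprn_gt0.
  by rewrite lt_min; apply/andP; split; apply: divr_gt0 => //; exact: mulr_gt0.
have eA : 0 < e1 / A by rewrite divr_gt0.
have [p hp] := papprox_inv cK (sep _ sw0) eA.
exists (Num.min r r1 / (nrm d + 1)); first by rewrite divr_gt0// lt_min r0.
move=> x' y' h1 h2 h3; rewrite ltr_pdivlMr// => h4.
have xy' : x' <= y' by move: h3; clear; lra.
exists ((d * rc (y' - x') * f w0) *: p) => z Kz.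
have close w : seg a d x' y' w -> nrm (w - w0) < r /\ nrm (w - w0) < r1.
  move=> [s hs ->]; have : nrm (cpath a d s - w0) < Num.min r r1.
    rewrite nrm_cpathB; apply: le_lt_trans h4; rewrite mulrC.
    have k : `|s - t| <= y' - x' by rewrite ler_norml; move: hs h3; clear; lra.
    by apply: ler_pM => //; [exact: nrm_ge0|clear; lra].
  by rewrite lt_min => /andP[].
have zw0 := hrho _ Kz.
have w0z : w0 - z != 0 by exact: sepK.
rewrite (_ : edge a d x' y' _ = edge a d x' y' (fun w => f w / (w - z) - f w0 / (w0 - z))
   + f w0 / (w0 - z) * d * rc (y' - x')); last first.
  rewrite -(edge_cst a d (f w0 / (w0 - z)) xy') -edgeD.
  - by apply: edge_ext => w _; rewrite subrK.
  - by move=> w sw; apply: ccontB; [exact: (ck _ _ _ h1 h2 Kz)|exact: ccont_cst].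
  - exact: econt_cst.
rewrite hornerZ (_ : _ + _ - _ = edge a d x' y' (fun w => f w / (w - z) - f w0 / (w0 - z))
   + d * rc (y' - x') * (f w0 * ((w0 - z)^-1 - p.[z]))); last by ring.
apply: le_trans (nrmD _ _) _.
have j1 : nrm (edge a d x' y' (fun w => f w / (w - z) - f w0 / (w0 - z))) <=
    nrm d * (2 * (2 * e1) * (y' - x')).
  apply: edge_bound => //.
    by move=> w sw; apply: ccontB; [exact: (ck _ _ _ h1 h2 Kz)|exact: ccont_cst].
  move=> w sw; have [c1 c2] := close w sw.
  have wz : w - z != 0 by apply: sepK Kz; exact: seg_sub h1 h2 _ sw.
  have wz2 : rho / 2 <= nrm (w - z).
    have : nrm (w - w0) < rho / 2 by apply: lt_le_trans c2 _; rewrite ge_min lexx.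
    by have := nrm_tri w w0 z; rewrite (nrmBC w0 w); move: zw0; clear; lra.
  have rho2 : 0 < rho / 2 by rewrite divr_gt0.
  have i1 : nrm (w - z)^-1 <= (rho / 2)^-1 by exact: nrm_invB.
  have i2 : nrm (w0 - z)^-1 <= rho^-1 by exact: nrm_invB.
  rewrite (_ : f w / (w - z) - f w0 / (w0 - z) = (f w - f w0) * (w - z)^-1
     - f w0 * ((w - w0) * ((w - z)^-1 * (w0 - z)^-1))); last by field; rewrite wz w0z.
  apply: le_trans (nrmB _ _) _.
  have b1 : nrm ((f w - f w0) * (w - z)^-1) <= e1.
    rewrite nrmM (_ : e1 = e1 * rho / 2 * (rho / 2)^-1); last by field; rewrite gt_eqF.
    by apply: ler_pM; rewrite ?nrm_ge0//; apply/ltW/hr.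
  have b2 : nrm (f w0 * ((w - w0) * ((w - z)^-1 * (w0 - z)^-1))) <= e1.
    rewrite (_ : e1 = A * ((e1 * rho ^+ 2 / (2 * A)) * ((rho / 2)^-1 * rho^-1))); last first.
      by field; rewrite !gt_eqF.
    rewrite !nrmM; apply: ler_pM; rewrite ?nrm_ge0 ?mulr_ge0 ?nrm_ge0//.
      by rewrite /A; clear; lra.
    apply: ler_pM; rewrite ?nrm_ge0 ?mulr_ge0 ?nrm_ge0//.
      by apply: le_trans (ltW c2) _; rewrite ge_min lexx orbT.
    by apply: ler_pM; rewrite ?nrm_ge0.
  by move: b1 b2; clear; lra.
have j2 : nrm (d * rc (y' - x') * (f w0 * ((w0 - z)^-1 - p.[z]))) <= nrm d * (y' - x') * e1.
  rewrite 2!nrmM nrm_real ger0_norm ?subr_ge0//; apply: ler_wpM2l.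
    by rewrite mulr_ge0 ?nrm_ge0 ?subr_ge0.
  rewrite nrmM (_ : e1 = A * (e1 / A)); last by field; rewrite gt_eqF.
  apply: ler_pM; rewrite ?nrm_ge0//; last exact: hp.
  by rewrite /A; clear; lra.
apply: le_trans (lerD j1 j2) _.
have l0 : 0 <= y' - x' by rewrite subr_ge0.
rewrite -e1E; have := mulr_ge0 (ltW e10) l0; have := mulr_ge0 (nrm_ge0 d) (mulr_ge0 (ltW e10) l0).
by clear; lra.
Qed.

Section fixed_grid.
Variables (ox oy s : R) (N : nat) (sel : nat -> nat -> bool).
Hypothesis s0 : 0 < s.
Hypothesis selP : forall j k, sel j k -> [&& (0 < j)%N, (j < N)%N, (0 < k)%N & (k < N)%N].

Definition gx (j : nat) : R := ox + j%:R * s.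
Definition gy (k : nat) : R := oy + k%:R * s.
Definition gbox j k := box (gx j) (gx j.+1) (gy k) (gy k.+1).
Let sc j k : C := (sel j k)%:R.
Let hB j k (f : C -> C) := hedge (gy k) (gx j) (gx j.+1) f.
Let vB j k (f : C -> C) := vedge (gx j) (gy k) (gy k.+1) f.

(* The sum of the integrals along the boundaries of the selected cells: an edge
   survives, with a sign, when exactly one of its two cells is selected. *)
Definition gridint (f : C -> C) : C := \sum_(j < N.+1) \sum_(k < N.+1)
  ((sc j k - sc j k.-1) * hB j k f + (sc j.-1 k - sc j k) * vB j k f).

Definition hside j k : set C := [set w | sel j k != sel j k.-1 /\ box (gx j) (gx j.+1) (gy k) (gy k) w].
Definition vside j k : set C := [set w | sel j.-1 k != sel j k /\ box (gx j) (gx j) (gy k) (gy k.+1) w].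
Definition gridsupp : set C :=
  \bigcup_(p in [set: 'I_N.+1 * 'I_N.+1]) (hside p.1 p.2 `|` vside p.1 p.2).

Lemma gx_le j : gx j <= gx j.+1.
Proof. by rewrite /gx lerD2l ler_pM2r// ler_nat. Qed.
Lemma gy_le k : gy k <= gy k.+1.
Proof. by rewrite /gy lerD2l ler_pM2r// ler_nat. Qed.

Let sc0 : [/\ forall j, sc j 0 = 0, forall j, sc j N = 0,
  forall k, sc 0 k = 0 & forall k, sc N k = 0].
Proof.
by split => [j|j|k|k]; rewrite /sc; case: (boolP (sel _ _)) => // /selP;
  rewrite ?ltnn ?andbF.
Qed.

Lemma gridintE f : gridint f = \sum_(j < N.+1) \sum_(k < N.+1)
  sc j k * rect (gx j) (gx j.+1) (gy k) (gy k.+1) f.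
Proof.
by case: sc0 => h1 h2 h3 h4; rewrite /gridint -(@grid_identity sc (fun j k => hB j k f) (fun j k => vB j k f)).
Qed.

Lemma compact_side (P : bool) a b c d : compact [set w : C | P /\ box a b c d w].
Proof.
case: P; last by rewrite (_ : mkset _ = set0); [exact: compact0|apply/seteqP; split => // w []].
by rewrite (_ : mkset _ = box a b c d); [exact: compact_box|apply/seteqP; split => // w []].
Qed.

Lemma compact_gridsupp : compact gridsupp.
Proof.
rewrite /gridsupp -bigsetU_fset_set; last exact: finite_finset.
apply: bigsetU_compact => p _.
by apply: compactU; exact: compact_side.
Qed.

Lemma hside_supp (j k : 'I_N.+1) : hside j k `<=` gridsupp.
Proof. by move=> w hw; exists (j, k) => //; left. Qed.
Lemma vside_supp (j k : 'I_N.+1) : vside j k `<=` gridsupp.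
Proof. by move=> w hw; exists (j, k) => //; right. Qed.

Lemma sc_neq0 j k j' k' : sc j k - sc j' k' != 0 -> sel j k != sel j' k'.
Proof. by apply: contraNneq; rewrite /sc => ->; rewrite subrr. Qed.

Lemma functional_gridint : functional gridsupp gridint.
Proof.
apply: functional_sum => j; apply: functional_sum => k; apply: functional_add.
- have [e|/sc_neq0 ne] := eqVneq (sc j k - sc j k.-1) 0.
    rewrite (_ : (fun f => _) = fun=> 0); first exact: functional0.
    by apply/funext => f; rewrite e mul0r.
  apply/functional_scale/(functional_sub _ (functional_hedge _ (gx_le j))).
  by move=> w hw; apply: (@hside_supp j k); split.
- have [e|/sc_neq0 ne] := eqVneq (sc j.-1 k - sc j k) 0.
    rewrite (_ : (fun f => _) = fun=> 0); first exact: functional0.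
    by apply/funext => f; rewrite e mul0r.
  apply/functional_scale/(functional_sub _ (functional_vedge _ (gy_le k))).
  by move=> w hw; apply: (@vside_supp j k); split.
Qed.

(** Nothing is known about [h] inside the cells, so the integral cannot be split cell by cell at the
    outset. Replacing each edge by the difference of [H] at its ends allows this: around each cell
    these differences cancel. *)
Lemma gridint_ftc h H : contS gridsupp h ->
  (forall w, gridsupp w -> cderiv H w (h w)) -> gridint h = 0.
Proof.
move=> ch dH; case: sc0 => h1 h2 h3 h4.
pose V j k := H (Complex (gx j) (gy k)).
transitivity (\sum_(j < N.+1) \sum_(k < N.+1)
   ((sc j k - sc j k.-1) * (V j.+1 k - V j k) + (sc j.-1 k - sc j k) * (V j k.+1 - V j k))).
  apply: eq_bigr => j _; apply: eq_bigr => k _; congr (_ + _).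
    have [->|/sc_neq0 ne] := eqVneq (sc j k - sc j k.-1) 0; first by rewrite !mul0r.
    congr (_ * _); rewrite /hB /hedge (@edge_ftc _ _ _ _ _ h H (gx_le j)) ?cpath_h//.
      by rewrite /econt seg_h => w hw; apply: ch; apply: (@hside_supp j k); split.
    by rewrite seg_h => w hw; apply: dH; apply: (@hside_supp j k); split.
  have [->|/sc_neq0 ne] := eqVneq (sc j.-1 k - sc j k) 0; first by rewrite !mul0r.
  congr (_ * _); rewrite /vB /vedge (@edge_ftc _ _ _ _ _ h H (gy_le k)) ?cpath_v//.
    by rewrite /econt seg_v => w hw; apply: ch; apply: (@vside_supp j k); split.
  by rewrite seg_v => w hw; apply: dH; apply: (@vside_supp j k); split.
rewrite -(@grid_identity sc (fun j k => V j.+1 k - V j k) (fun j k => V j k.+1 - V j k))//.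
rewrite big1// => j _; rewrite big1// => k _; rewrite (_ : _ - _ - _ = 0) ?mulr0//.
ring.
Qed.

Lemma papprox_gridint K f : compact K -> contS gridsupp f ->
  (forall w, gridsupp w -> ~ hull K w) ->
  papprox K (fun z => gridint (fun w => f w / (w - z))).
Proof.
move=> cK cf sep; apply: papprox_sum => j; apply: papprox_sum => k; apply: papproxD.
- have [e|/sc_neq0 ne] := eqVneq (sc j k - sc j k.-1) 0.
    rewrite (_ : (fun f => _) = fun=> 0); first exact: papprox0.
    by apply/funext => z; rewrite e mul0r.
  apply/papproxZ/papprox_edge => //; first exact: gx_le.
    by rewrite /econt seg_h => w hw; apply: cf; apply: (@hside_supp j k); split.
  by rewrite seg_h => w hw; apply: sep; apply: (@hside_supp j k); split.
- have [e|/sc_neq0 ne] := eqVneq (sc j.-1 k - sc j k) 0.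
    rewrite (_ : (fun f => _) = fun=> 0); first exact: papprox0.
    by apply/funext => z; rewrite e mul0r.
  apply/papproxZ/papprox_edge => //; first exact: gy_le.
    by rewrite /econt seg_v => w hw; apply: cf; apply: (@vside_supp j k); split.
  by rewrite seg_v => w hw; apply: sep; apply: (@vside_supp j k); split.
Qed.

Lemma gx_sep j j' x : (j < j')%N -> gx j < x < gx j.+1 -> ~ (gx j' <= x <= gx j'.+1).
Proof.
move=> jj' hx h; have : gx j.+1 <= gx j' by rewrite /gx lerD2l ler_pM2r// ler_nat.
lra.
Qed.
Lemma gx_sep' j j' x : (j' < j)%N -> gx j < x < gx j.+1 -> ~ (gx j' <= x <= gx j'.+1).
Proof.
move=> jj' hx h; have : gx j'.+1 <= gx j by rewrite /gx lerD2l ler_pM2r// ler_nat.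
lra.
Qed.
Lemma gy_sep j j' x : (j < j')%N -> gy j < x < gy j.+1 -> ~ (gy j' <= x <= gy j'.+1).
Proof.
move=> jj' hx h; have : gy j.+1 <= gy j' by rewrite /gy lerD2l ler_pM2r// ler_nat.
lra.
Qed.
Lemma gy_sep' j j' x : (j' < j)%N -> gy j < x < gy j.+1 -> ~ (gy j' <= x <= gy j'.+1).
Proof.
move=> jj' hx h; have : gy j'.+1 <= gy j by rewrite /gy lerD2l ler_pM2r// ler_nat.
lra.
Qed.

Lemma gridint_cauchy_inner f z j0 k0 : sel j0 k0 ->
  inner (gx j0) (gx j0.+1) (gy k0) (gy k0.+1) z ->
  (forall j k, sel j k -> holo (gbox j k) f) ->
  gridint (fun w => f w / (w - z)) = f z * wind.
Proof.
move=> s00 iz hf; have /and4P[_ jN _ kN] := selP s00.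
have jN' : (j0 < N.+1)%N by exact: ltnW.
have kN' : (k0 < N.+1)%N by exact: ltnW.
have zero j k : (j != j0) || (k != k0) ->
    sc j k * rect (gx j) (gx j.+1) (gy k) (gy k.+1) (fun w => f w / (w - z)) = 0.
  move=> ne; rewrite /sc; case: (boolP (sel j k)) => [sjk|_]; last by rewrite mul0r.
  rewrite mul1r; apply: holo_kernel_eq0; [exact: gx_le|exact: gy_le|exact: hf|].
  case: iz => i1 i2 [b1 b2]; case/orP: ne; rewrite neq_ltn => /orP[h|h].
  - exact: (gx_sep' h i1 b1).
  - exact: (gx_sep h i1 b1).
  - exact: (gy_sep' h i2 b2).
  - exact: (gy_sep h i2 b2).
rewrite gridintE (bigD1 (Ordinal jN'))//= (bigD1 (Ordinal kN'))//=.
rewrite [X in _ + X + _]big1 ?addr0; last first.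
  by move=> k hk; apply: zero; apply/orP; right; rewrite -val_eqE in hk.
rewrite [X in _ + X]big1 ?addr0; last first.
  move=> j hj; rewrite big1// => k _; apply: zero; rewrite -val_eqE in hj.
  by rewrite hj.
by rewrite /sc s00 mul1r cauchy_formula//; exact: hf.
Qed.

End fixed_grid.

(** Serves to reach points on the grid lines, where no single cell gives Cauchy's formula, as limits
    of interior points. *)
Lemma box_inner_approx a b c d (z : C) (e : R) : a < b -> c < d -> box a b c d z -> 0 < e ->
  exists2 v, inner a b c d v & nrm (v - z) < e.
Proof.
move=> ab cd [h1 h2] e0.
have near1 p q x : p < q -> p <= x <= q -> exists2 y, p < y < q & `|y - x| < e / 2.
  move=> pq hx; have [h|h] := ltP x ((p + q) / 2).
    exists (Num.min (x + e / 4) (x + (q - p) / 4)).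
      by rewrite lt_min gt_min; move: hx pq h e0; clear; lra.
    have : x < Num.min (x + e / 4) (x + (q - p) / 4) by rewrite lt_min; move: e0 pq; clear; lra.
    have : Num.min (x + e / 4) (x + (q - p) / 4) <= x + e / 4 by rewrite ge_min lexx.
    by rewrite ltr_norml; move: e0; clear; lra.
  exists (Num.max (x - e / 4) (x - (q - p) / 4)).
    by rewrite lt_max gt_max; move: hx pq h e0; clear; lra.
  have : Num.max (x - e / 4) (x - (q - p) / 4) < x by rewrite gt_max; move: e0 pq; clear; lra.
  have : x - e / 4 <= Num.max (x - e / 4) (x - (q - p) / 4) by rewrite le_max lexx.
  by rewrite ltr_norml; move: e0; clear; lra.
have [x hx1 hx2] := near1 _ _ _ ab h1; have [y hy1 hy2] := near1 _ _ _ cd h2.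
exists (Complex x y) => //; apply: le_lt_trans (nrm_ReIm _) _; rewrite CreB CimB /=.
by move: hx2 hy2; clear; lra.
Qed.

(* A chain of grid edges in [W] around a compact set [A]. *)
Lemma grid_exists (A W : set C) : compact A -> open W -> A `<=` W ->
  exists S (L : (C -> C) -> C), [/\ compact S /\ functional S L,
    S `<=` W `\` A,
    (forall f z, holo W f -> A z -> L (fun w => f w / (w - z)) = f z * wind),
    (forall h H, contS S h -> (forall w, S w -> cderiv H w (h w)) -> L h = 0) &
    (forall K f, compact K -> contS S f -> (forall w, S w -> ~ hull K w) ->
       papprox K (fun z => L (fun w => f w / (w - z))))].
Proof.
move=> cA oW AW; have [d d0 hd] := compact_open_sep cA oW AW.
have /compactP[_ [M0 hM0]] := cA; pose M := `|M0|.
have hM z : A z -> nrm z <= M by move=> /hM0 h; exact: le_trans (ler_norm _).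
have Mge : 0 <= M by exact: normr_ge0.
(* Cells have diameter at most 2 s < d, so those that meet [A] lie in [W]. The choice of [o] and [N]
   leaves a border of unselected cells around the square of half side M. *)
pose s := d / 3; have s0 : 0 < s by rewrite divr_gt0.
pose o := - (M + 2 * s); pose N := (Num.truncn (2 * M / s)).+4.+1.
pose sel j k := `[< exists2 w, A w & gbox o o s j k w >].
have idx j (x : R) : `|x| <= M -> gx o s j <= x <= gx o s j.+1 -> (0 < j)%N && (j < N)%N.
  rewrite ler_norml => hx; rewrite /gx => /andP[h1 h2]; apply/andP; split.
    rewrite lt0n; apply/eqP => j0; move: h2; rewrite j0 mul1r /o.
    by move: hx s0; clear; lra.
  rewrite -(ltr_nat R); apply: (@le_lt_trans _ _ (2 * M / s + 2)).
    rewrite -lerBlDr ler_pdivlMr// mulrBl; move: h1 hx; rewrite /o; clear; lra.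
  have -> : N%:R = (Num.truncn (2 * M / s)).+1%:R + 4 :> R by rewrite -natrD addn4.
  by have := truncnS_gt (2 * M / s); clear; lra.
have selP j k : sel j k -> [&& (0 < j)%N, (j < N)%N, (0 < k)%N & (k < N)%N].
  move=> /asboolP[w Aw [h1 h2]].
  have := idx j (Cre w) (le_trans (nrm_Re _) (hM _ Aw)) h1.
  have := idx k (Cim w) (le_trans (nrm_Im _) (hM _ Aw)) h2.
  by move=> /andP[-> ->] /andP[-> ->].
have diam j k v w : gbox o o s j k v -> gbox o o s j k w -> nrm (v - w) < d.
  move=> [v1 v2] [w1 w2]; apply: le_lt_trans (nrm_ReIm _) _; rewrite CreB CimB.
  have gS i : gx o s i.+1 = gx o s i + s by rewrite /gx -natr1; ring.
  have gS' i : gy o s i.+1 = gy o s i + s by rewrite /gy -natr1; ring.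
  have k1 : `|Cre v - Cre w| <= s by rewrite ler_norml; move: v1 w1; rewrite gS; clear; lra.
  have k2 : `|Cim v - Cim w| <= s by rewrite ler_norml; move: v2 w2; rewrite gS'; clear; lra.
  by move: k1 k2 d0; rewrite /s; clear; lra.
have selW j k : sel j k -> gbox o o s j k `<=` W.
  by move=> /asboolP[w Aw bw] v bv; apply: (hd w) => //; exact: diam bv bw.
have find z : A z -> exists j k, gbox o o s j k z.
  move=> Az.
  have one (x : R) : `|x| <= M -> exists j, gx o s j <= x <= gx o s j.+1.
    rewrite ler_norml => hx; have p : 0 <= (x - o) / s.
      by rewrite divr_ge0 ?(ltW s0)// /o; move: hx s0; clear; lra.
    exists (Num.truncn ((x - o) / s)); rewrite /gx.
    have /andP[t1 t2] := truncn_itv p; rewrite ler_pdivlMr// in t1.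
    by rewrite ltr_pdivrMr// in t2; move: t1 t2; clear; lra.
  have [j hj] := one _ (le_trans (nrm_Re z) (hM _ Az)).
  have [k hk] := one _ (le_trans (nrm_Im z) (hM _ Az)).
  by exists j, k.
have fL := @functional_gridint o o s N sel s0.
have cS := @compact_gridsupp o o s N sel.
have gys : forall k, gy o s k <= gy o s k.+1 by exact: gy_le.
have gxs : forall k, gx o s k <= gx o s k.+1 by exact: gx_le.
(* A surviving edge belongs to a selected cell, hence lies in [W], and to an unselected one, hence
   avoids [A]. *)
have SW : gridsupp o o s N sel `<=` W `\` A.
  have hb j k : sel j k != sel j k.-1 -> box (gx o s j) (gx o s j.+1) (gy o s k) (gy o s k) `<=` W `\` A.
    case: k => [|k] /=; first by rewrite eqxx.
    move=> ne w bw.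
    have b1 : gbox o o s j k.+1 w by apply: box_sub bw.
    have b2 : gbox o o s j k w by apply: box_sub bw.
    split; last first.
      move=> Aw; move: ne; have -> : sel j k.+1 by apply/asboolP; exists w.
      by have -> : sel j k by apply/asboolP; exists w.
    have [/selW h|s1] := boolP (sel j k.+1); first exact: h.
    have [/selW h|s2] := boolP (sel j k); first exact: h.
    by move: ne; rewrite (negbTE s1) (negbTE s2).
  have vb j k : sel j.-1 k != sel j k -> box (gx o s j) (gx o s j) (gy o s k) (gy o s k.+1) `<=` W `\` A.
    case: j => [|j] /=; first by rewrite eqxx.
    move=> ne w bw.
    have b1 : gbox o o s j.+1 k w by apply: box_sub bw.
    have b2 : gbox o o s j k w by apply: box_sub bw.
    split; last first.
      move=> Aw; move: ne; have -> : sel j.+1 k by apply/asboolP; exists w.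
      by have -> : sel j k by apply/asboolP; exists w.
    have [/selW h|s1] := boolP (sel j.+1 k); first exact: h.
    have [/selW h|s2] := boolP (sel j k); first exact: h.
    by move: ne; rewrite (negbTE s1) (negbTE s2).
  by move=> w [[j k] _ [[/hb + bw]|[/vb + bw]]]; exact.
exists (gridsupp o o s N sel), (gridint o o s N sel); split => //;
  [|exact: (@gridint_ftc o o s N sel s0 selP)|exact: (@papprox_gridint o o s N sel s0)].
move=> f z hf Az; have [j0 [k0 bz]] := find z Az.
have s00 : sel j0 k0 by apply/asboolP; exists z.
have inn v : inner (gx o s j0) (gx o s j0.+1) (gy o s k0) (gy o s k0.+1) v ->
    gridint o o s N sel (fun w => f w / (w - v)) = f v * wind.
  move=> iv; apply: (gridint_cauchy_inner s0 selP s00 iv) => j k /selW sW.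
  exact: holo_sub sW hf.
have cf : contS (gridsupp o o s N sel) f by apply: contS_sub (holo_contS hf) => w /SW[].
have zS w : gridsupp o o s N sel w -> w != z.
  by move=> /SW[_ nA]; apply/eqP => wz; subst w.
(* Both sides of Cauchy's formula are continuous at z, even when z lies on an edge between selected
   cells, because z is off the support of the chain. *)
have cG : ccont (fun v => gridint o o s N sel (fun w => f w / (w - v) ^+ 1) - f v * wind) z.
  apply: ccontB.
    by apply: cderiv_ccont (kernel_cderiv 1 fL cS cf (@contS_id _ _) zS).
  apply: ccontM; last exact: ccont_cst.
  by have [l] := hf z (AW _ Az); exact: cderiv_ccont.
apply/eqP; rewrite -subr_eq0; apply/eqP; apply: nrm_le0 => e e0.
have [r r0 hr] := cG e e0.
have gxl : gx o s j0 < gx o s j0.+1 by rewrite /gx ltrD2l ltr_pM2r// ltr_nat.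
have gyl : gy o s k0 < gy o s k0.+1 by rewrite /gy ltrD2l ltr_pM2r// ltr_nat.
have [v iv hv] := box_inner_approx gxl gyl bz r0.
have := hr v hv; under eq_fun do rewrite expr1.
rewrite inn// subrr sub0r nrmN; under eq_fun do rewrite expr1.
exact: ltW.
Qed.

End grid.

(** * Runge's theorem and hulls in simply connected domains *)

Section runge.
Context {R : realType}.
Local Notation C := (R[i]^o).
Implicit Types (K A B N U : set C) (f h H : C -> C) (b z w : C).

Lemma papprox_ext K f g : (forall z, K z -> f z = g z) -> papprox K f -> papprox K g.
Proof. by move=> fg hf e /hf[p hp]; exists p => z Kz; rewrite -fg//; exact: hp. Qed.

(** The Cauchy integral runs over a chain outside [K], hence outside its hull, where every kernel is
    a limit of polynomials. *)
Theorem runge K U f : compact K -> hull K `<=` K -> open U -> K `<=` U -> holo U f ->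
  papprox K f.
Proof.
move=> cK hK oU KU hf; have [S [L [[cS fL] SU cau _ app]]] := grid_exists cK oU KU.
apply: (@papprox_ext _ (fun z => wind^-1 * L (fun w => f w / (w - z)))).
  by move=> z Kz; rewrite (cau f z hf Kz) mulrC mulfK// wind_neq0.
apply: papproxZ; apply: app => //; first by move=> w /SU[Uw _]; exact: holo_contS hf _ Uw.
by move=> w /SU[_ nK] /hK.
Qed.

Lemma compact_diff_open K U : compact K -> open U -> compact (K `\` U).
Proof.
move=> /compactP[cK [M hM]] oU; apply/compactP; split; last by exists M => z [/hM].
by rewrite setDE; apply: closedI => //; exact: open_closedC.
Qed.

(* A compact set whose hull reaches a point [b] winds around [b]: no function
   with a primitive near it can be close to [1 / (w - b)]. *)
Lemma hull_obstruction K N b : compact K -> open N -> K `<=` N -> ~ N b ->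
  (forall S, compact S -> S `<=` N -> forall e : R, 0 < e -> exists h H,
     (forall w, N w -> cderiv H w (h w) /\ ccont h w) /\
     forall w, S w -> nrm ((w - b)^-1 - h w) <= e) -> ~ hull K b.
Proof.
move=> cK oN KN nNb app hb.
(* The chain surrounds the part of the hull outside [N], to which b belongs, and stays inside [N]:
   over it 1 / (w - b) integrates to [wind], but [h] to 0. *)
have cA := compact_diff_open (compact_hull cK) oN; have oW := open_hullD cK.
have AW : hull K `\` N `<=` hull K `\` K by move=> w [hw nN]; split=> // /KN.
have [S [L [[cS fL] SU cau prim _]]] := grid_exists cA oW AW.
have SN : S `<=` N by move=> w /SU[[hw nK] nA]; apply: contrapT => nN; apply: nA.
have := cau (fun=> 1) b; have -> : (fun w : C => 1 / (w - b)) = fun w => (w - b)^-1.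
  by apply/funext => w; rewrite mul1r.
move=> /(_ _ (conj hb nNb)) E; rewrite mul1r in E.
have {}E : L (fun w => (w - b)^-1) = wind.
  by apply: E => w _; exists 0; exact: cderiv_cst.
have [_ _ [B B0 hB]] := fL.
have cb : contS S (fun w => (w - b)^-1).
  apply: contSV; first by move=> w /SN Nw; rewrite subr_eq0; apply/eqP => wb; subst w.
  by apply: contSB; [exact: contS_id|exact: contS_cst].
have w0 : 0 < nrm (wind : C) by rewrite nrm_gt0 wind_neq0.
pose e := nrm (wind : C) / (2 * (B + 1)).
have B1 : 0 < 2 * (B + 1) by move: B0; clear; lra.
have e0 : 0 < e by rewrite divr_gt0.
have [h [H [dH hS]]] := app S cS SN e e0.
have ch : contS S h by move=> w /SN/dH[].
have Lh : L h = 0 by apply: (prim h H ch) => w /SN/dH[].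
have : nrm (L (fun w => (w - b)^-1 - h w)) <= B * e.
  by apply: hB => //; [exact: ltW|exact: contSB].
rewrite (functionalB fL cb ch) E Lh subr0.
suff : B * e < nrm (wind : C) by move=> k1 k2; have := lt_le_trans k1 k2; rewrite ltxx.
rewrite /e mulrA ltr_pdivrMr// mulrC ltr_pM2l//; move: B0; clear; lra.
Qed.

Definition fatten A (d : R) : set C := [set w | exists2 z, A z & nrm (w - z) < d].

Lemma open_fatten A d : open (fatten A d).
Proof.
apply/openP => w [z Az hz]; exists (d - nrm (w - z)) => [|v hv]; first by rewrite subr_gt0.
by exists z => //; have := nrm_tri w v z; move: hv; clear; lra.
Qed.

(* A b outside both hulls is not in the hull of the union: [1 / (w - b)] is
   close to a polynomial near A and to another one near B, and together these
   have a primitive. *)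
Lemma hullU_disjoint A B : compact A -> compact B -> A `&` B = set0 ->
  hull (A `|` B) `<=` hull A `|` hull B.
Proof.
move=> cA cB AB b hb; apply: contrapT => /not_orP[nA nB]; move: hb.
have [NA [oNA sNA _ hNA]] := papprox_inv_nbhs cA nA.
have [NB [oNB sNB _ hNB]] := papprox_inv_nbhs cB nB.
have oB : open (~` B) by apply: closed_openC; exact: ((compactP B).1 cB).1.
have [|d d0 hd] := @compact_open_sep _ A (~` B) cA oB.
  by move=> z Az Bz; have : (A `&` B) z by []; rewrite AB.
pose OA := fatten A (d / 2); pose OB := fatten B (d / 2).
have oOA : open OA by exact: open_fatten.
have oOB : open OB by exact: open_fatten.
have dis w : OA w -> OB w -> False.
  move=> [z Az hz] [v Bv hv]; apply: (hd z v Az _ Bv).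
  by have := nrm_tri w v z; rewrite (nrmBC v w); move: hz hv; clear; lra.
have d2 : 0 < d / 2 by rewrite divr_gt0.
pose N := ((NA `&` OA) `|` (NB `&` OB)) `\ b.
have nAb : b \notin A by rewrite notin_setE => /sub_hull.
apply: (@hull_obstruction _ N).
- exact: compactU.
- rewrite /N setDE; apply: openI; first by apply: openU; exact: openI.
  apply: closed_openC; apply/closedP => z zb; exists (nrm (z - b)) => [|w hw wb].
    by rewrite nrm_gt0 subr_eq0; apply/eqP.
  by move: hw; rewrite wb nrmBC ltxx.
- move=> w [Aw|Bw]; split.
  + by left; split; [exact: sNA|exists w => //; rewrite subrr nrm0].
  + by move=> wb; apply: nA; rewrite -wb; exact: sub_hull.
  + by right; split; [exact: sNB|exists w => //; rewrite subrr nrm0].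
  + by move=> wb; apply: nB; rewrite -wb; exact: sub_hull.
- by move=> [_]; apply.
move=> S cS SN e e0; have [p hp] := hNA e e0; have [q hq] := hNB e e0.
have [P PE] := poly_primitive p; have [Q QE] := poly_primitive q.
exists (fun w => if `[< OA w >] then p.[w] else q.[w]).
exists (fun w => if `[< OA w >] then P.[w] else Q.[w]).
have nearA w : OA w -> exists2 r : R, 0 < r & forall v, nrm (v - w) < r -> `[< OA v >] = true.
  move=> OAw; have /openP/(_ w OAw)[r r0 hr] := oOA; exists r => // v /hr h.
  exact/asboolP.
have nearB w : OB w -> exists2 r : R, 0 < r & forall v, nrm (v - w) < r -> `[< OA v >] = false.
  move=> OBw; have /openP/(_ w OBw)[r r0 hr] := oOB; exists r => // v /hr h.
  by apply/asboolP => OAv; exact: dis OAv h.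
split => [w [[[_ /[dup] OAw /nearA[r r0 hr]]|[_ /[dup] OBw /nearB[r r0 hr]]] _]|w /SN[[[NAw OAw]|[NBw OBw]] _]].
- rewrite (hr w) ?subrr ?nrm0//; split.
    apply: (@cderiv_near _ (fun v => P.[v])); first by exists r => // v /hr ->.
    by rewrite -PE; exact: cderiv_poly.
  apply: (@ccont_near _ (fun v => p.[v])); last exact: ccont_poly.
  by exists r => // v /hr ->.
- rewrite (hr w) ?subrr ?nrm0//; split.
    apply: (@cderiv_near _ (fun v => Q.[v])); first by exists r => // v /hr ->.
    by rewrite -QE; exact: cderiv_poly.
  apply: (@ccont_near _ (fun v => q.[v])); last exact: ccont_poly.
  by exists r => // v /hr ->.
- by case: asboolP => // _; exact: hp.
- by case: asboolP => [OAw|_]; [case: (dis w)|exact: hq].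
Qed.

Lemma closed_some K : compact K ->
  closed (Some @` K : set (one_point_compactification C)).
Proof.
move=> cK; have /compactP[clK _] := cK.
rewrite -openC openE => -[z|] /= h.
  change (nbhs z (Some @^-1` (~` (Some @` K)) : set C)).
  apply: (@filterS _ _ _ (~` K)).
    by move=> w nKw [v Kv [vw]]; apply: nKw; rewrite -vw.
  apply: open_nbhs_nbhs; split; first exact: closed_openC.
  by move=> Kz; apply: h; exists z.
exists K; first by split.
by move=> x [[w nKw <-] [v Kv [vw]]|-> [v]//]; apply: nKw; rewrite -vw.
Qed.

(** In the one-point compactification, the part of the hull outside [G] is closed because the hull
    is compact, and open in the complement of [G] because [hull K] minus [K] is open. It misses
    infinity, so connectedness makes it empty. *)
Lemma hull_simply_connected (G K : set C) : simply_connected G -> compact K ->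
  K `<=` G -> hull K `<=` G.
Proof.
move=> sG cK KG b hb; apply: contrapT => nGb.
pose T := Some @` (hull K `\` G) : set (one_point_compactification C).
have E : T = ~` (Some @` G).
  apply: sG.
  - by exists (Some b), b.
  - exists (Some @` (hull K `\` K)).
      by apply: one_point_compactification_open_some; exact: open_hullD.
    apply/seteqP; split => [_ [w [hw nG] <-]|x [nx [w [hw _] wx]]].
      by split; [move=> [v Gv [vw]]; apply: nG; rewrite -vw|exists w => //; split => // /KG].
    by exists w => //; split => // Gw; apply: nx; exists w.
  - exists (Some @` hull K); first exact/closed_some/compact_hull.
    apply/seteqP; split => [_ [w [hw nG] <-]|x [nx [w hw wx]]].
      by split; [move=> [v Gv [vw]]; apply: nG; rewrite -vw|exists w].
    by exists w => //; split => // Gw; apply: nx; exists w.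
have : T None by rewrite E => -[v].
by move=> [v].
Qed.

End runge.

(** * Univalent maps *)

Section univalent.
Context {R : realType}.
Local Notation C := (R[i]^o).
Implicit Types (K S U : set C) (f h F : C -> C) (b z w : C).

Lemma cpath1 z w : cpath z (w - z) 1 = w.
Proof. by rewrite /cpath (rmorph1 (real_complex R)) mulr1 addrC subrK. Qed.
Lemma cpath0 z w : cpath z w 0 = z.
Proof. by rewrite /cpath (rmorph0 (real_complex R)) mulr0 addr0. Qed.

Lemma mean_value_ball F l z w r M : nrm (w - z) < r ->
  (forall v, nrm (v - z) < r -> nrm (v - z) <= nrm (w - z) -> cderiv F v (l v) /\ nrm (l v) <= M) ->
  nrm (F w - F z) <= nrm (w - z) * M.
Proof.
move=> wr h; have := @mean_value_le R z (w - z) 0 1 F l M ler01.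
rewrite cpath1 cpath0 subr0 mulr1; apply => v [t ht ->].
have k : nrm (cpath z (w - z) t - z) <= nrm (w - z).
  rewrite -[X in _ - X](cpath0 z (w - z)) nrm_cpathB subr0 ger0_norm; last by move: ht; clear; lra.
  by rewrite ler_piMr ?nrm_ge0//; move: ht; clear; lra.
by apply: h => //; exact: le_lt_trans wr.
Qed.

Lemma box_not_frame x0 x1 y0 y1 w : box x0 x1 y0 y1 w -> ~ frame x0 x1 y0 y1 w ->
  inner x0 x1 y0 y1 w.
Proof.
move=> bw nf; have [/andP[h1 h2] /andP[h3 h4]] := bw; rewrite /inner /= !lt_neqAle h1 h2 h3 h4 !andbT.
split; apply/andP; split; apply/eqP => E; apply: nf; split=> //; rewrite E; tauto.
Qed.

Section at_point.
Variables (U : set C) (phi : C -> C).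
Hypotheses (oU : open U) (hphi : holo U phi)
  (inj : forall z w, U z -> U w -> phi z = phi w -> z = w).

Let phi' := cder phi.
Let dphi z : U z -> cderiv phi z (phi' z). Proof. exact: holo_cder. Qed.
Let hphi' : holo U phi'. Proof. exact: holo_deriv. Qed.

(** A derivative vanishing near [z] would make [phi] locally constant. Density is enough below,
    since the identities extend by continuity; that the derivative has no zero need not be
    established. *)
Lemma cder_dense z (e : R) : U z -> 0 < e -> exists w, [/\ U w, nrm (w - z) < e & cder phi w != 0].
Proof.
move=> Uz e0; apply: contrapT => h; have /openP/(_ z Uz)[r r0 hr] := oU.
pose m := Num.min e r / 2; have m0 : 0 < m by rewrite divr_gt0// lt_min e0.
have me : m < Num.min e r by rewrite /m; move: m0; rewrite /m; lra.
pose w : C := z + rc m.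
have nw : nrm (w - z) = m by rewrite /w addrAC subrr add0r nrm_real ger0_norm// ltW.
have wz : w = z.
  apply: inj => //; first by apply: hr; rewrite nw; move: me; rewrite lt_min => /andP[].
  apply/eqP; rewrite -subr_eq0; apply/eqP; apply: nrm_le0 => d d0.
  apply: (@le_trans _ _ (nrm (w - z) * 0)); last by rewrite mulr0 ltW.
  apply: (@mean_value_ball _ phi' _ _ (Num.min e r)); first by rewrite nw.
  move=> v; rewrite lt_min => /andP[ve vr] _; have Uv : U v by exact: hr.
  split; first exact: dphi.
  suff -> : phi' v = 0 by rewrite nrm0.
  by apply/eqP; apply/negPn/negP => nz; apply: h; exists v.
by move: nw; rewrite wz subrr nrm0 => /esym E; move: m0; rewrite E ltxx.
Qed.

(** The logarithmic derivative of phi - phi z has a simple pole of residue 1 at [z]; here the pole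
    is removed. *)
Lemma log_deriv_bounded z : U z -> phi' z != 0 -> exists2 r : R, 0 < r &
  exists M, forall w, w != z -> nrm (w - z) < r ->
    nrm (phi' w / (phi w - phi z) - (w - z)^-1) <= M.
Proof.
move=> Uz D0; set D := phi' z in D0 *; have /openP/(_ z Uz)[r r0 hr] := oU.
have nD : 0 < nrm D by rewrite nrm_gt0.
have [l /cderivP/(_ 1 ltr01)[d d0 hd]] := hphi' Uz.
pose A := nrm l + 1; have A0 : 0 < A by have := nrm_ge0 l; rewrite /A; lra.
have lip v : nrm (v - z) < d -> nrm (phi' v - D) <= A * nrm (v - z).
  move=> /hd; rewrite -/D mul1r => h; have := nrmD (phi' v - D - l * (v - z)) (l * (v - z)).
  by rewrite subrK nrmM /A mulrDl mul1r; move: h; lra.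
pose s := Num.min (Num.min r d) (nrm D / (2 * A)).
have s0 : 0 < s by rewrite !lt_min r0 d0 divr_gt0// mulr_gt0.
(* The numerator below will be at most 2 A h^2, the denominator at least |D| h^2 / 2. *)
exists s => //; exists (4 * A / nrm D) => w wz; rewrite !lt_min => /andP[/andP[wr wd] wA].
set h := nrm (w - z) in wr wd wA *; have h0 : 0 < h by rewrite nrm_gt0 subr_eq0.
have Rb : nrm (phi w - phi z - D * (w - z)) <= h * (A * h).
  rewrite (_ : _ - _ - _ = (phi w - D * w) - (phi z - D * z)); last by ring.
  apply: (@mean_value_ball (fun v => phi v - D * v) (fun v => phi' v - D * 1) _ _ (Num.min r d)).
    by rewrite lt_min wr.
  move=> v; rewrite lt_min => /andP[vr vd] vh; split.
    by apply: cderivB; [apply/dphi/hr|apply: cderivZ; exact: cderiv_id].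
  by rewrite mulr1; apply: le_trans (lip _ vd) _; rewrite ler_pM2l.
have low : nrm D * h / 2 <= nrm (phi w - phi z).
  have := nrmB (phi w - phi z) (phi w - phi z - D * (w - z)).
  rewrite opprB addrCA subrr addr0 nrmM -/h.
  move: wA Rb; rewrite ltr_pdivlMr ?mulr_gt0// => wA.
  have : h * (2 * (A * h)) <= h * nrm D by rewrite ler_pM2l// mulrA mulrC mulrA ltW// mulrAC -mulrA (mulrC A).
  by lra.
have Dh : 0 < nrm D * h / 2 by rewrite divr_gt0// mulr_gt0.
have p0 : phi w - phi z != 0 by rewrite -nrm_gt0; exact: lt_le_trans low.
have wz0 : w - z != 0 by rewrite subr_eq0.
rewrite (_ : _ - _ = ((phi' w - D) * (w - z) - (phi w - phi z - D * (w - z))) /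
   ((phi w - phi z) * (w - z))); last by field; rewrite wz0 p0.
rewrite nrmM nrmV ler_pdivrMr; last by rewrite nrm_gt0 mulf_neq0.
apply: (@le_trans _ _ (2 * A * h * h)).
  apply: le_trans (nrmB _ _) _; rewrite nrmM -/h; have := lip _ wd; rewrite -/h => k.
  have : nrm (phi' w - D) * h <= A * h * h by rewrite ler_pM2r.
  by move: Rb; lra.
rewrite nrmM -/h mulrA ler_pM2r//.
have k : 4 * A / nrm D * (nrm D * h / 2) <= 4 * A / nrm D * nrm (phi w - phi z).
  by rewrite ler_pM2l// divr_gt0// mulr_gt0.
apply: le_trans k; rewrite le_eqVlt; apply/orP; left; apply/eqP; field; exact: lt0r_neq0.
Qed.

Section square.
Variables (z0 : C) (s : R).
Hypotheses (s0 : 0 < s) (sU : sqbox z0 s `<=` U).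

Let fL := @functional_sq R z0 s s0.
Let cF := @compact_sqframe R z0 s s0.
Let FU : sqframe z0 s `<=` U. Proof. by move=> w /sqframe_box/sU. Qed.
Let cphi : contS (sqframe z0 s) phi. Proof. by move=> w /FU/hphi[l]; exact: cderiv_ccont. Qed.
Let cphi' : contS (sqframe z0 s) phi'. Proof. by move=> w /FU/hphi'[l]; exact: cderiv_ccont. Qed.

(* Integrals of the argument principle: [count_at zeta / wind] is the number of
   preimages of zeta in the square, [sum_at zeta / wind] is their sum. *)
Definition count_at (zeta : C) : C := sqint z0 s (fun w => phi' w / (phi w - zeta) ^+ 1).
Definition sum_at (zeta : C) : C := sqint z0 s (fun w => (w * phi' w) / (phi w - zeta) ^+ 1).

Let inner_sep z w : sqinner z0 s z -> sqframe z0 s w -> phi w != phi z.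
Proof.
move=> iz fw; apply/eqP => /inj E; have := inner_frame iz fw; rewrite E ?eqxx//; first exact: FU.
exact/sU/inner_box.
Qed.

(** By injectivity [z] is the only pole in the square; once it is subtracted, removable
    singularities contribute nothing. *)
Lemma count_sum_at z : sqinner z0 s z -> phi' z != 0 ->
  count_at (phi z) = wind /\ sum_at (phi z) = z * wind.
Proof.
move=> iz D0; have Uz : U z by exact/sU/inner_box.
have [r r0 [M hM]] := log_deriv_bounded Uz D0.
pose g w := phi' w / (phi w - phi z) - (w - z)^-1.
have dg w : sqbox z0 s w -> w != z -> exists l, cderiv g w l.
  move=> /sU Uw wz; have [l dl] := hphi' Uw; eexists.
  apply: cderivB; last exact: cderiv_kernel1.
  apply: cderivM; first exact: dl.
  apply: cderivV; last by apply: cderivB; [exact: dphi|exact: cderiv_cst].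
  by rewrite subr_eq0; apply: contra_neq wz; exact: inj.
have g0 : sqint z0 s g = 0 by exact: (rect_removable iz r0 dg hM).
have wg0 : sqint z0 s (fun w => w * g w) = 0.
  apply: (@rect_removable _ _ _ _ _ _ z r ((nrm z + r) * M) iz r0).
    move=> w bw wz; have [l dl] := dg w bw wz; eexists.
    by apply: cderivM; [exact: cderiv_id|exact: dl].
  move=> w wz wr; rewrite nrmM; apply: ler_pM; rewrite ?nrm_ge0//; last exact: hM.
  by have := nrm_sub w z; move: wr; lra.
have nz w : sqframe z0 s w -> w - z != 0.
  by move=> fw; rewrite subr_eq0 (inner_frame iz fw).
have ck : contS (sqframe z0 s) (fun w => (w - z)^-1).
  by apply: contSV => //; apply: contSB; [exact: contS_id|exact: contS_cst].
have cg : contS (sqframe z0 s) g.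
  apply: contSB => //; apply: contSM => //; apply: contSV.
    by move=> w fw; rewrite subr_eq0 (inner_sep iz fw).
  by apply: contSB => //; exact: contS_cst.
have W : sqint z0 s (fun w => (w - z)^-1) = wind by exact: rect_wind.
split.
  rewrite /count_at (_ : (fun w => _) = fun w => g w + (w - z)^-1); last first.
    by apply/funext => w; rewrite /g expr1 subrK.
  by rewrite (functionalD fL cg ck) g0 W add0r.
have cwg : contS (sqframe z0 s) (fun w => w * g w).
  by apply: contSM => //; exact: contS_id.
have cz : contS (sqframe z0 s) (fun w => z * (w - z)^-1).
  by apply: contSM => //; exact: contS_cst.
(* This rests on w / (w - z) = 1 + z / (w - z), where the constant integrates to 0. *)
rewrite /sum_at (@functional_ext _ _ _ _ (fun w => (w * g w + 1) + z * (w - z)^-1) fL).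
- rewrite (functionalD fL)//; last by apply: contSD => //; exact: contS_cst.
  rewrite (functionalD fL)//; last exact: contS_cst.
  rewrite wg0 (functionalZ _ fL ck) W /sqint goursat ?addr0 ?add0r//; try exact: sq_le.
  by move=> w _; exists 0; exact: cderiv_cst.
- apply: kernel_contS => //; first by apply: contSM => //; exact: contS_id.
  by move=> w; exact: inner_sep.
- by apply: contSD => //; apply: contSD => //; exact: contS_cst.
- move=> w fw; rewrite /g expr1.
  have h1 := nz w fw; have h2 := inner_sep iz fw; rewrite -subr_eq0 in h2.
  by field; rewrite h1 h2.
Qed.

Let away : exists2 rho : R, 0 < rho & forall w, sqframe z0 s w -> rho <= nrm (phi w - phi z0).
Proof.
apply: (@contS_away _ (sqframe z0 s) (fun w => phi w - phi z0) cF).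
  by apply: contSB => //; exact: contS_cst.
by move=> w fw; rewrite subr_eq0; apply: inner_sep fw; exact: sqinner_center.
Qed.

(** The derivative of [count_at] integrates a function with primitive -1 / (phi - zeta), so
    [count_at] is constant near [phi z0]; a nearby point where the derivative of [phi] is nonzero
    shows that it equals [wind]. Without a preimage of zeta, Goursat would make it 0. *)
Lemma count_at_near : exists2 rho : R, 0 < rho & forall zeta, nrm (zeta - phi z0) < rho ->
  [/\ forall w, sqframe z0 s w -> phi w != zeta, count_at zeta = wind &
   exists2 z, sqinner z0 s z & phi z = zeta].
Proof.
have [rho rho0 hrho] := away; exists rho => //.
have off zeta w : nrm (zeta - phi z0) < rho -> sqframe z0 s w -> phi w != zeta.
  by move=> hz /hrho h; apply/eqP => E; move: hz h; rewrite E; lra.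
have d0 zeta : nrm (zeta - phi z0) < rho -> cderiv count_at zeta 0.
  move=> hz; have := kernel_cderiv 1 fL cF cphi' cphi (fun w => off zeta w hz).
  rewrite mul1r /sqint (@rect_ftc _ _ _ _ _ _ (fun w => - (phi w - zeta)^-1))//; try exact: sq_le.
    by apply: kernel_contS => // w; exact: off.
  move=> w fw; rewrite (_ : _ / _ = - (- ((phi w - zeta)^-1) ^+ 2 * (phi' w - 0))).
    apply: cderivN; apply: cderivV; first by rewrite subr_eq0 off.
    by apply: cderivB; [exact/dphi/FU|exact: cderiv_cst].
  by rewrite subr0 mulNr opprK exprVn mulrC.
have Uz0 : U z0 by exact/sU/inner_box/sqinner_center.
have const zeta : nrm (zeta - phi z0) < rho -> count_at zeta = count_at (phi z0).
  move=> hz; apply/eqP; rewrite -subr_eq0; apply/eqP; apply: nrm_le0 => e e0.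
  apply: (@le_trans _ _ (nrm (zeta - phi z0) * 0)); last by rewrite mulr0 ltW.
  by apply: (@mean_value_ball _ (fun=> 0) _ _ rho) => // v hv _; rewrite nrm0; split => //; exact: d0.
have cz0 : count_at (phi z0) = wind.
  have [d dpos hd] := cderiv_ccont (dphi Uz0) rho0.
  have [|w [Uw ws wD]] := @cder_dense z0 (Num.min s d) Uz0; first by rewrite lt_min s0.
  move: ws; rewrite lt_min => /andP[ws /hd wd].
  have [<- _] := count_sum_at (sqinner_nrm ws) wD.
  by rewrite const.
move=> zeta hz; have cw : count_at zeta = wind by rewrite const.
split => //; first by move=> w; exact: off.
apply: contrapT => nex; have : count_at zeta = 0.
  rewrite /count_at; under eq_fun do rewrite expr1.
  apply: goursat; try exact: sq_le.
  move=> w bw; have Uw := sU bw; have [l dl] := hphi' Uw; eexists.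
  apply: cderivM; first exact: dl.
  apply: cderivV; last by apply: cderivB; [exact: dphi|exact: cderiv_cst].
  rewrite subr_eq0; apply/eqP => E; have [fw|nf] := pselect (sqframe z0 s w).
    by have := off zeta w hz fw; rewrite E eqxx.
  by apply: nex; exists w => //; exact: box_not_frame.
by rewrite cw; apply/eqP; exact: wind_neq0.
Qed.

(** Known where the derivative of [phi] does not vanish; both sides are continuous and such points
    are dense. *)
Lemma sum_at_inverse z : sqinner z0 s z -> sum_at (phi z) = z * wind.
Proof.
move=> iz; have Uz : U z by exact/sU/inner_box.
have c1 : ccont (fun v => sum_at (phi v) - v * wind) z.
  apply: ccontB; last by apply: ccontM; [exact: ccont_id|exact: ccont_cst].
  apply: (@ccont_comp _ phi sum_at); first exact: cderiv_ccont (dphi Uz).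
  apply: cderiv_ccont (kernel_cderiv 1 fL cF _ cphi _).
    by apply: contSM => //; exact: contS_id.
  by move=> w; exact: inner_sep.
apply/eqP; rewrite -subr_eq0; apply/eqP; apply: nrm_le0 => e e0.
have [d d0 hd] := c1 e e0; have [r r0 hr] := sqinner_open iz.
have [|w [Uw wd wD]] := @cder_dense z (Num.min d r) Uz; first by rewrite lt_min d0.
move: wd; rewrite lt_min => /andP[/hd + /hr iw].
have [_ ->] := count_sum_at iw wD; rewrite subrr sub0r nrmN; exact: ltW.
Qed.

End square.
End at_point.

(** Locally the inverse is [sum_at] divided by [wind], an integral of Cauchy kernels in zeta, whence
    its derivability. *)
Theorem univalent_inverse (U : set C) (phi : C -> C) : open U -> holo U phi ->
  (forall z w, U z -> U w -> phi z = phi w -> z = w) ->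
  exists psi : C -> C, [/\ open (phi @` U), forall z, U z -> psi (phi z) = z &
    holo (phi @` U) psi].
Proof.
move=> oU hphi inj; pose psi zeta := get [set z | U z /\ phi z = zeta].
have psiK z : U z -> psi (phi z) = z.
  move=> Uz; have [Up Ep] : [set w | U w /\ phi w = phi z] (psi (phi z)).
    by apply: (@getI _ [set w | U w /\ phi w = phi z] z); split.
  exact: inj.
exists psi; split => //.
  apply/openP => _ [z Uz <-]; have [s s0 sU] := open_sqbox oU Uz.
  have [rho rho0 hrho] := count_at_near oU hphi inj s0 sU.
  by exists rho => // w /hrho[_ _ [v iv <-]]; exists v => //; exact/sU/inner_box.
move=> _ [z Uz <-]; have [s s0 sU] := open_sqbox oU Uz.
have [rho rho0 hrho] := count_at_near oU hphi inj s0 sU.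
have FU : sqframe z s `<=` U by move=> w /sqframe_box/sU.
eexists; apply: (@cderiv_near _ (fun zeta => wind^-1 * sum_at phi z s zeta)).
  exists rho => // w /hrho[_ _ [v iv <-]].
  rewrite (sum_at_inverse oU hphi inj s0 sU iv) psiK; last exact/sU/inner_box.
  by rewrite mulrC mulfK// wind_neq0.
apply: cderivZ; apply: (kernel_cderiv 1 (@functional_sq R z s s0) (@compact_sqframe R z s s0)).
- apply: contSM; first exact: contS_id.
  by move=> w /FU Uw; have [l] := holo_deriv oU hphi Uw; exact: cderiv_ccont.
- by move=> w /FU/hphi[l]; exact: cderiv_ccont.
- by have [|h _ _] := hrho (phi z); rewrite ?subrr ?nrm0.
Qed.

Lemma compact_image K f : compact K -> contS K f -> compact (f @` K).
Proof.
move=> cK cf; apply: continuous_compact => //.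
by apply: continuous_in_subspaceT => w; rewrite inE => /cf/ccontP.
Qed.

(* For b outside [phi @` G], pulling [1 / (w - b)] back to G and approximating
   it there by a polynomial, which has a primitive, shows that b is not in the
   hull. For the other b, a polynomial separating [psi b] from S composed with
   [psi] is holomorphic near the hull, and Runge's theorem applies to it. *)
Theorem univalent_hull (G : set C) (phi : C -> C) S : open G -> simply_connected G ->
  holo G phi -> (forall z w, G z -> G w -> phi z = phi w -> z = w) ->
  compact S -> S `<=` G -> hull S `<=` S ->
  hull (phi @` S) `<=` phi @` S /\
  forall p : {poly R[i]}, exists t : C -> C,
    (forall z, S z -> t (phi z) = p.[z]) /\ papprox (phi @` S) t.
Proof.
move=> oG sG hphi inj cS SG hS.
have [psi [oD psiK hpsi]] := univalent_inverse oG hphi inj.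
set D := phi @` G in oD hpsi.
have ED : phi @` S `<=` D by move=> _ [z Sz <-]; exists z => //; exact: SG.
have cE : compact (phi @` S).
  by apply: compact_image => // z /SG/hphi[l]; exact: cderiv_ccont.
have psiG w : D w -> G (psi w) by move=> [z Gz <-]; rewrite psiK.
have phiK w : D w -> phi (psi w) = w by move=> [z Gz <-]; rewrite psiK.
have dchain w : D w -> cder phi (psi w) * cder psi w = 1.
  move=> Dw; have d1 := cderiv_comp (holo_cder hpsi Dw) (holo_cder hphi (psiG w Dw)).
  apply: cderiv_unique d1 _; apply: (@cderiv_near _ (fun v => v)); last exact: cderiv_id.
  have /openP/(_ w Dw)[r r0 hr] := oD; exists r => // v /hr Dv; by rewrite phiK.
have hD : hull (phi @` S) `<=` D.
  move=> b hb; apply: contrapT => nDb; move: hb.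
  apply: (hull_obstruction cE oD ED nDb) => S' cS' S'D e e0.
  have cpsi : contS S' psi by move=> w /S'D/hpsi[l]; exact: cderiv_ccont.
  (* Simple connectedness keeps this hull inside [G], so that Runge's theorem applies there. *)
  pose T := hull (psi @` S').
  have cT : compact T by apply/compact_hull/compact_image.
  have TG : T `<=` G.
    apply: hull_simply_connected => //; first exact: compact_image.
    by move=> _ [w S'w <-]; apply/psiG/S'D.
  have hT : hull T `<=` T by rewrite /T hullK.
  have cdpsi : contS S' (cder psi).
    by move=> w /S'D Dw; have [l] := holo_deriv oD hpsi Dw; exact: cderiv_ccont.
  have [B B0 hB] := contS_bounded cS' cdpsi.
  have nb w : G w -> phi w - b != 0.
    by move=> Gw; rewrite subr_eq0; apply/eqP => E; apply: nDb; exists w.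
  have hf : holo G (fun w => cder phi w / (phi w - b)).
    move=> w Gw; have [l dl] := holo_deriv oG hphi Gw; eexists.
    apply: cderivM; first exact: dl.
    apply: cderivV; first exact: nb.
    by apply: cderivB; [exact: (holo_cder hphi Gw)|exact: cderiv_cst].
  have eB : 0 < e / B by rewrite divr_gt0.
  have [p hp] := runge cT hT oG TG hf eB.
  have [P PE] := poly_primitive p.
  (* By the chain rule, (phi' o psi) psi' = 1, so 1 / (w - b) is the pullback of phi' / (phi - b)
     times psi'; with [p] in its place a primitive is available. *)
  exists (fun w => p.[psi w] * cder psi w), (fun w => P.[psi w]); split.
    move=> w Dw; have dp := holo_cder hpsi Dw; split.
      by rewrite -PE; exact: (cderiv_comp dp (cderiv_poly P (psi w))).
    apply: ccontM; first exact: (ccont_comp (cderiv_ccont dp) (ccont_poly p (psi w))).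
    by have [l] := holo_deriv oD hpsi Dw; exact: cderiv_ccont.
  move=> w S'w; have Dw := S'D w S'w.
  rewrite (_ : _ - _ = (cder phi (psi w) / (phi (psi w) - b) - p.[psi w]) * cder psi w); last first.
    by rewrite mulrBl mulrAC dchain// mul1r phiK.
  rewrite nrmM (_ : e = e / B * B); last by rewrite divfK// gt_eqF.
  apply: ler_pM; rewrite ?nrm_ge0//; last exact: hB.
  by apply: hp; apply: sub_hull; exists w.
have hE : hull (phi @` S) `<=` phi @` S.
  move=> b hb; have Db := hD b hb; apply: contrapT => nEb.
  have nS : ~ hull S (psi b) by move=> /hS Sb; apply: nEb; exists (psi b) => //; exact: phiK.
  have [p pb hp] := nhullP nS.
  have hpp : holo D (fun w => p.[psi w]).
    by move=> w Dw; eexists; exact: (cderiv_comp (holo_cder hpsi Dw) (cderiv_poly p (psi w))).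
  have hh : hull (hull (phi @` S)) `<=` hull (phi @` S) by rewrite hullK.
  have e0 : 0 < 4^-1 :> R by rewrite invr_gt0.
  have [P hP] := runge (compact_hull cE) hh oD hD hpp e0.
  (* |1 - P b| <= 1/4, whereas |P b| <= 1/4 + 1/4 because b is in the hull: a contradiction. *)
  have := hP b hb; rewrite pb.
  have : nrm P.[b] <= 2^-1.
    apply: hb => _ [z Sz <-]; have := hP (phi z) (sub_hull (imageP phi Sz)).
    rewrite psiK; last exact: SG.
    have := hp z Sz; have := nrmB p.[z] (p.[z] - P.[phi z]); rewrite opprB addrCA subrr addr0.
    by clear; lra.
  by have := nrm_sub 1 P.[b]; rewrite nrm1; clear; lra.
split => // p; exists (fun w => p.[psi w]); split => [z Sz|].
  by rewrite psiK//; exact: SG.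
apply: (runge cE hE oD ED) => w Dw.
by eexists; exact: (cderiv_comp (holo_cder hpsi Dw) (cderiv_poly p (psi w))).
Qed.

End univalent.

(** * Carleman approximation *)

Section carleman.
Context {R : realType}.
Local Notation C := (R[i]^o).
Implicit Types (K A B S U : set C) (f h F : C -> C) (b z w : C).

(** Runge's theorem for the function that is one polynomial near [K] and another near [A];
    [hullU_disjoint] supplies polynomial convexity of the union. *)
Lemma papproxU K A f : compact K -> compact A -> K `&` A = set0 ->
  hull K `<=` K -> hull A `<=` A -> papprox K f -> papprox A f -> papprox (K `|` A) f.
Proof.
move=> cK cA KA hK hA fK fA e e0; have e2 : 0 < e / 2 by rewrite divr_gt0.
have [p hp] := fK _ e2; have [q hq] := fA _ e2.
have oA : open (~` A) by apply: closed_openC; exact: ((compactP A).1 cA).1.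
have [|d d0 hd] := @compact_open_sep _ K (~` A) cK oA.
  by move=> z Kz Az; have : (K `&` A) z by []; rewrite KA.
pose OK := fatten K (d / 2); pose OA := fatten A (d / 2).
have d2 : 0 < d / 2 by rewrite divr_gt0.
have dis w : OK w -> OA w -> False.
  move=> [z Kz hz] [v Av hv]; apply: (hd z v Kz _ Av).
  by have := nrm_tri w v z; rewrite (nrmBC v w); move: hz hv; clear; lra.
pose g w := if `[< OK w >] then p.[w] else q.[w].
have [|||||P hP] := @runge _ (K `|` A) (OK `|` OA) g _ _ _ _ _ _ e2.
- exact: compactU.
- by move=> w /(hullU_disjoint cK cA KA)[/hK|/hA]; [left|right].
- by apply: openU; exact: open_fatten.
- by move=> w [Kw|Aw]; [left|right]; exists w => //; rewrite subrr nrm0.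
- move=> w [OKw|OAw]; eexists.
    apply: (@cderiv_near _ (fun v => p.[v])); last exact: cderiv_poly.
    have /openP/(_ w OKw)[r r0 hr] := @open_fatten _ K (d / 2).
    by exists r => // v /hr h; rewrite /g (asboolT h).
  apply: (@cderiv_near _ (fun v => q.[v])); last exact: cderiv_poly.
  have /openP/(_ w OAw)[r r0 hr] := @open_fatten _ A (d / 2).
  by exists r => // v /hr h; rewrite /g asboolF// => h'; exact: dis h' h.
exists P => z Uz.
suff : nrm (f z - g z) <= e / 2.
  have := hP z Uz; have := nrmD (f z - g z) (g z - P.[z]); rewrite subrKA; clear; lra.
rewrite /g; case: asboolP => [OKz|nOK]; case: Uz => [Kz|Az].
- exact: hp.
- by case: (dis z) => //; exists z => //; rewrite subrr nrm0.
- by case: nOK; exists z => //; rewrite subrr nrm0.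
- exact: hq.
Qed.

Section family.
Variables (I : choiceType) (D : set I) (E : I -> set C).
Hypotheses (cE : forall i, D i -> compact (E i)) (hE : forall i, D i -> hull (E i) `<=` E i)
  (tE : trivIset D E).

Definition unionE (s : seq I) : set C := [set z | exists2 i, i \in s & E i z].

Lemma unionE_cons i s : unionE (i :: s) = E i `|` unionE s.
Proof.
apply/seteqP; split => [z [j]|z [Ez|[j js Ez]]].
- by rewrite inE => /orP[/eqP ->|js]; [left|right; exists j].
- by exists i => //; rewrite inE eqxx.
- by exists j => //; rewrite inE js orbT.
Qed.

Lemma unionE_disj i s : D i -> (forall j, j \in s -> D j) -> i \notin s ->
  E i `&` unionE s = set0.
Proof.
move=> Di Ds nis; apply/seteqP; split => // z [Eiz [j js Ejz]].
have : i = j by apply: (tE Di (Ds j js)); exists z.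
by move=> ij; move: nis; rewrite ij js.
Qed.

Lemma unionE_compact s : (forall j, j \in s -> D j) -> compact (unionE s).
Proof.
elim: s => [|i s IH] Ds.
  by rewrite (_ : unionE [::] = set0); [exact: compact0|apply/seteqP; split => // z []].
rewrite unionE_cons; apply: compactU; first by apply: cE; apply: Ds; rewrite inE eqxx.
by apply: IH => j js; apply: Ds; rewrite inE js orbT.
Qed.

Lemma unionE_hull s : (forall j, j \in s -> D j) -> hull (unionE s) `<=` unionE s.
Proof.
elim: s => [|i s IH] Ds.
  (* The hull of the empty set is empty: the polynomial 0 is bounded on it by -1. *)
  by move=> z /(_ 0 (-1)); rewrite horner0 nrm0 => /(_ _)/wrap[w []//|]; rewrite ler0N1.
have Di : D i by apply: Ds; rewrite inE eqxx.
have Ds' j : j \in s -> D j by move=> js; apply: Ds; rewrite inE js orbT.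
rewrite unionE_cons; have [js|nis] := boolP (i \in s).
  rewrite (_ : E i `|` unionE s = unionE s); first exact: IH.
  by apply/seteqP; split => [z [Ez|//]|z]; [exists i|right].
move=> z /(hullU_disjoint (cE Di) (unionE_compact Ds') (unionE_disj Di Ds' nis)).
by case=> [/(hE Di)|/(IH Ds')]; [left|right].
Qed.

Lemma unionE_papprox s f : (forall j, j \in s -> D j) ->
  (forall j, j \in s -> papprox (E j) f) -> papprox (unionE s) f.
Proof.
elim: s => [|i s IH] Ds hf.
  by move=> e e0; exists 0 => z [].
have Di : D i by apply: Ds; rewrite inE eqxx.
have Ds' j : j \in s -> D j by move=> js; apply: Ds; rewrite inE js orbT.
have hf' j : j \in s -> papprox (E j) f by move=> js; apply: hf; rewrite inE js orbT.
rewrite unionE_cons; have [js|nis] := boolP (i \in s).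
  rewrite (_ : E i `|` unionE s = unionE s); first exact: IH.
  by apply/seteqP; split => [z [Ez|//]|z]; [exists i|right].
apply: papproxU.
- exact: cE.
- exact: unionE_compact.
- exact: unionE_disj.
- exact: hE.
- exact: unionE_hull.
- by apply: hf; rewrite inE eqxx.
- exact: IH.
Qed.

Variable G : set C.
Hypotheses (oG : open G) (sG : simply_connected G) (EG : forall i, D i -> E i `<=` G)
  (lf : forall K, compact K -> K `<=` G -> finite_set [set i | D i /\ E i `&` K !=set0]).

Lemma meeting K : compact K -> K `<=` G -> exists s : seq I,
  forall i, i \in s <-> D i /\ E i `&` K !=set0.
Proof.
move=> cK KG; have /finite_seqP[s hs] := lf cK KG; exists s => i.
by have : [set` s] i <-> [set i | D i /\ E i `&` K !=set0] i by rewrite hs.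
Qed.

(* The hull of K and of the [E i] that meet K may meet further sets [E i]. The
   union Q with those is still polynomially convex: outside the first hull the
   added sets are compact, since [hull K1 `\` K1] is open, and the hull of a
   disjoint union of compact sets splits. *)
Lemma saturate K : compact K -> K `<=` G -> exists Q : set C,
  [/\ compact Q, Q `<=` G, K `<=` Q, hull Q `<=` Q &
      forall i, D i -> E i `<=` Q \/ E i `&` Q = set0].
Proof.
move=> cK KG; have [s0 hs0] := meeting cK KG.
have Ds0 i : i \in s0 -> D i by move=> /hs0[].
pose K1 := K `|` unionE s0.
have cK1 : compact K1 by apply: compactU => //; exact: unionE_compact.
have K1G : K1 `<=` G by move=> z [/KG//|[i /Ds0 Di]]; exact: EG.
have cQ1 := compact_hull cK1; have Q1G := hull_simply_connected sG cK1 K1G.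
have [s1 hs1] := meeting cQ1 Q1G.
pose s2 := [seq i <- s1 | i \notin s0].
have Ds2 i : i \in s2 -> D i by rewrite mem_filter => /andP[_ /hs1[]].
have cA := unionE_compact Ds2; have hA := unionE_hull Ds2.
have disj : K1 `&` unionE s2 = set0.
  apply/seteqP; split => // z [K1z [k]]; rewrite mem_filter => /andP[ni /hs1[Di _]] Ez.
  move/negP: ni; apply; case: K1z => [Kz|[j js Ejz]].
    by apply/hs0; split => //; exists z.
  have -> // : k = j by apply: (tE Di (Ds0 j js)); exists z.
(* Removing the open set [hull K1] minus [K1] removes all of [hull K1], as [K1] does not meet these
   sets. *)
pose A' := unionE s2 `\` (hull K1 `\` K1).
have cA' : compact A' by apply: compact_diff_open => //; exact: open_hullD.
have disj' : hull K1 `&` A' = set0.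
  apply/seteqP; split => // z [hz [Az nz]]; apply: nz; split => // K1z.
  by have : (K1 `&` unionE s2) z by []; rewrite disj.
have QE : hull K1 `|` unionE s2 = hull K1 `|` A'.
  apply/seteqP; split => z [hz|Az]; [by left| |by left|by right; case: Az].
  by have [hz|nhz] := pselect (hull K1 z); [left|right; split => // -[]].
exists (hull K1 `|` unionE s2); split.
- exact: compactU.
- by move=> z [/Q1G//|[i /Ds2 Di]]; exact: EG.
- by move=> z Kz; left; apply: sub_hull; left.
- rewrite {1}QE => z /(hullU_disjoint cQ1 cA' disj'); rewrite hullK => -[hz|]; first by left.
  by move=> hz; right; apply: hA; apply: hullS hz => w [].
move=> i Di; have [in0|ni0] := boolP (i \in s0).
  by left => z Ez; left; apply: sub_hull; right; exists i.
have [[z [Ez Qz]]|ne] := pselect (E i `&` (hull K1 `|` unionE s2) !=set0); last first.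
  by right; apply/seteqP; split => // z hz; apply: ne; exists z.
left => w Ew; right; exists i => //; rewrite mem_filter ni0 /=.
apply/hs1; split => //; case: Qz => [hz|[j]]; first by exists z.
rewrite mem_filter => /andP[_ /hs1[Dj [v [Ejv hv]]]] Ejz.
have -> : i = j by apply: (tE Di Dj); exists z.
by exists v.
Qed.

(** The usual exhaustion of [G] by bounded sets that keep a distance from the complement. *)
Definition kexh (m : nat) : set C :=
  [set z | nrm z <= m%:R /\ forall w, ~ G w -> m.+1%:R^-1 <= nrm (z - w)].

Lemma compact_kexh m : compact (kexh m).
Proof.
apply/compactP; split; last by exists m%:R => z [].
apply/closedP => z nz; have [h|h] := ltP m%:R (nrm z).
  exists (nrm z - m%:R) => [|w hw [hm _]]; first by rewrite subr_gt0.
  by move: hm; rewrite leNgt => /negP; apply; have := nrm_sub z w; rewrite nrmBC; lra.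
have [w [nGw hw]] : exists w, ~ G w /\ nrm (z - w) < m.+1%:R^-1.
  apply: contrapT => k; apply: nz; split => // w nGw; rewrite leNgt; apply/negP => hw.
  by apply: k; exists w.
exists (m.+1%:R^-1 - nrm (z - w)) => [|v hv [_ hm]]; first by rewrite subr_gt0.
have := hm w nGw; rewrite leNgt => /negP; apply; apply: le_lt_trans (nrm_tri z v w) _.
by rewrite -ltrBrDr.
Qed.

Lemma kexhG m : kexh m `<=` G.
Proof.
move=> z [_ h]; apply: contrapT => nGz; have := h z nGz.
by rewrite subrr nrm0 leNgt invr_gt0 ltr0Sn.
Qed.

Lemma kexh_absorb K : compact K -> K `<=` G -> exists m, K `<=` kexh m.
Proof.
move=> cK KG; have [d d0 hd] := compact_open_sep cK oG KG.
have [_ [M hM]] := (compactP K).1 cK.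
exists (maxn (Num.truncn `|M|).+1 (Num.truncn d^-1).+1) => z Kz; split.
  apply: le_trans (hM z Kz) _; apply: le_trans (ler_norm _) _.
  apply: le_trans (ltW (truncnS_gt _)) _; rewrite ler_nat; exact: leq_maxl.
move=> w nGw; have h : d <= nrm (z - w).
  by rewrite leNgt; apply/negP => h; apply: nGw; apply: (hd z) => //; rewrite nrmBC.
apply: le_trans h; rewrite -[leRHS]invrK lef_pV2 ?posrE ?invr_gt0//.
apply: le_trans (ltW (truncnS_gt _)) _; rewrite ler_nat.
by apply: leq_trans (leqnSn _); exact: leq_maxr.
Qed.

(* The limit l is the same for all rates c, because of the order of the
   quantifiers. *)
Lemma geometric_limit (u : nat -> C) (c0 : R) (m0 : nat) :
  (forall k, (m0 <= k)%N -> nrm (u k.+1 - u k) <= c0 / 2 ^+ k) ->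
  exists l : C, forall c m, (forall k, (m <= k)%N -> nrm (u k.+1 - u k) <= c / 2 ^+ k) ->
    forall k, (m <= k)%N -> nrm (l - u k) <= 2 * c / 2 ^+ k.
Proof.
move=> h0.
have pw k : 0 < 2 ^+ k :> R by exact: exprn_gt0.
have half k (c : R) : c / 2 ^+ k.+1 = c / 2 ^+ k / 2 by rewrite exprSr invfM mulrA.
have ex (g : C -> R) : (forall z w, g (z - w) = g z - g w) -> (forall z, `|g z| <= nrm z) ->
    exists x, forall k, (m0 <= k)%N -> `|x - g (u k)| <= 2 * c0 / 2 ^+ k.
  move=> gB gn.
  have st k : `|g (u (m0 + k).+1) - g (u (m0 + k)%N)| <= c0 / 2 ^+ (m0 + k).
    by rewrite -gB; apply: le_trans (gn _) _; apply: h0; rewrite leq_addr.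
  have [||k|x hx] := @nested_itv R (fun k => g (u (m0 + k)%N) - 2 * (c0 / 2 ^+ (m0 + k)))
     (fun k => g (u (m0 + k)%N) + 2 * (c0 / 2 ^+ (m0 + k))).
  - by move=> k; have := st k; rewrite addnS half ler_norml; lra.
  - by move=> k; have := st k; rewrite addnS half ler_norml; lra.
  - by have := le_trans (normr_ge0 _) (st k); lra.
  exists x => k mk; have := hx (k - m0)%N; rewrite subnKC// ler_norml -mulrA; lra.
have [x hx] := ex (@complex.Re R) (@CreB R) (@nrm_Re R).
have [y hy] := ex (@complex.Im R) (@CimB R) (@nrm_Im R).
exists (Complex x y) => c m hc k mk.
have tele j : nrm (u (k + j)%N - u k) <= 2 * c / 2 ^+ k - 2 * c / 2 ^+ (k + j).
  elim: j => [|j IH]; first by rewrite addn0 !subrr nrm0.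
  have := hc (k + j)%N (leq_trans mk (leq_addr _ _)).
  have := nrm_tri (u (k + j)%N) (u (k + j).+1) (u k).
  by rewrite addnS half -!mulrA; rewrite -!mulrA in IH; lra.
have pos (a : R) i : 0 <= a / 2 ^+ i -> 0 <= a by rewrite pmulr_lge0 ?invr_gt0.
have c_ge0 : 0 <= c by exact: pos (le_trans (nrm_ge0 _) (hc m (leqnn m))).
have c00 : 0 <= c0 by exact: pos (le_trans (nrm_ge0 _) (h0 m0 (leqnn m0))).
apply/ler_addgt0Pr => e e0; have [n hn] := ex_pow2_lt (4 * c0) e0.
pose j := maxn n m0.
have mj : (m0 <= k + j)%N by apply: leq_trans (leq_maxr n m0) (leq_addl _ _).
have nj : (n <= k + j)%N by apply: leq_trans (leq_maxl n m0) (leq_addl _ _).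
have sm : 4 * c0 / 2 ^+ (k + j) <= 4 * c0 / 2 ^+ n.
  by rewrite ler_wpM2l ?mulr_ge0// lef_pV2 ?posrE// ler_weXn2l// ler1n.
have := hx _ mj; have := hy _ mj; have := nrm_ReIm (Complex x y - u (k + j)%N).
rewrite CreB CimB /= => h1 h2 h3.
have := tele j; have : 0 <= 2 * c / 2 ^+ (k + j).
  by rewrite divr_ge0 ?mulr_ge0// ltW.
have := nrm_tri (u (k + j)%N) (Complex x y) (u k).
by rewrite -!mulrA in h2 h3 sm hn *; lra.
Qed.

Variables (t : I -> C -> C) (r : I -> R).
Hypotheses (tapp : forall i, D i -> papprox (E i) (t i)) (r0 : forall i, D i -> 0 < r i).

(* One step: a polynomial is corrected by a polynomial that is small on [Q] and
   hits the targets on the sets [E i] that meet [Q'] but not [Q]. *)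
Lemma carleman_step (Q Q' : set C) (p : {poly R[i]}) (m : nat) :
  compact Q -> hull Q `<=` Q -> compact Q' -> Q' `<=` G ->
  (forall i, D i -> E i `<=` Q \/ E i `&` Q = set0) ->
  exists q : {poly R[i]},
   [/\ forall z, Q z -> nrm (q.[z] - p.[z]) <= 8^-1 / 2 ^+ m,
     forall i z, D i -> E i `&` Q' !=set0 -> Q z -> nrm (q.[z] - p.[z]) <= (r i / 8) / 2 ^+ m &
     forall i z, D i -> E i `&` Q' !=set0 -> E i `&` Q = set0 -> E i z ->
       nrm (q.[z] - t i z) <= r i / 8].
Proof.
move=> cQ hQ cQ' Q'G dich; have [s hs] := meeting cQ' Q'G.
have Ds i : i \in s -> D i by move=> /hs[].
(* One tolerance d serves all the finitely many sets that meet [Q'], and is at most 1 for the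
   uniform estimate on [Q]. *)
have [d [d0 d1 hd]] : exists d : R, [/\ 0 < d, d <= 1 & forall i, i \in s -> d <= r i].
  elim: s Ds {hs} => [|i s IH] Ds; first by exists 1.
  have [|d [d0 d1 hd]] := IH; first by move=> j js; apply: Ds; rewrite inE js orbT.
  exists (Num.min d (r i)); split => [||j].
  - by rewrite lt_min d0 r0//; apply: Ds; rewrite inE eqxx.
  - by rewrite ge_min d1.
  - by rewrite inE => /orP[/eqP ->|/hd h]; rewrite ge_min ?lexx ?orbT// h.
pose s1 := [seq i <- s | `[< E i `&` Q = set0 >]].
have Ds1 i : i \in s1 -> D i by rewrite mem_filter => /andP[_]; exact: Ds.
have QE i : i \in s1 -> E i `&` Q = set0 by rewrite mem_filter => /andP[/asboolP].
have /choice[f hf] : forall z, exists v : C, (Q z -> v = p.[z]) /\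
    forall i, i \in s1 -> E i z -> v = t i z.
  move=> z; have [Qz|nQz] := pselect (Q z).
    exists p.[z]; split => // i is1 Ez.
    by have : (E i `&` Q) z by []; rewrite QE.
  have [[i [is1 Ez]]|ne] := pselect (exists i, i \in s1 /\ E i z); last first.
    by exists 0; split => // i is1 Ez; case: ne; exists i.
  exists (t i z); split => // j js1 Ejz; congr (t _ z).
  by apply: (tE (Ds1 _ is1) (Ds1 _ js1)); exists z.
have fQ z : Q z -> f z = p.[z] by move=> Qz; exact: (hf z).1.
have fE i z : i \in s1 -> E i z -> f z = t i z by move=> is1 Ez; exact: (hf z).2.
have fapp : papprox (Q `|` unionE s1) f.
  apply: papproxU => //.
  - exact: unionE_compact.
  - apply/seteqP; split => // z [Qz [i is1 Ez]].
    by have : (E i `&` Q) z by []; rewrite QE.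
  - exact: unionE_hull.
  - by move=> e e0; exists p => z Qz; rewrite fQ// subrr nrm0 ltW.
  - apply: unionE_papprox => // i is1.
    apply: (@papprox_ext _ _ (t i)) => [z Ez|]; first by rewrite (fE i).
    exact/tapp/Ds1.
have pw : 0 < 2 ^+ m :> R by exact: exprn_gt0.
have e0 : 0 < d / 8 / 2 ^+ m by rewrite !divr_gt0.
have [q hq] := fapp _ e0; exists q.
have hqQ z : Q z -> nrm (q.[z] - p.[z]) <= d / 8 / 2 ^+ m.
  by move=> Qz; rewrite nrmBC -fQ//; apply: hq; left.
have mono (x y : R) : x <= y -> x / 8 / 2 ^+ m <= y / 8 / 2 ^+ m.
  by move=> xy; rewrite ler_pM2r ?invr_gt0// ler_pM2r// invr_gt0.
split => [z Qz|i z Di EQ' Qz|i z Di EQ' EQ Ez].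
- by apply: le_trans (hqQ z Qz) _; apply: le_trans (mono _ _ d1) _; rewrite mul1r.
- by apply: le_trans (hqQ z Qz) _; apply/mono/hd/hs.
- have is1 : i \in s1 by rewrite mem_filter; apply/andP; split; [exact/asboolP|exact/hs].
  rewrite nrmBC -(fE i)//; apply: le_trans (hq z _) _; first by right; exists i.
  apply: (@le_trans _ _ (d / 8)).
    by rewrite ler_piMr ?divr_ge0 ?(ltW d0)// invf_le1// exprn_ege1// ler1n.
  by rewrite ler_pM2r ?invr_gt0//; apply/hd/hs.
Qed.

(** Each [E i] has its target set once, when it first meets the growing saturated sets; afterwards
    it lies inside them and sees only corrections of summable size, measured in terms of [r i]. *)
Theorem carleman : exists F : C -> C, holo G F /\
  forall i z, D i -> E i z -> nrm (F z - t i z) <= r i.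
Proof.
have [sat hsat] : exists sat : set C -> set C, forall K, compact K -> K `<=` G ->
    [/\ compact (sat K), sat K `<=` G, K `<=` sat K, hull (sat K) `<=` sat K &
      forall i, D i -> E i `<=` sat K \/ E i `&` sat K = set0].
  have /choice[sat hsat] : forall K, exists Q, compact K -> K `<=` G ->
    [/\ compact Q, Q `<=` G, K `<=` Q, hull Q `<=` Q &
      forall i, D i -> E i `<=` Q \/ E i `&` Q = set0].
    move=> K; have [[cK KG]|h] := pselect (compact K /\ K `<=` G).
      by have [Q hQ] := saturate cK KG; exists Q.
    by exists set0 => cK KG; case: h.
  by exists sat.
(* Saturation at each stage leaves no [E i] partly inside [Q m]; adding [kexh m] makes the [Q m]
   exhaust [G]. *)
pose Q := fix Q m := if m is m'.+1 then sat (Q m' `|` kexh m') else set0.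
have HQ m : [/\ compact (Q m), Q m `<=` G, hull (Q m) `<=` Q m &
    forall i, D i -> E i `<=` Q m \/ E i `&` Q m = set0].
  elim: m => [|m [c1 c2 c3 c4]] /=.
    split => //; first exact: compact0.
      have := @unionE_hull [::]; rewrite (_ : unionE [::] = set0); first by apply.
      by apply/seteqP; split => // z [].
    by move=> i _; right; rewrite setI0.
  have [||h1 h2 h3 h4 h5] := hsat (Q m `|` kexh m) => //.
    by apply: compactU => //; exact: compact_kexh.
  by move=> z [/c2//|]; exact: kexhG.
have QS m : Q m `<=` Q m.+1 /\ kexh m `<=` Q m.+1.
  have [c1 c2 c3 c4] := HQ m.
  have [||h1 h2 h3 h4 h5] := hsat (Q m `|` kexh m).
  - by apply: compactU => //; exact: compact_kexh.
  - by move=> z [/c2//|]; exact: kexhG.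
  - by split => z hz; apply: h3; [left|right].
have Qmono k m : (k <= m)%N -> Q k `<=` Q m.
  elim: m => [|m IH]; first by rewrite leqn0 => /eqP ->.
  by rewrite leq_eqVlt => /orP[/eqP ->//|/IH h] z /h; exact: (QS m).1.
have /choice[stp hstp] : forall x : nat * {poly R[i]}, exists q : {poly R[i]},
   [/\ forall z, Q x.1 z -> nrm (q.[z] - x.2.[z]) <= 8^-1 / 2 ^+ x.1,
     forall i z, D i -> E i `&` Q x.1.+1 !=set0 -> Q x.1 z ->
       nrm (q.[z] - x.2.[z]) <= (r i / 8) / 2 ^+ x.1 &
     forall i z, D i -> E i `&` Q x.1.+1 !=set0 -> E i `&` Q x.1 = set0 -> E i z ->
       nrm (q.[z] - t i z) <= r i / 8].
  move=> [m p]; have [c1 c2 c3 c4] := HQ m; have [c1' c2' c3' c4'] := HQ m.+1.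
  exact: carleman_step.
pose P := fix P m := if m is m'.+1 then stp (m', P m') else (0 : {poly R[i]}).
have HP m := hstp (m, P m).
have PS m : P m.+1 = stp (m, P m) by [].
(* The rate c is used twice: 1/8 for uniform convergence on each [Q m], and [r i / 8] for the
   targets. Outside all [Q m] the value 0 is a default. *)
have /choice[F hF] : forall z, exists l : C, forall m, Q m z ->
    forall c k0, (forall k, (k0 <= k)%N -> nrm ((P k.+1).[z] - (P k).[z]) <= c / 2 ^+ k) ->
    forall k, (k0 <= k)%N -> nrm (l - (P k).[z]) <= 2 * c / 2 ^+ k.
  move=> z; have [[m Qz]|h] := pselect (exists m, Q m z); last first.
    by exists 0 => m Qz; case: h; exists m.
  have [|l hl] := @geometric_limit (fun k => (P k).[z]) 8^-1 m.
    by move=> k mk; have [h _ _] := HP k; apply: h; exact: Qmono Qz.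
  by exists l => _ _ c k0 h; exact: hl.
have Qlim m k z : Q m z -> (m <= k)%N -> nrm (F z - (P k).[z]) <= 2 * 8^-1 / 2 ^+ k.
  move=> Qz mk; apply: (hF z m Qz 8^-1 m) => // j mj.
  by have [h _ _] := HP j; apply: h; exact: Qmono Qz.
exists F; split.
  apply: weierstrass => // K cK KG e e0; have [m hm] := kexh_absorb cK KG.
  have KQ : K `<=` Q m.+1 by move=> z /hm; exact: (QS m).2.
  have [n hn] := ex_pow2_lt (2 * 8^-1) e0.
  pose k := maxn n m.+1; exists (fun z => (P k).[z]) => [z _|z Kz].
    by eexists; exact: cderiv_poly.
  apply: le_trans (Qlim m.+1 k z (KQ z Kz) (leq_maxr _ _)) _.
  apply: le_trans _ (ltW hn); rewrite ler_wpM2l ?mulr_ge0 ?invr_ge0//.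
  rewrite lef_pV2 ?posrE ?exprn_gt0//; apply: ler_weXn2l; first by rewrite ler1n.
  exact: leq_maxl.
move=> i z Di Ez.
have [m0 hm0] := @kexh_absorb [set z] (@compact_set1 _ z) (fun w wz => EG Di (eq_ind_r _ Ez wz)).
have exm : exists m, `[< Q m z >].
  by exists m0.+1; apply/asboolP; apply: (QS m0).2; exact: hm0.
(* [Q 0] is empty, so the first stage that contains z is some m.+1; [E i] is disjoint from [Q m] and
   receives its target at step m. *)
case: (ex_minnP exm) => -[|m] /asboolP Qz minm; first by [].
have [c1 c2 c3 c4] := HQ m; have [c1' c2' c3' c4'] := HQ m.+1.
have nQz : ~ Q m z by move=> /asboolP/minm; rewrite ltnn.
have EQ : E i `&` Q m = set0 by case: (c4 i Di) => // h; case: nQz; exact: h.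
have EQ' k : (m < k)%N -> E i `&` Q k !=set0.
  by move=> mk; exists z; split => //; exact: Qmono Qz.
have [_ _ h3] := HP m; have b1 := h3 i z Di (EQ' _ (ltnSn m)) EQ Ez; rewrite -PS in b1.
have b2 : nrm (F z - (P m.+1).[z]) <= 2 * (r i / 8) / 2 ^+ m.+1.
  apply: (hF z m.+1 Qz (r i / 8) m.+1) => // k mk.
  have [_ h _] := HP k; apply: (h i) => //; first exact: EQ' (leqW mk).
  exact: Qmono Qz.
(* The budget: r i / 8 when the target is set, and at most r i / 4 for all later corrections. *)
have b3 : 2 * (r i / 8) / 2 ^+ m.+1 <= 2 * (r i / 8).
  rewrite ler_piMr ?mulr_ge0 ?divr_ge0 ?(ltW (r0 Di))//.
  by rewrite invf_le1 ?exprn_gt0// exprn_ege1// ler1n.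
have := nrm_tri (P m.+1).[z] (F z) (t i z); have := r0 Di; lra.
Qed.

End family.
End carleman.

(** * Lower density and the space H(G) *)

Section density.
Context {R : realType}.

Lemma densityP (A : set nat) : (0 < lower_density R A)%E <->
  exists2 c : R, 0 < c & exists N, forall n, (N <= n)%N ->
    c <= #|` fset_set (A `&` `I_n.+1)|%:R / n.+1%:R.
Proof.
rewrite /lower_density; set u := (X in limn_einf X).
rewrite limn_einf_lim (cvg_lim _ (@cvg_einfs_sup _ _))//; split => [/ereal_sup_gt[_ [N _ <-]]|[c c0 [N hN]]].
  set x := einfs u N => x0.
  have xu n : (N <= n)%N -> (x <= u n)%E by move=> Nn; apply: ereal_inf_lbound; exists n.
  have xfin : x \is a fin_num.
    rewrite fin_numElt (lt_trans _ x0) ?ltNyr//=.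
    by apply: le_lt_trans (xu N (leqnn N)) _; rewrite ltry.
  exists (fine x); first by rewrite fine_gt0// x0 -ge0_fin_numE// ltW.
  by exists N => n /xu; rewrite -lee_fin fineK.
apply: lt_le_trans (_ : (c%:E <= _)%E); first by rewrite lte_fin.
apply: (@le_trans _ _ (einfs u N)); last by apply: ereal_sup_ubound; exists N.
by apply: le_ereal_inf_tmp => _ [n /= Nn <-]; rewrite lee_fin; exact: hN.
Qed.

Lemma density_gt0_sub (A B F : set nat) : finite_set F -> A `\` F `<=` B ->
  (0 < lower_density R A)%E -> (0 < lower_density R B)%E.
Proof.
move=> finF AB /densityP[c c0 [N hN]]; apply/densityP; exists (c / 2); first by rewrite divr_gt0.
set m := #|` fset_set F|.
(* From this index on, the m elements of [F] account for at most half of c (n + 1). *)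
exists (maxn N (Num.truncn (2 * m%:R / c)).+1) => n; rewrite geq_max => /andP[Nn mn].
have n0 : 0 < n.+1%:R :> R by [].
have fin (S : set nat) : finite_set (S `&` `I_n.+1) by apply: finite_setIr; exact: finite_II.
have card : (#|` fset_set (A `&` `I_n.+1)| <= #|` fset_set (B `&` `I_n.+1)| + m)%N.
  apply: (@leq_trans #|` fset_set ((B `&` `I_n.+1) `|` F)|).
    apply: fsubset_leq_card; rewrite -fset_set_sub//; last by rewrite finite_setU; split.
    by move=> k [Ak kn]; have [Fk|nFk] := pselect (F k); [right|left; split => //; exact: AB].
  by rewrite fset_setU// cardfsU leq_subr.
have := hN n Nn; rewrite ler_pdivlMr// => h; rewrite ler_pdivlMr//.
have h' : #|` fset_set (A `&` `I_n.+1)|%:R <= #|` fset_set (B `&` `I_n.+1)|%:R + m%:R :> R.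
  by rewrite -natrD ler_nat.
have h2 : 2 * m%:R / c <= n.+1%:R.
  by apply: le_trans (ltW (truncnS_gt _)) _; rewrite ler_nat leqW.
rewrite ler_pdivrMr// in h2; lra.
Qed.

End density.

(** * From the subspace [G] and the space [hol G] to functions on the plane *)

Section bridge.
Context {R : realType}.
Local Notation C := (R[i]^o).
Variable G : set C.

Lemma nbhs_setP (x : G) (U : set G) :
  nbhs x U <-> exists2 e : R, 0 < e & forall y : G, nrm (set_val y - set_val x : C) < e -> U y.
Proof.
split => [[V [[W oW <-] Wx WU]]|[e e0 he]].
  have /openP/(_ _ Wx)[e e0 he] := oW; exists e => // y hy; apply: WU; exact: he.
exists (set_val @^-1` [set w : C | nrm (w - set_val x) < e]).
split; last by move=> y hy; exact: he.
  by exists [set w : C | nrm (w - set_val x) < e] => //; exact: open_ballC.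
by rewrite /= subrr nrm0.
Qed.

Lemma set_valG (x : G) : G (set_val x). Proof. exact/set_mem/(valP x). Qed.

Lemma compact_set_val (L : set G) : compact L -> compact (set_val @` L : set C).
Proof.
move=> cL; apply: continuous_compact => //.
by apply: continuous_subspaceT; exact: initial_continuous.
Qed.

Lemma compact_preimage_val (K : set C) : compact K -> K `<=` G ->
  compact (set_val @^-1` K : set G).
Proof.
move=> cK KG F FF FK.
have [//|h] := pselect (exists p : G, (set_val @^-1` K) p /\ cluster F p).
suff [S FS SK] : exists2 S, F S & S `&` (set_val @^-1` K) = set0.
  by have := @filter_ex _ _ _ _ (filterI FS FK); rewrite SK => -[].
suff : exists2 S, F S & forall x : G, S x -> ~ K (set_val x).
  by move=> [S FS h']; exists S => //; apply/seteqP; split => // x [/h'].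
apply: (@compact_ind _ K (fun T => exists2 S, F S & forall x : G, S x -> ~ T (set_val x))) => //.
- by exists setT; [exact: (@filterT _ F)|move=> x _ []].
- by move=> A B AB [S FS SB]; exists S => // x /SB nB /AB.
- move=> A B [S FS SA] [T FT TB]; exists (S `&` T); first exact: filterI.
  by move=> x [/SA nA /TB nB] [].
- move=> z Kz; have Gz := KG z Kz; pose x : G := SigSub (mem_set Gz).
  have nz : ~ cluster F x by move=> ?; apply: h; exists x.
  apply: contrapT => hz; apply: nz => A B FA /nbhs_setP[e e0 he].
  apply: contrapT => AB; apply: hz; exists e => //; exists A => // y Ay [_ hy].
  by apply: AB; exists y; split => //; exact: he.
Qed.

Definition ext (f : G -> C) : C -> C := 'valL_(0 : C) f.

Lemma extE (f : G -> C) (x : G) : ext f (set_val x) = f x.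
Proof. exact: (congr1 (fun h => h x) (valLK (0 : C) f)). Qed.

Lemma valG_ex z : G z -> exists x : G, set_val x = z.
Proof. by move=> Gz; exists (SigSub (mem_set Gz)). Qed.

Lemma holomorphicP (f : G -> C) : holomorphic f <-> holo G (ext f).
Proof. by split => h z Gz; have := h z Gz; rewrite derivable_cderiv. Qed.

Lemma hol_holo (f : hol G) : holo G (ext f).
Proof. exact/holomorphicP/holP. Qed.

Hypothesis oG : open G.

Lemma holo_holomorphic (F : C -> C) : holo G F -> holomorphic (fun x : G => F (set_val x)).
Proof.
move=> hF; apply/holomorphicP => z Gz; have [l dl] := hF z Gz; exists l.
apply: cderiv_near dl; have /openP/(_ z Gz)[e e0 he] := oG; exists e => // w /he Gw.
by have [x <-] := valG_ex Gw; rewrite extE.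
Qed.

Definition mkhol (F : C -> C) (hF : holo G F) : hol G :=
  Hol (asboolT (holo_holomorphic hF)).

Lemma mkholE F (hF : holo G F) x : mkhol hF x = F (set_val x). Proof. by []. Qed.

Lemma hol_eq (f g : hol G) : (forall x, f x = g x) -> f = g.
Proof. by move=> fg; apply: val_inj; apply/funext. Qed.

Lemma hol_nbhsP (g : hol G) (V : set (hol G)) : nbhs g V <->
  exists2 L : set G, compact L & exists2 e : R, 0 < e &
    forall h : hol G, (forall x, L x -> nrm (h x - g x) < e) -> V h.
Proof.
split.
  rewrite nbhsE => -[U [[W oW <-] Ug UV]].
  (* The filter of the expected basic neighbourhoods converges to [g] uniformly on each compact set,
     hence contains every neighbourhood of [g]. *)
  pose Fl : set_system (G -> C) := [set P | exists2 L : set G, compact L & exists2 e : R, 0 < e &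
    forall h : G -> C, (forall x, L x -> nrm (h x - g x) < e) -> P h].
  have FF : Filter Fl.
    split.
    - by exists set0; [exact: compact0|exists 1].
    - move=> P Q [L cL [e e0 hL]] [L' cL' [e' e'0 hL']].
      exists (L `|` L'); first exact: compactU.
      exists (Num.min e e') => [|h hh]; first by rewrite lt_min e0.
      split; [apply: hL => x Lx|apply: hL' => x Lx].
        by have := hh x (or_introl Lx); rewrite lt_min => /andP[].
      by have := hh x (or_intror Lx); rewrite lt_min => /andP[].
    - by move=> P Q PQ [L cL [e e0 hL]]; exists L => //; exists e => // h /hL/PQ.
  have : {family compact, Fl --> (g : G -> C)}.
    apply/fam_cvgP => L cL P /uniform_nbhs[E [entE EP]].
    move: entE; rewrite -entourage_ballE => -[d /= d0 hd].
    have dd : d = rc (Cre d) by move: d0; rewrite ltcE => /andP[/eqP]; case: (d) => a b /= ->.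
    exists L => //; exists (Cre d); first by move: d0; rewrite ltcE => /andP[].
    move=> h hh; apply: EP => y Ly; apply: (hd (g y, h y)).
    by rewrite /ball /= nrmE dd ltcR nrmBC; exact: hh.
  move=> /(_ W); case; first by apply: open_nbhs_nbhs; split.
  by move=> L cL [e e0 hL]; exists L => //; exists e => // h hh; apply: UV; exact: hL.
move=> [L cL [e e0 he]].
pose E := [set xy : C * C | nrm (xy.2 - xy.1) < e].
have entE : entourage E.
  rewrite -entourage_ballE; exists (rc e); first by rewrite /= ltcR.
  by move=> [a b] /=; rewrite /ball /= nrmE ltcR nrmBC.
have := @fam_nbhs _ _ compact L E (hol_fun g : {family compact, G -> C}) entE cL.
move=> /(@initial_continuous _ {family compact, G -> C} (@hol_fun R G) g) nb.
by apply: (@filterS _ (nbhs g) (@nbhs_filter (hol G) g) _ _ _ nb) => h hh; exact: he.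
Qed.

End bridge.

(** * The universal family and its closed span *)

Section taylor_coefficients.
Context {R : realType}.
Local Notation C := (R[i]^o).
Implicit Types (f h : C -> C) (w z : C).

Definition disc z (r : R) : set C := [set w | nrm (w - z) <= r].

Lemma hull_disc z r : hull (disc z r) `<=` disc z r.
Proof.
move=> b /(_ ('X - z%:P) r); rewrite hornerXsubC; apply => w; rewrite hornerXsubC; exact.
Qed.

Lemma compact_disc z r : compact (disc z r).
Proof.
apply/compactP; split.
  apply/closedP => w /negP; rewrite -ltNge => hw.
  exists (nrm (w - z) - r) => [|v hv]; first by rewrite subr_gt0.
  apply/negP; rewrite -ltNge; have := nrm_tri v w z; rewrite (nrmBC w v); lra.
exists (nrm z + r) => w hw; have := nrm_sub w z; move: hw; rewrite /disc /=; lra.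
Qed.

Lemma functional_lsum (S : set C) L n (u : nat -> C) (f : nat -> C -> C) :
  functional S L -> (forall j, contS S (f j)) ->
  contS S (fun w => \sum_(j < n) u j * f j w) /\
  L (fun w => \sum_(j < n) u j * f j w) = \sum_(j < n) u j * L (f j).
Proof.
move=> fL cf; elim: n => [|n [IHc IH]].
  rewrite (_ : (fun w => _) = fun=> 0); last by apply/funext => w; rewrite big_ord0.
  split; first exact: contS_cst.
  rewrite big_ord0 -[RHS](mul0r (L (fun=> 0))) -(functionalZ _ fL (@contS_cst _ _ _)).
  by congr L; apply/funext => w; rewrite mul0r.
rewrite (_ : (fun w => _) = fun w => \sum_(j < n) u j * f j w + u n * f n w); last first.
  by apply/funext => w; rewrite big_ord_recr.
have cn : contS S (fun w => u n * f n w) by apply: contSM => //; exact: contS_cst.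
split; first exact: contSD.
by rewrite (functionalD fL)// (functionalZ _ fL)// IH big_ord_recr.
Qed.

Variables (z0 : C) (s : R).
Hypothesis s0 : 0 < s.

Definition basis (j : nat) : C -> C := fun w => ((rc s)^-1 * (w - z0)) ^+ j.
(** Cauchy's integral for the Taylor coefficient of index [l] at [z0] in the variable (w - z0) /
    s. *)
Definition coef (l : nat) (h : C -> C) : C :=
  wind^-1 * sqint z0 s (fun w => h w * (rc s ^+ l / (w - z0) ^+ l.+1)).

Let fL := @functional_sq R z0 s s0.

Let nz w : sqframe z0 s w -> w - z0 != 0.
Proof. by move=> /sqframe_nrm h; rewrite -nrm_gt0; exact: lt_le_trans h. Qed.

Let rcs : rc s != 0 :> C.
Proof. by rewrite -nrm_gt0 nrm_real gtr0_norm. Qed.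

Let cz : contS (sqframe z0 s) (fun w => w - z0).
Proof. by apply: contSB; [exact: contS_id|exact: contS_cst]. Qed.

Let ck l : contS (sqframe z0 s) (fun w => rc s ^+ l / (w - z0) ^+ l.+1).
Proof.
apply: contSM; first exact: contS_cst.
by apply: contSV; [move=> w fw; rewrite expf_neq0// nz|exact: contSX].
Qed.

Lemma contS_basis S j : contS S (basis j).
Proof.
apply: contSX; apply: contSM; first exact: contS_cst.
by apply: contSB; [exact: contS_id|exact: contS_cst].
Qed.

(** On the frame |w - z0| >= s, so the normalised kernel is at most 1 / s whatever [l] is: this
    makes [Ca] uniform in [l]. *)
Lemma coef_functional : exists2 Ca : R, 0 < Ca & forall l, functional (sqframe z0 s) (coef l) /\
  forall h M, 0 <= M -> contS (sqframe z0 s) h ->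
    (forall w, sqframe z0 s w -> nrm (h w) <= M) -> nrm (coef l h) <= Ca * M.
Proof.
have [h1 h2 [B B0 hB]] := fL.
pose Ca := nrm (wind^-1 : C) * (B * s^-1) + 1.
have B0' : 0 <= nrm (wind^-1 : C) * (B * s^-1).
  by rewrite mulr_ge0 ?nrm_ge0// mulr_ge0// invr_ge0 ltW.
have Ca0 : 0 < Ca by rewrite ltr_wpDl.
have bnd l h M : 0 <= M -> contS (sqframe z0 s) h ->
    (forall w, sqframe z0 s w -> nrm (h w) <= M) -> nrm (coef l h) <= Ca * M.
  move=> M0 ch hM; rewrite nrmM; apply: (@le_trans _ _ (nrm (wind^-1 : C) * (B * (M * s^-1)))).
    apply: ler_wpM2l; first exact: nrm_ge0.
    apply: hB; first by rewrite mulr_ge0// invr_ge0 ltW.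
      exact: contSM.
    move=> w fw; rewrite nrmM; apply: ler_pM; rewrite ?nrm_ge0 ?hM//.
    have ws := sqframe_nrm fw; rewrite nrmM nrmV !nrmX nrm_real gtr0_norm// exprS invfM.
    rewrite mulrCA mulrC -[leRHS]mul1r; apply: ler_pM.
    - by rewrite divr_ge0 ?exprn_ge0 ?nrm_ge0// ltW.
    - by rewrite invr_ge0 nrm_ge0.
    - rewrite ler_pdivrMr ?exprn_gt0//; last exact: lt_le_trans ws.
      by rewrite mul1r; apply: lerXn2r => //; rewrite nnegrE ?nrm_ge0 ?ltW.
    - by rewrite lef_pV2 ?posrE//; exact: lt_le_trans ws.
  rewrite (_ : _ * _ = (nrm (wind^-1 : C) * (B * s^-1)) * M); last by ring.
  by rewrite ler_wpM2r// lerDl.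
exists Ca => // l; split; last exact: bnd.
split => [f g cf cg|c f cf|].
- rewrite /coef -mulrDr -(functionalD fL); [|exact: contSM..].
  by congr (_ * sqint _ _ _); apply/funext => w; rewrite mulrDl.
- rewrite /coef mulrCA -(@functionalZ _ _ _ c (fun w => f w * (rc s ^+ l / (w - z0) ^+ l.+1)) fL).
    by congr (_ * sqint _ _ _); apply/funext => w; rewrite mulrA.
  exact: contSM.
- by exists Ca; [exact: ltW|exact: bnd].
Qed.

Lemma sqint_inv_pow k : sqint z0 s (fun w => ((w - z0)^-1) ^+ k.+2) = 0.
Proof.
apply: (@rect_ftc _ _ _ _ _ _ (fun w => - k.+1%:R^-1 * ((w - z0)^-1) ^+ k.+1)).
- exact: sq_le.
- exact: sq_le.
- by apply: contSX; apply: contSV => //; exact: nz.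
move=> w fw; have d1 := cderiv_kernel1 (inner_frame (@sqinner_center _ z0 s s0) fw).
have := cderivZ (- k.+1%:R^-1) (cderiv_comp d1 (cderivX k.+1 ((w - z0)^-1))).
congr (cderiv _ _ _); rewrite /= !exprS.
have k0 : k.+1%:R != 0 :> C by rewrite pnatr_eq0.
by move: (nz fw) => w0; set X := (w - z0)^-1; field.
Qed.

(** For j < l the integrand has a primitive, for j > l it is holomorphic in the square, and for j =
    l it is 1 / (w - z0). *)
Lemma coef_basis l j : coef l (basis j) = (j == l)%:R.
Proof.
have cb : contS (sqframe z0 s) (fun w => basis j w * (rc s ^+ l / (w - z0) ^+ l.+1)).
  by apply: contSM => //; exact: contS_basis.
rewrite /coef; case: (ltngtP j l) => [jl|lj|->].
- rewrite (@functional_ext _ _ _ _ (fun w => (rc s)^-1 ^+ j * rc s ^+ l *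
     ((w - z0)^-1) ^+ (l - j).-1.+2) fL cb).
  + rewrite (functionalZ _ fL); first by rewrite sqint_inv_pow !mulr0.
    by apply: contSX; apply: contSV => //; exact: nz.
  + apply: contSM; first exact: contS_cst.
    by apply: contSX; apply: contSV => //; exact: nz.
  + move=> w /nz w0; rewrite prednK ?subn_gt0//.
    have -> : l.+1 = (j + (l - j).+1)%N by rewrite addnS subnKC// ltnW.
    rewrite /basis exprMn exprD; have := expf_neq0 j w0; have := expf_neq0 (l - j).+1 w0.
    rewrite [((w - z0)^-1) ^+ _]exprVn.
    set b := (rc s)^-1 ^+ j; set X := (w - z0) ^+ j; set Y := (w - z0) ^+ _.
    by set a := rc s ^+ _ => Y0 X0; field; rewrite X0 Y0.
- rewrite (@functional_ext _ _ _ _ (fun w => (rc s)^-1 ^+ j * rc s ^+ l *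
     (w - z0) ^+ (j - l.+1)) fL cb).
  + rewrite /sqint goursat ?mulr0//; try exact: sq_le.
    move=> w _; eexists; apply: cderivZ.
    apply: (@cderiv_comp _ (fun w => w - z0) (fun v => v ^+ _)); last exact: cderivX.
    by apply: cderivB; [exact: cderiv_id|exact: cderiv_cst].
  + by apply: contSM; [exact: contS_cst|exact: contSX].
  + move=> w /nz w0; rewrite /basis exprMn.
    have -> : (w - z0) ^+ j = (w - z0) ^+ l.+1 * (w - z0) ^+ (j - l.+1) by rewrite -exprD subnKC.
    have := expf_neq0 l.+1 w0; set b := (rc s)^-1 ^+ j; set a := rc s ^+ l.
    set X := (w - z0) ^+ l.+1; set Y := (w - z0) ^+ _ => X0.
    by field; exact: X0.
- rewrite (@functional_ext _ _ _ _ (fun w => (w - z0)^-1) fL).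
  + by rewrite /sqint rect_wind ?mulVf ?wind_neq0//; exact: sqinner_center.
  + by apply: contSM => //; exact: contS_basis.
  + by apply: contSV => //; exact: nz.
  + move=> w /nz w0; rewrite /basis exprMn exprVn exprS.
    have := expf_neq0 l w0; have := expf_neq0 l rcs; set X := (w - z0) ^+ l.
    by set Y := rc s ^+ l => Y0 X0; field; rewrite w0 X0 Y0.
Qed.

Lemma sum_half m : \sum_(j < m) (2^-1 ^+ j : R) <= 2.
Proof.
suff -> : \sum_(j < m) (2^-1 ^+ j : R) = 2 - 2 * 2^-1 ^+ m.
  by rewrite gerBl mulr_ge0// exprn_ge0// invr_ge0.
elim: m => [|m IH]; first by rewrite big_ord0 expr0; ring.
by rewrite big_ord_recr /= IH exprS; field.
Qed.

(* If all coefficients are at most M, then the perturbation changes the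
   functionals [coef l] by at most M / 2, so that M can be improved to
   [Ca * S + M / 2]; iterate. *)
Lemma coef_estimate : exists2 Ca : R, 0 < Ca & forall (F : nat -> C -> C),
  (forall j, contS (sqframe z0 s) (F j)) ->
  (forall j w, sqframe z0 s w -> nrm (F j w - basis j w) <= (4 * Ca)^-1 * 2^-1 ^+ j) ->
  forall m (u : nat -> C) (S : R), 0 <= S ->
    (forall w, sqframe z0 s w -> nrm (\sum_(j < m) u j * F j w) <= S) ->
    forall j, (j < m)%N -> nrm (u j) <= 2 * Ca * S.
Proof.
have [Ca Ca0 hCa] := coef_functional; exists Ca => // F cF hF m u S S0 hS.
have step M : 0 <= M -> (forall j, (j < m)%N -> nrm (u j) <= M) ->
    forall l, (l < m)%N -> nrm (u l) <= Ca * S + M / 2.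
  move=> M0 hM l lm; have [fl bl] := hCa l.
  have [cs E] := functional_lsum m u fl cF.
  have Fd j : coef l (F j) = (j == l)%:R + coef l (fun w => F j w - basis j w).
    have cb : contS (sqframe z0 s) (basis j) by exact: contS_basis.
    by rewrite (functionalB fl)// coef_basis addrC subrK.
  have dB j : nrm (coef l (fun w => F j w - basis j w)) <= 4^-1 * 2^-1 ^+ j.
    have cb : contS (sqframe z0 s) (basis j) by exact: contS_basis.
    apply: le_trans (bl _ _ _ _ (hF j)) _.
    - by rewrite mulr_ge0 ?invr_ge0 ?exprn_ge0 ?invr_ge0// mulr_ge0// ltW.
    - exact: contSB.
    - by rewrite invfM mulrA mulrCA mulfV ?mulr1// gt_eqF.
  (* By biorthogonality only the perturbation couples the coefficients, and it contributes at most M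
     (1/4) times the sum of the 2^-j, that is M / 2. *)
  have uE : u l = coef l (fun w => \sum_(j < m) u j * F j w)
      - \sum_(j < m) u j * coef l (fun w => F j w - basis j w).
    rewrite E -sumrB (bigD1 (Ordinal lm))//= Fd eqxx big1 ?addr0 => [|j jl].
      by rewrite mulrDr mulr1 addrK.
    rewrite Fd; have -> : (j : nat) == l = false by apply/negbTE; rewrite -val_eqE in jl.
    by rewrite add0r subrr.
  rewrite uE; apply: le_trans (nrmB _ _) _; apply: lerD; first exact: bl.
  apply: le_trans (nrm_sum _ _ _) _.
  apply: (@le_trans _ _ (\sum_(j < m) M * (4^-1 * 2^-1 ^+ j))).
    by apply: ler_sum => j _; rewrite nrmM; apply: ler_pM; rewrite ?nrm_ge0 ?hM.
  rewrite -mulr_sumr -mulr_sumr; apply: ler_wpM2l => //.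
  by have := sum_half m; lra.
pose M := \sum_(j < m) nrm (u j).
have M0 : 0 <= M by apply: sumr_ge0 => j _; exact: nrm_ge0.
have base j : (j < m)%N -> nrm (u j) <= M.
  move=> jm; rewrite /M (bigD1 (Ordinal jm))//= lerDl; apply: sumr_ge0 => i _; exact: nrm_ge0.
have it k j : (j < m)%N -> nrm (u j) <= 2 * Ca * S + M / 2 ^+ k.
  elim: k j => [|k IH] j jm.
    rewrite expr0 divr1; apply: le_trans (base j jm) _.
    by rewrite lerDr !mulr_ge0// ltW.
  have p : 0 <= 2 * Ca * S + M / 2 ^+ k.
    by rewrite addr_ge0 ?divr_ge0 ?exprn_ge0// !mulr_ge0// ltW.
  apply: le_trans (step _ p IH j jm) _; rewrite exprSr invfM mulrA; lra.
move=> j jm; apply/ler_addgt0Pr => e e0; have [k hk] := ex_pow2_lt M e0.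
by apply: le_trans (it k j jm) _; rewrite lerD2l ltW.
Qed.

End taylor_coefficients.

Section universal_family.
Context {R : realType}.
Local Notation C := (R[i]^o).

(** Lists of rational pairs, constant coefficient first: a countable type of codes for a dense set
    of polynomials. *)
Definition ratpoly (s : seq (rat * rat)) : {poly C} :=
  foldr (fun q p => p * 'X + (Complex (ratr q.1) (ratr q.2))%:P) 0 s.

Lemma ratr_near (x e : R) : 0 < e -> exists q : rat, `|x - ratr q| <= e.
Proof.
move=> e0; have [q] : exists q, ratr q \in `]x - e, x + e[ by apply: rat_in_itvoo; lra.
by rewrite in_itv /= => /andP[h1 h2]; exists q; rewrite ler_norml; apply/andP; split; lra.
Qed.

Lemma ratpoly_dense (p : {poly C}) (B e : R) : 0 < e ->
  exists s, forall z : C, nrm z <= B -> nrm (p.[z] - (ratpoly s).[z]) <= e.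
Proof.
elim/poly_ind: p e => [|p c IH] e e0.
  by exists [::] => z _; rewrite subrr nrm0 ltW.
have B0 : 0 < `|B| + 1 by rewrite ltr_pwDr.
have e2 : 0 < e / 2 / (`|B| + 1) by rewrite !divr_gt0.
have [s hs] := IH _ e2.
have e4 : 0 < e / 4 by rewrite divr_gt0.
have [a ha] := ratr_near (Cre c) e4; have [b hb] := ratr_near (Cim c) e4.
exists ((a, b) :: s) => z zB; rewrite /= -/(ratpoly s) !hornerMXaddC.
have -> : p.[z] * z + c - ((ratpoly s).[z] * z + Complex (ratr a) (ratr b)) =
    (p.[z] - (ratpoly s).[z]) * z + (c - Complex (ratr a) (ratr b)) :> C by ring.
apply: le_trans (nrmD _ _) _; rewrite nrmM.
have h1 : nrm (c - Complex (ratr a) (ratr b)) <= e / 2.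
  apply: le_trans (nrm_ReIm _) _; case: (c) ha hb => x y /= ha hb; lra.
have h2 : nrm (p.[z] - (ratpoly s).[z]) * nrm z <= e / 2.
  apply: (@le_trans _ _ (e / 2 / (`|B| + 1) * (`|B| + 1))); last by rewrite divfK ?gt_eqF.
  apply: ler_pM; rewrite ?nrm_ge0 ?hs//; have := ler_norm B; lra.
lra.
Qed.

Context {G : set C} (oG : open G) (sG : simply_connected G) (phi : nat -> G -> G)
  (hphi : forall n, holomorphic (set_val \o phi n)) (uphi : forall n, injective (phi n))
  (K : nat -> set G) (A : nat -> set nat).
Hypothesis cK : forall nu, compl_connected_compact (K nu).
Hypothesis tE : trivIset [set p : nat * nat | A p.2 p.1] (fun p => phi p.1 @` K p.2).
Hypothesis lf : forall L : set G, compact L ->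
  finite_set [set p : nat * nat | A p.2 p.1 /\ L `&` phi p.1 @` K p.2 !=set0].

Let phiC n : C -> C := ext (set_val \o phi n).

Let phiCE n x : phiC n (set_val x) = set_val (phi n x). Proof. exact: extE. Qed.

Let E (p : nat * nat) : set C := phiC p.1 @` (set_val @` K p.2).

Let holo_phiC n : holo G (phiC n). Proof. by apply/holomorphicP; exact: hphi. Qed.

Let inj_phiC n z w : G z -> G w -> phiC n z = phiC n w -> z = w.
Proof.
move=> /valG_ex[x <-] /valG_ex[y <-]; rewrite !phiCE => h.
by congr (set_val _); apply: (@uphi n); exact: val_inj.
Qed.

Let KG nu : (set_val @` K nu : set C) `<=` G.
Proof. by move=> _ [x _ <-]; exact: set_valG. Qed.

Let univ n nu := univalent_hull oG sG (@holo_phiC n) (@inj_phiC n)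
  (compact_set_val (cK nu).1) (@KG nu)
  (hull_compl_connected (compact_set_val (cK nu).1) (cK nu).2).

Let EP p z : E p z -> exists2 x, K p.2 x & z = set_val (phi p.1 x).
Proof. by move=> [_ [x Kx <-] <-]; exists x; rewrite ?phiCE. Qed.

Let compactE p : compact (E p).
Proof.
apply: compact_image; first exact: compact_set_val (cK _).1.
exact: contS_sub (@KG _) (holo_contS (@holo_phiC _)).
Qed.

(* Carleman approximation on the disc and on those [E (n, nu)] that do not meet
   it; the other n are the finitely many elements of X. *)
Lemma universal_family (z0 : C) (s eta : R) (dec : nat -> nat * {poly C}) :
  disc z0 s `<=` G -> 0 < eta -> forall b : nat -> {poly C},
  exists F : nat -> C -> C,
  [/\ forall l, holo G (F l),
      forall l w, disc z0 s w -> nrm (F l w - (b l).[w]) <= eta * 2^-1 ^+ l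
    & forall nu, exists2 X : set nat, finite_set X & forall n, A nu n -> ~ X n ->
        forall x, K nu x -> forall l,
          nrm (F l (set_val (phi n x)) -
               (if (dec nu).1 == l then (dec nu).2.[set_val x] else 0)) <= 2^-1 ^+ (l + nu)].
Proof.
move=> BG eta0 b; pose B := disc z0 s.
have cB : compact B by exact: compact_disc.
(* [None] indexes the disc and [Some p] the set [E p] when it avoids the disc, so that one use of
   [carleman] handles all the targets. *)
pose D (o : option (nat * nat)) := if o is Some p then A p.2 p.1 /\ E p `&` B = set0 else True.
pose Es (o : option (nat * nat)) := if o is Some p then E p else B.
have cEs o : D o -> compact (Es o) by case: o => [p|] _; [exact: compactE|exact: cB].
have hEs o : D o -> hull (Es o) `<=` Es o.
  by case: o => [p|] _ /=; [exact: (univ p.1 p.2).1|exact: hull_disc].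
have tEs : trivIset D Es.
  move=> [p|] [q|] Dp Dq [z []] //=.
  - move=> /EP[x Kx zx] /EP[y Ky zy]; congr Some; apply: tE; [exact: Dp.1|exact: Dq.1|].
    exists (phi p.1 x); split; first by exists x.
    by exists y => //; apply: val_inj; move: zx zy => -> /esym.
  - by move=> Ez Bz; case: Dp => _ /seteqP[/(_ z) + _] => /(_ (conj Ez Bz)).
  - by move=> Bz Ez; case: Dq => _ /seteqP[/(_ z) + _] => /(_ (conj Ez Bz)).
have EG o : D o -> Es o `<=` G.
  case: o => [p|] _ //= _ /EP[x _ ->]; exact: set_valG.
have lfs L : compact L -> L `<=` G -> finite_set [set o | D o /\ Es o `&` L !=set0].
  move=> cL LG; have := lf (compact_preimage_val cL LG).
  set P := (X in finite_set X) => fP.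
  apply: (@sub_finite_set _ _ (Some @` P `|` [set None])); last first.
    by rewrite finite_setU; split; [exact: finite_image|exact: finite_set1].
  move=> [p|] [Dp [z [Ez Lz]]]; last by right.
  left; exists p => //; split; first exact: Dp.1.
  by case/EP: Ez Lz => x Kx -> Lz; exists (phi p.1 x); split => //; exists x.
have main l : exists F : C -> C, [/\ holo G F,
    forall w, B w -> nrm (F w - (b l).[w]) <= eta * 2^-1 ^+ l &
    forall n nu, A nu n -> E (n, nu) `&` B = set0 -> forall x, K nu x ->
          nrm (F (set_val (phi n x)) -
               (if (dec nu).1 == l then (dec nu).2.[set_val x] else 0)) <= 2^-1 ^+ (l + nu)].
  have ht (p : nat * nat) : exists t : C -> C, papprox (E p) t /\
      forall x, K p.2 x -> t (set_val (phi p.1 x)) =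
                   if (dec p.2).1 == l then (dec p.2).2.[set_val x] else 0.
    have [t [th ta]] := (univ p.1 p.2).2 (if (dec p.2).1 == l then (dec p.2).2 else 0).
    exists t; split => // x Kx; rewrite -phiCE th; last by exists x.
    by case: ifP => // _; rewrite horner0.
  have [t /all_and2[ta th]] := choice ht.
  pose ts (o : option (nat * nat)) := if o is Some p then t p else horner (b l).
  pose r (o : option (nat * nat)) : R := if o is Some p then 2^-1 ^+ (l + p.2) else eta * 2^-1 ^+ l.
  have [//||F [hF FE]] := @carleman _ _ D Es cEs hEs tEs G oG sG EG lfs ts r.
  - move=> [p|] _ //= e e0; exists (b l) => z _; by rewrite subrr nrm0 ltW.
  - by move=> [p|] _ /=; rewrite ?mulr_gt0// exprn_gt0// invr_gt0.
  exists F; split => // [w Bw|n nu An dn x Kx]; first exact: FE None w I Bw.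
  rewrite -(th (n, nu) x Kx); apply: FE (Some (n, nu)) _ (conj An dn) _.
  by exists (set_val x); [exists x|rewrite phiCE].
have [F /all_and3[h1 h2 h3]] := choice main.
exists F; split => // nu.
(* These n were left out of [D]; local finiteness applied to the disc makes them finitely many. *)
exists [set n | A nu n /\ E (n, nu) `&` B !=set0].
  have := finite_image fst (lf (compact_preimage_val cB BG)); apply: sub_finite_set.
  move=> n [An [z [Ez Bz]]]; exists (n, nu) => //; split => //.
  by case/EP: Ez Bz => x Kx -> Lz; exists (phi n x); split => //; exists x.
move=> n An nX x Kx l; apply: h3 => //; apply/eqP/negPn/negP => /set0P h; exact: nX.
Qed.

End universal_family.

(** * The closed span is a closed subspace of infinite dimension *)

Section closed_span.
Context {R : realType}.
Local Notation C := (R[i]^o).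
Context {G : set C} (F : nat -> C -> C).
Hypothesis hF : forall l, holo G (F l).

(** A polynomial serves here only as a finitely supported sequence of coefficients, for its linear
    structure. *)
Definition comb (p : {poly C}) (z : C) : C := \sum_(j < size p) p`_j * F j z.

Lemma comb_widen n (p : {poly C}) z : (size p <= n)%N -> comb p z = \sum_(j < n) p`_j * F j z.
Proof.
move=> pn; rewrite /comb (big_ord_widen n (fun j => p`_j * F j z))// big_mkcond /=.
apply: eq_bigr => j _; case: ltnP => // h.
by rewrite nth_default// mul0r.
Qed.

Lemma combD p q z : comb (p + q) z = comb p z + comb q z.
Proof.
have s1 := leq_maxl (size p) (size q); have s2 := leq_maxr (size p) (size q).
rewrite (comb_widen _ s1) (comb_widen _ s2) (comb_widen _ (size_polyD p q)).
by rewrite -big_split; apply: eq_bigr => j _; rewrite coefD mulrDl.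
Qed.

Lemma combZ a p z : comb (a *: p) z = a * comb p z.
Proof.
rewrite (comb_widen _ (size_scale_leq a p)) mulr_sumr.
by apply: eq_bigr => j _; rewrite coefZ mulrA.
Qed.

Lemma combB p q z : comb (p - q) z = comb p z - comb q z.
Proof. by rewrite -scaleN1r combD combZ mulN1r. Qed.

Lemma combXn l z : comb 'X^l z = F l z.
Proof.
rewrite /comb size_polyXn big_ord_recr /= coefXn eqxx mul1r big1 ?add0r// => j _.
by rewrite coefXn (ltn_eqF (ltn_ord j)) mul0r.
Qed.

Definition closed_span : set (hol G) := [set f | forall L : set C, compact L -> L `<=` G ->
  forall e : R, 0 < e -> exists p, forall z, L z -> nrm (ext f z - comb p z) <= e].

Lemma ext_lin a (f g : hol G) z : G z -> ext (a *: f + g : hol G) z = a * ext f z + ext g z.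
Proof. by move=> /valG_ex[x <-]; rewrite !extE. Qed.

Lemma submod_closed_span : submod_closed (mem closed_span).
Proof.
split=> [|a f g]; rewrite ?inE.
  move=> L cL LG e e0; exists 0 => z /LG/valG_ex[x <-].
  by rewrite extE /comb size_poly0 big_ord0 subr0 nrm0 ltW.
move=> Mf Mg L cL LG e e0.
have a0 : 0 < nrm a + 1 by rewrite ltr_wpDl// nrm_ge0.
have [|p hp] := Mf L cL LG (e / 2 / (nrm a + 1)); first by rewrite !divr_gt0.
have [|q hq] := Mg L cL LG (e / 2); first by rewrite divr_gt0.
exists (a *: p + q) => z Lz; rewrite ext_lin; last exact: LG.
rewrite combD combZ (_ : _ - _ = a * (ext f z - comb p z) + (ext g z - comb q z)); last by ring.
apply: le_trans (nrmD _ _) _; rewrite nrmM.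
have h1 : nrm a * nrm (ext f z - comb p z) <= e / 2.
  apply: (@le_trans _ _ ((nrm a + 1) * (e / 2 / (nrm a + 1)))); last by rewrite mulrC divfK ?gt_eqF.
  by apply: ler_pM; rewrite ?nrm_ge0 ?hp// lerDl.
have := hq z Lz; lra.
Qed.

Lemma closed_closed_span : closed closed_span.
Proof.
move=> f cf L cL LG e e0; have e2 : 0 < e / 2 by rewrite divr_gt0.
have [] := cf [set h | forall x : G, (set_val @^-1` L) x -> nrm (h x - f x) < e / 2].
  apply/hol_nbhsP; exists (set_val @^-1` L : set G); first exact: compact_preimage_val.
  by exists (e / 2).
move=> h [Mh hf]; have [p hp] := Mh L cL LG (e / 2) e2; exists p => z Lz.
have [x xz] := valG_ex (LG _ Lz); have := hp z Lz; have := hf x.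
rewrite /= xz => /(_ Lz) h1 h2; have := nrm_tri (ext h z) (ext f z) (comb p z).
have : nrm (ext f z - ext h z) < e / 2 by rewrite -xz !extE nrmBC.
lra.
Qed.

Hypothesis oG : open G.

Lemma span_mem l : closed_span (mkhol oG (@hF l)).
Proof.
move=> L cL LG e e0; exists 'X^l => z /LG/valG_ex[x <-].
by rewrite combXn extE mkholE subrr nrm0 ltW.
Qed.

Context {z0 : C} {s Ca : R}.
Hypothesis BG : disc z0 (2 * s) `<=` G.
Hypothesis Ca0 : 0 < Ca.
Hypothesis coefs : forall (m : nat) (u : nat -> C) (S : R), 0 <= S ->
  (forall w, sqframe z0 s w -> nrm (\sum_(j < m) u j * F j w) <= S) ->
  forall j, (j < m)%N -> nrm (u j) <= 2 * Ca * S.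

Let frameB : sqframe z0 s `<=` disc z0 (2 * s).
Proof. by move=> w /sqframe_box/sqbox_nrm. Qed.

Lemma comb_coef (p : {poly C}) (S : R) : 0 <= S ->
  (forall w, disc z0 (2 * s) w -> nrm (comb p w) <= S) -> forall j, nrm p`_j <= 2 * Ca * S.
Proof.
move=> S0 hS j; have [jp|pj] := ltnP j (size p); last first.
  by rewrite nth_default// nrm0 !mulr_ge0// ltW.
by apply: (coefs S0 _ jp) => w /frameB; exact: hS.
Qed.

(** If n vectors spanned, n + 1 of the [F l] would satisfy a nontrivial relation, read off the
    kernel of an (n + 1) x n matrix; [comb_coef] with bound 0 forces all its coefficients to
    vanish. *)
Lemma infinite_dim_span : ~ finite_dimensional closed_span.
Proof.
move=> [n [b [_ hb]]]; have [c hc] := choice (fun l => hb _ (@span_mem l)).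
pose A : 'M[C]_(n.+1, n) := \matrix_(i, j) c i j.
have : kermx A != 0.
  rewrite kermx_eq0 /row_free neq_ltn; apply/orP; left.
  by apply: (@leq_ltn_trans n); rewrite ?rank_leq_col.
move=> /rowV0Pn[v /sub_kermxP vA v0].
pose p : {poly C} := \poly_(i < n.+1) v ord0 (inord i).
have p0 w : G w -> comb p w = 0.
  move=> /valG_ex[x <-]; rewrite (comb_widen _ (size_poly _ _)).
  transitivity ((\sum_(i < n.+1) v ord0 i *: mkhol oG (@hF i) : hol G) x).
    have -> : forall I (r : seq I) (f : I -> hol G), (\sum_(i <- r) f i : hol G) x = \sum_(i <- r) f i x.
      by move=> I r f; elim: r => [|i r IH]; rewrite ?big_nil// !big_cons -IH.
    by apply: eq_bigr => i _; rewrite coef_poly ltn_ord inord_val.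
  under eq_bigr do rewrite hc scaler_sumr.
  rewrite exchange_big big1//= => j _; under eq_bigr do rewrite scalerA.
  rewrite -scaler_suml.
  rewrite (_ : \sum_(i < n.+1) _ = 0) ?scale0r//; have /matrixP/(_ ord0 j) := vA.
  by rewrite !mxE; apply: etrans; apply: eq_bigr => i _; rewrite mxE.
move/eqP: v0; apply; apply/rowP => i; rewrite mxE.
have := @comb_coef p 0 (lexx _) _ i; rewrite mulr0 coef_poly ltn_ord inord_val => h.
by apply/eqP; rewrite -nrm_eq0 eq_le nrm_ge0 andbT; apply: h => w /BG/p0 ->; rewrite nrm0.
Qed.

End closed_span.

(** * Coefficients of the elements of the closed span *)

Section expansion.
Context {R : realType}.
Local Notation C := (R[i]^o).
Context {G : set C} (F : nat -> C -> C).

(** The tolerances decrease like 2^-j and the coefficients are bounded, so the total error does not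
    depend on the length of [p]; 2 bounds the geometric sum. *)
Lemma comb_near (p : {poly C}) (w : C) (A B : R) (t : nat -> C) : 0 <= B ->
  (forall j, nrm p`_j <= A) -> (forall j, nrm (F j w - t j) <= B * 2^-1 ^+ j) ->
  nrm (comb F p w - \sum_(j < size p) p`_j * t j) <= 2 * (A * B).
Proof.
move=> B0 hA hB; have A0 : 0 <= A := le_trans (nrm_ge0 _) (hA 0%N).
rewrite /comb -sumrB; apply: le_trans (nrm_sum _ _ _) _.
apply: (@le_trans _ _ (\sum_(j < size p) A * (B * 2^-1 ^+ j))).
  by apply: ler_sum => j _; rewrite -mulrBr nrmM; apply: ler_pM; rewrite ?nrm_ge0.
rewrite -mulr_sumr -mulr_sumr mulrA mulrC.
by apply: ler_wpM2r; [exact: mulr_ge0|exact: sum_half].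
Qed.

Lemma sum_coef_delta (p : {poly C}) (l : nat) (q : C) :
  \sum_(j < size p) p`_j * (if l == j then q else 0) = p`_l * q.
Proof.
have [lp|pl] := ltnP l (size p).
  rewrite (bigD1 (Ordinal lp))//= eqxx big1 ?addr0// => j jl.
  rewrite ifF ?mulr0//; apply/negbTE; rewrite eq_sym; exact: jl.
rewrite nth_default// mul0r big1// => j _.
by rewrite gtn_eqF ?mulr0//; exact: leq_trans pl.
Qed.

Lemma kexh_le k m : (k <= m)%N -> kexh G k `<=` kexh G m.
Proof.
move=> km z [h1 h2]; split; first by apply: le_trans h1 _; rewrite ler_nat.
by move=> w /h2; apply: le_trans; rewrite lef_pV2 ?posrE// ler_nat.
Qed.

Hypotheses (oG : open G) (cG : connected G).
Context {z0 : C} {s Ca eta : R}.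
Hypothesis s0 : 0 < s.
Hypothesis BG : disc z0 (2 * s) `<=` G.
Hypothesis Ca0 : 0 < Ca.
Hypothesis coefs : forall (m : nat) (u : nat -> C) (S : R), 0 <= S ->
  (forall w, sqframe z0 s w -> nrm (\sum_(j < m) u j * F j w) <= S) ->
  forall j, (j < m)%N -> nrm (u j) <= 2 * Ca * S.
Hypothesis eta0 : 0 < eta.
Hypothesis Fb : forall l w, disc z0 (2 * s) w -> nrm (F l w - basis z0 s l w) <= eta * 2^-1 ^+ l.

Let ccoef := @comb_coef R F z0 s Ca Ca0 coefs.

(* The coefficients of the combinations approximating f converge, to the c of
   the conclusion for index l; they do not all tend to 0, since otherwise f
   would vanish near [z0]. *)
Lemma span_expansion (f : hol G) : closed_span F f -> f != 0 ->
  exists l c (A : R), [/\ c != 0, 0 < A & forall w, G w -> forall (q : C) (d : R), 0 <= d ->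
    (forall j, nrm (F j w - (if l == j :> nat then q else 0)) <= d * 2^-1 ^+ j) ->
    nrm (ext f w - c * q) <= A * d].
Proof.
move=> Mf f0; pose B := disc z0 (2 * s).
have cB : compact B by exact: compact_disc.
have half k : 0 < (2 ^+ k : R)^-1 by rewrite invr_gt0 exprn_gt0.
(* The disc is there to control the coefficients of [p k], the sets [kexh G k] to reach every point
   of [G]. *)
have /choice[p hp] : forall k, exists p, forall z, (B `|` kexh G k) z ->
    nrm (ext f z - comb F p z) <= (2 ^+ k)^-1.
  move=> k; apply: Mf => //; first by apply: compactU => //; exact: compact_kexh.
  by move=> z [/BG//|/kexhG].
(* On the disc consecutive combinations differ by at most 2^-k + 2^-(k + 1), and [comb_coef] costs a
   factor 2 Ca. *)
have cauchy j k : nrm ((p k.+1)`_j - (p k)`_j) <= (4 * Ca) / 2 ^+ k.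
  rewrite -coefB (_ : _ / _ = 2 * Ca * (2 * (2 ^+ k)^-1)); last by ring.
  apply: ccoef; first by rewrite mulr_ge0// ltW.
  move=> w Bw; rewrite combB; have := nrm_tri (ext f w) (comb F (p k.+1) w) (comb F (p k) w).
  have := hp k w (or_introl Bw); have := hp k.+1 w (or_introl Bw).
  by rewrite (nrmBC (comb F (p k.+1) w) (ext f w)) exprS invfM; have := half k; lra.
have /choice[c hc] : forall j, exists l, forall k, nrm (l - (p k)`_j) <= 8 * Ca / 2 ^+ k.
  move=> j; have [l hl] := @geometric_limit _ _ (4 * Ca) 0%N (fun k _ => cauchy j k).
  by exists l => k; have := hl (4 * Ca) 0%N (fun k _ => cauchy j k) k isT; rewrite mulrA -natrM.
have [M M0 hM] := contS_bounded cB (contS_sub BG (holo_contS (@hol_holo _ _ f))).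
(* On the disc |f| <= M, so all the combinations are at most M + 1 there, whence a bound on their
   coefficients that is independent of k. *)
pose A0 := 2 * Ca * (M + 1).
have A00 : 0 < A0 by rewrite mulr_gt0 ?addr_gt0// mulr_gt0.
have hA0 k j : nrm (p k)`_j <= A0.
  apply: ccoef => [|w Bw]; first by rewrite addr_ge0// ltW.
  have := hp k w (or_introl Bw); have := hM w Bw.
  have : (2 ^+ k : R)^-1 <= 1 by rewrite invf_le1 ?exprn_gt0// exprn_ege1// ler1n.
  have := nrm_tri (ext f w) (comb F (p k) w) 0; rewrite !subr0 nrmBC; lra.
have [[l cl]|c0] := pselect (exists l, c l != 0); last first.
  exfalso; move/eqP: f0; apply; apply: hol_eq => x.
  rewrite -extE; apply: (@identity_theorem _ G (ext f) z0 oG cG (@hol_holo _ _ f) _ _ _ (set_valG x)).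
    by apply: BG; rewrite /disc /= subrr nrm0 mulr_ge0// ltW.
  (* At distance less than s / 2 from z0 the function of index j in the basis is at most 2^-j, so |F
     j w| <= (1 + eta) 2^-j and small coefficients yield a small sum. *)
  exists (s / 2) => [|w wz]; first by rewrite divr_gt0.
  have Bw : B w by apply: ltW; apply: lt_trans wz _; move: s0; lra.
  apply/eqP; rewrite -nrm_eq0 eq_le nrm_ge0 andbT; apply/ler_addgt0Pr => e e0.
  have [k hk] := ex_pow2_lt (1 + 16 * Ca * (1 + eta)) e0.
  have cp j : nrm (p k)`_j <= 8 * Ca / 2 ^+ k.
    have := hc j k; suff -> : c j = 0 by rewrite sub0r nrmN.
    by apply/eqP/negPn/negP => cj; apply: c0; exists j.
  have := @comb_near (p k) w _ (1 + eta) (fun=> 0) _ cp.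
  rewrite big1 => [|j _]; last by rewrite mulr0.
  rewrite subr0 => h.
  have {}h : nrm (comb F (p k) w) <= 2 * (8 * Ca / 2 ^+ k * (1 + eta)).
    apply: h => [|j]; first by rewrite addr_ge0// ltW.
    rewrite subr0; have := Fb j Bw; have := nrm_tri (basis z0 s j w) (F j w) 0.
    have : nrm (basis z0 s j w) <= 2^-1 ^+ j.
      rewrite /basis nrmX; apply: lerXn2r; rewrite ?nnegrE ?nrm_ge0 ?invr_ge0//.
      rewrite nrmM nrmV nrm_real gtr0_norm// mulrC ler_pdivrMr//; lra.
    rewrite !subr0; lra.
  have := hp k w (or_introl Bw); have := nrm_tri (comb F (p k) w) (ext f w) 0.
  rewrite !subr0 add0r => h1 h2; apply: ltW; apply: le_lt_trans hk.
  apply: le_trans h1 _.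
  rewrite (_ : (1 + _) / _ = (2 ^+ k)^-1 + 2 * (8 * Ca / 2 ^+ k * (1 + eta))); last by ring.
  exact: lerD.
exists l, (c l), (2 * A0); split => //; first by rewrite mulr_gt0.
move=> w Gw q d d0 hq; apply/ler_addgt0Pr => e e0.
have [k0 hk0] : exists k0, kexh G k0 w.
  have cw : compact (disc w 0) by exact: compact_disc.
  have [|m hm] := kexh_absorb oG cw; last by exists m; apply: hm; rewrite /disc /= subrr nrm0.
  move=> v; rewrite /disc /= => h; suff -> : v = w by [].
  by apply/eqP; rewrite -subr_eq0 -nrm_eq0 eq_le h nrm_ge0.
have [k1 hk1] := ex_pow2_lt (1 + 8 * Ca * nrm q) e0.
(* [k0] brings w into [kexh G k]; [k1] makes the errors of [p k] and of its coefficient l small. *)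
pose k := (k0 + k1)%N.
have h1 := hp k w (or_intror (kexh_le (leq_addr _ _) hk0)).
have h2 : nrm (comb F (p k) w - (p k)`_l * q) <= 2 * (A0 * d).
  rewrite -sum_coef_delta.
  exact: (@comb_near (p k) w A0 d (fun j : nat => if l == j then q else 0) d0 (hA0 k) hq).
have h3 : nrm ((p k)`_l * q - c l * q) <= 8 * Ca / 2 ^+ k * nrm q.
  by rewrite -mulrBl nrmM ler_wpM2r ?nrm_ge0// nrmBC.
have h4 : (2 ^+ k)^-1 + 8 * Ca / 2 ^+ k * nrm q <= e.
  rewrite (_ : _ + _ = (1 + 8 * Ca * nrm q) / 2 ^+ k); last by ring.
  have p0 : 0 <= 1 + 8 * Ca * nrm q by rewrite addr_ge0// !mulr_ge0 ?nrm_ge0// ltW.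
  apply: le_trans (ltW hk1); rewrite ler_wpM2l//.
  by rewrite lef_pV2 ?posrE ?exprn_gt0// ler_weXn2l ?ler1n// leq_addl.
have h5 := nrm_tri (comb F (p k) w) (ext f w) (c l * q).
have h6 := nrm_tri ((p k)`_l * q) (comb F (p k) w) (c l * q).
rewrite -mulrA; lra.
Qed.

End expansion.

Lemma injective_unbounded (g : nat -> nat) : injective g -> forall N, exists k, (N <= g k)%N.
Proof.
move=> gi N; apply: contrapT => h.
have gN k : (g k < N)%N by rewrite ltnNge; apply/negP => Nk; apply: h; exists k.
have : injective (fun k : 'I_N.+1 => Ordinal (gN k)) by move=> i j [/gi/val_inj].
by move=> /leq_card; rewrite !card_ord ltnn.
Qed.

(** Inclusion is asked from some index on, because nu will also be constrained by its label. *)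
Lemma exhaustive_absorb (T : topologicalType) (K : nat -> set T) (L : set T) :
  exhaustive K -> compact L -> exists N, forall nu, (N <= nu)%N -> L `<=` K nu.
Proof.
move=> [_ KT KS] /compact_near_coveringP/(_ nat \oo (fun nu x => K nu x))[].
  move=> x _; have [nu _ Kx] : (\bigcup_nu K nu) x by rewrite KT.
  exists ((K nu.+1)°, [set m | (nu < m)%N]) => /=.
    split; last by exists nu.+1.
    by apply: open_nbhs_nbhs; split; [exact: open_interior|exact: KS].
  have mono m : (nu < m)%N -> K nu.+1 `<=` K m.
    elim: m => // m IH; rewrite ltnS leq_eqVlt => /orP[/eqP -> //|/IH h].
    by apply: subset_trans h _ => y /KS/interior_subset.
  by move=> [y m] /= [/interior_subset Ky /mono]; apply.
by move=> N _ h; exists N.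
Qed.

(** * Labels and rational polynomials *)

Section decoding.
Context {R : realType}.
Local Notation C := (R[i]^o).

(* Every pair occurs at infinitely many indices. *)
Definition decode (nu : nat) : nat * seq (rat * rat) :=
  oapp fst (0%N, [::]) (@choice.unpickle ((nat * seq (rat * rat)) * nat)%type nu).

Lemma decode_unbounded l q N : exists2 nu, (N <= nu)%N & decode nu = (l, q).
Proof.
have [|k hk] := @injective_unbounded (fun k => choice.pickle ((l, q), k)) _ N.
  by move=> i j /(pcan_inj choice.pickleK)[].
by exists (choice.pickle ((l, q), k)) => //; rewrite /decode choice.pickleK.
Qed.

(** Since f composed with phi_n will be close to c P, it is g / c that has to be approximated.
    Runge's theorem is applied on the hull of [L], which lies in [G] by simple connectedness. *)
Lemma ratpoly_hol (G : set C) (sG : simply_connected G) (oG : open G) (g : hol G) (L : set G)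
    (c : C) (e : R) : compact L -> c != 0 -> 0 < e ->
  exists q, forall x, L x -> nrm (c * (ratpoly q).[set_val x] - g x) <= e.
Proof.
move=> cL c0 e0; have cK := compact_set_val cL.
have KG : (set_val @` L : set C) `<=` G by move=> _ [x _ <-]; exact: set_valG.
have e2 : 0 < e / 2 by rewrite divr_gt0.
have c1 : 0 < nrm c by rewrite nrm_gt0.
have cH := compact_hull cK.
have [|p hp] := runge cH _ oG (hull_simply_connected sG cK KG) (@hol_holo _ _ g) e2.
  by rewrite hullK.
have [B hB] := ((compactP _).1 cK).2; have e3 : 0 < e / 2 / nrm c by rewrite divr_gt0.
have [q hq] := ratpoly_dense (c^-1 *: p) B e3; exists q => x Lx.
have Kx : (set_val @` L) (set_val x : C) by exists x.
have := hp _ (sub_hull Kx); rewrite extE nrmBC => h1.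
have h2 : nrm (c * (ratpoly q).[set_val x] - p.[set_val x]) <= e / 2.
  rewrite (_ : _ - _ = - (c * ((c^-1 *: p).[set_val x] - (ratpoly q).[set_val x]))); last first.
    by rewrite hornerZ mulrBr mulrA mulfV// mul1r opprB.
  rewrite nrmN nrmM mulrC -ler_pdivlMr//; apply: hq; exact: hB.
have := nrm_tri p.[set_val x] (c * (ratpoly q).[set_val x]) (g x); lra.
Qed.

End decoding.

Theorem theorem3p2 (R : realType) (G : set R[i]^o) (G_nonempty : G !=set0)
    (G_open : open G) (G_connected : connected G)
    (G_simply_connected : simply_connected G)
    (phi : nat -> G -> G)
    (phi_holomorphic : forall n, holomorphic (set_val \o phi n))
    (phi_univalent : forall n, injective (phi n))
    (phi_runaway : strongly_frequently_runaway phi) :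
  spaceable (FHC R (fun n => comp_op G_open (phi_holomorphic n))).
Proof.
have [K [A [exK cK [dA _ tE lf]]]] := phi_runaway.
have [z0 Gz0] := G_nonempty; have /openP/(_ _ Gz0)[e e0 he] := G_open.
(* The square of half side s that carries the Cauchy integrals lies in the disc of radius 2 s = e /
   2, itself inside [G]. *)
pose s := e / 4; have s0 : 0 < s by rewrite divr_gt0.
have BG : disc z0 (2 * s) `<=` G.
  by move=> w hw; apply: he; apply: le_lt_trans hw _; rewrite /s; move: e0; clear; lra.
have [Ca Ca0 hCa] := coef_estimate z0 s0.
have eta0 : 0 < (4 * Ca)^-1 by rewrite invr_gt0 mulr_gt0.
pose bp j : {poly R[i]^o} := ((rc s)^-1 *: ('X - z0%:P)) ^+ j.
have bpE j w : (bp j).[w] = basis z0 s j w by rewrite horner_exp hornerZ hornerXsubC.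
have [F [hF Fb Fphi]] := universal_family G_open G_simply_connected phi_holomorphic
  phi_univalent cK tE lf (fun nu => ((decode nu).1, ratpoly (decode nu).2)) BG eta0 bp.
have frame : sqframe z0 s `<=` disc z0 (2 * s) by move=> w /sqframe_box/sqbox_nrm.
have {}Fb l w : disc z0 (2 * s) w -> nrm (F l w - basis z0 s l w) <= (4 * Ca)^-1 * 2^-1 ^+ l.
  by rewrite -bpE; exact: Fb.
have coefs := hCa F (fun j => contS_sub frame (contS_sub BG (holo_contS (hF j))))
  (fun j w fw => Fb j w (frame w fw)).
exists (closed_span F); split.
- exact: submod_closed_span.
- exact: closed_closed_span.
- exact: (@infinite_dim_span _ _ F hF G_open z0 s Ca BG Ca0 coefs).
move=> f Mf; have [->|f0] := eqVneq f 0; [by right|left].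
have [l [c [B [c0 B0 fE]]]] := span_expansion G_open G_connected s0 BG Ca0 coefs eta0 Fb Mf f0.
move=> V oV [g Vg]; have [L cL [d d0 hV]] := (hol_nbhsP g V).1 (open_nbhs_nbhs (conj oV Vg)).
have d2 : 0 < d / 2 by rewrite divr_gt0.
have [q hq] := ratpoly_hol G_simply_connected G_open g cL c0 d2.
have [N1 hN1] := exhaustive_absorb exK cL.
have [N2 hN2] := ex_pow2_lt B d2.
(* nu >= N1 puts [L] inside [K nu], and nu >= N2 makes B 2^-nu < d / 2; the other half of d is spent
   on the rational polynomial. *)
have [nu Nnu dnu] := decode_unbounded l q (N1 + N2).
have [X fX hX] := Fphi nu.
apply: (density_gt0_sub fX _ (dA nu)) => n [An nXn]; apply: hV => x Lx.
have Kx : K nu x by apply: hN1 Lx; exact: leq_trans (leq_addr _ _) Nnu.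
have h1 : nrm (ext f (set_val (phi n x)) - c * (ratpoly q).[set_val x]) <= B * 2^-1 ^+ nu.
  (* The tolerance 2^-(j + nu) factors as 2^-nu 2^-j, so the expansion applies with d = 2^-nu. *)
  apply: fE => [||j]; [exact: set_valG|by rewrite exprn_ge0// invr_ge0|].
  by rewrite -exprD addnC; have := hX n An nXn x Kx j; rewrite dnu.
have h2 : B * 2^-1 ^+ nu < d / 2.
  apply: le_lt_trans hN2; rewrite ler_pM2l// exprVn lef_pV2 ?posrE ?exprn_gt0//.
  by rewrite ler_weXn2l ?ler1n//; exact: leq_trans (leq_addl _ _) Nnu.
have h3 := hq x Lx.
have := nrm_tri (c * (ratpoly q).[set_val x]) (ext f (set_val (phi n x))) (g x).
rewrite extE in h1 *; move=> h4; apply: (@le_lt_trans _ _ _ _ _ h4).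
by move: h1 h2 h3; clear; lra.
Qed.
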